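(* The set $\mathrm{FH}=\{X\in\mathrm{SF}\mid X\text{ is a Fréchet-Hilbert space}\}$ is Borel in $\mathrm{SF}$, and so are the isomorphism classes $\langle\mathbb{R}^{\mathbb{N}}\rangle$, $\langle\ell_2^{\mathbb{N}}\rangle$ and $\langle\ell_2\oplus\mathbb{R}^{\mathbb{N}}\rangle$.
   Context: A Fréchet space is a completely metrizable locally convex topological vector space (real scalars) whose topology can be defined by an invariant metric. $C(\mathbb{R})$ is the Fréchet space of continuous real-valued functions on $\mathbb{R}$ with the topology of uniform convergence on compact sets; every separable Fréchet space is isomorphic to a closed subspace of it. $\mathrm{SF}=\{X\subseteq C(\mathbb{R})\mid X\text{ is a closed vector subspace}\}$ with the Effros Borel structure, i.e., the $\sigma$-algebra generated by the sets $\{X\in\mathrm{SF}\mid X\cap U\neq\emptyset\}$, $U\subseteq C(\mathbb{R})$ open; it is a standard Borel space. A Fréchet space is Hilbertian if it is linearly homeomorphic to a Hilbert space (possibly finite dimensional). A Fréchet space $X$ is Fréchet-Hilbert if there is a sequence $(\|\cdot\|_n)_n$ of pseudonorms (seminorms) on $X$ generating its topology such that each quotient $X/\{x\in X\mid\|x\|_n=0\}$ is Hilbertian. For a separable Fréchet space $Y$, $\langle Y\rangle=\{X\in\mathrm{SF}\mid X\cong Y\}$, where $\cong$ denotes linear isomorphism (linear homeomorphism). Countable powers $\mathbb{R}^{\mathbb{N}}$, $\ell_2^{\mathbb{N}}$ carry the product topology. *)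

(* Defs.v *)
From HB Require Import structures.
From mathcomp Require Import all_boot all_order all_algebra.
From mathcomp Require Import generic_quotient ring_quotient sesquilinear.
From mathcomp Require Import all_classical all_reals all_analysis.
From mathcomp Require Import ring lra.

Set Implicit Arguments.
Unset Strict Implicit.
Unset Printing Implicit Defensive.

Import Order.TTheory GRing.Theory Num.Theory.
Import numFieldNormedType.Exports.

Local Open Scope classical_set_scope.
Local Open Scope ring_scope.

Definition linear_homeo (R : numDomainType) (V W : preTopologicalLmodType R) :
    Prop :=
  exists (f : {linear V -> W}) (g : W -> V),
    [/\ continuous f, continuous g, cancel f g & cancel g f].

Section Subspace.
Context (R : numDomainType) (V : preTopologicalLmodType R) (S : submodClosed V).

Definition tvs_sub : Type := {x : V | x \in S}.

HB.instance Definition _ := SubChoice.on tvs_sub.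
HB.instance Definition _ := [SubChoice_isSubLmodule of tvs_sub by <:].
HB.instance Definition _ :=
  Topological.copy tvs_sub (initial_topology (val : tvs_sub -> V)).

End Subspace.

Section Quotient.
Context (R : numDomainType) (V : preTopologicalLmodType R) (S : submodClosed V).
Local Open Scope quotient_scope.

(* The library quotients Z-modules by a [zmodClosed] predicate; [submodClosed]
   does not record the closure under opposites, which follows from scaling. *)
Definition submod_mem : {pred V} := fun x => x \in S.

Fact submod_mem_zmod_closed : zmod_closed submod_mem.
Proof. exact: GRing.submod_closedB (submodClosedP S). Qed.

HB.instance Definition _ := GRing.isZmodClosed.Build V submod_mem
  submod_mem_zmod_closed.

Definition tvs_quot : Type := Quotient.quot submod_mem.

HB.instance Definition _ :=
  Topological.copy tvs_quot (quotient_topology (Quotient.quot submod_mem)).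
HB.instance Definition _ := @GRing.isZmodule.Build tvs_quot _ _ _
  (@Quotient.addqA _ submod_mem) (@Quotient.addqC _ submod_mem)
  (@Quotient.add0q _ submod_mem) (@Quotient.addNq _ submod_mem).

Let pi (x : V) : tvs_quot := \pi_(Quotient.quot submod_mem) x.
Let piK (x : tvs_quot) : pi (repr x) = x.
Proof. exact: reprK. Qed.
Let piD x y : pi (x + y) = pi x + pi y.
Proof. exact: Quotient.pi_add. Qed.
Let pi_eq x y : pi x = pi y <-> x - y \in S.
Proof.
rewrite -[_ \in S]/(x - y \in submod_mem) Quotient.idealrBE.
by split=> [pixy|/eqP //]; exact/eqP.
Qed.

Definition tvs_quot_scale (a : R) (x : tvs_quot) : tvs_quot :=
  \pi_(Quotient.quot submod_mem) (a *: repr x).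

Let pi_scale a x : pi (a *: x) = tvs_quot_scale a (pi x).
Proof.
by apply/pi_eq; rewrite -scalerBr rpredZ//; apply/pi_eq; rewrite piK.
Qed.

Fact tvs_quot_scaleA a b v :
  tvs_quot_scale a (tvs_quot_scale b v) = tvs_quot_scale (a * b) v.
Proof. by rewrite -[v]piK -!pi_scale scalerA. Qed.

Fact tvs_quot_scale1 : left_id 1 tvs_quot_scale.
Proof. by move=> v; rewrite -[v]piK -pi_scale scale1r. Qed.

Fact tvs_quot_scaleDr : right_distributive tvs_quot_scale +%R.
Proof.
by move=> a u v; rewrite -[u]piK -[v]piK -piD -!pi_scale scalerDr piD.
Qed.

Fact tvs_quot_scaleDl v :
  {morph tvs_quot_scale^~ v : a b / a + b}.
Proof. by move=> a b /=; rewrite -[v]piK -!pi_scale scalerDl piD. Qed.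

HB.instance Definition _ := GRing.Zmodule_isLmodule.Build R tvs_quot
  tvs_quot_scaleA tvs_quot_scale1 tvs_quot_scaleDr tvs_quot_scaleDl.

End Quotient.

Section CountablePower.
Context (R : numDomainType) (V : preTopologicalLmodType R).

Definition countable_power : Type := nat -> V.

HB.instance Definition _ := GRing.Lmodule.copy countable_power (nat -> V).
HB.instance Definition _ :=
  Topological.copy countable_power {ptws nat -> V}.

End CountablePower.

Section DirectSum.
Context (R : numDomainType) (V W : preTopologicalLmodType R).

Definition direct_sum : Type := (V * W)%type.

HB.instance Definition _ := GRing.Lmodule.copy direct_sum (V * W)%type.
HB.instance Definition _ := Topological.copy direct_sum (V * W)%type.

End DirectSum.

Section SquareSummable.
Context (R : realType).
Implicit Types x y : nat -> R.

Definition square_summable : {pred nat -> R} :=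
  fun x => `[< cvgn (series (x * x)) >].

Let cvg_sdot x y : x \in square_summable -> y \in square_summable ->
  cvgn (series (x * y)).
Proof.
move=> /asboolP cx /asboolP cy; apply: (@normed_cvg _ R^o).
apply: (@series_le_cvg _ _ (x * x + y * y)) => [n|n|n|].
- exact: normr_ge0.
- by rewrite /= addr_ge0// -expr2 sqr_ge0.
- rewrite /=; have -> : (x * y) n = x n * y n by [].
  have -> : (x * x + y * y) n = x n ^+ 2 + y n ^+ 2 by [].
  rewrite normrM -(real_normK (num_real (x n))) -(real_normK (num_real (y n))).
  by have := sqr_ge0 (`|x n| - `|y n|); nra.
- exact: is_cvg_seriesD.
Qed.

Fact square_summable_closed : GRing.subsemimod_closed square_summable.
Proof.
split; first split.
- apply/asboolP; have -> : 0 * 0 = 0 :> (nat -> R) by rewrite mulr0.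
  rewrite (_ : series _ = cst 0); first exact: is_cvg_cst.
  by apply/funext => n; rewrite /series/= big1.
- move=> x y Sx Sy; apply/asboolP; rewrite mulrDl !mulrDr.
  by apply: is_cvg_seriesD; apply: is_cvg_seriesD; exact: cvg_sdot.
- move=> a x Sx; apply/asboolP.
  rewrite (_ : _ * _ = (a * a) *: (x * x)).
    by apply: is_cvg_seriesZ; exact: cvg_sdot.
  apply/funext => n.
  by change (a * x n * (a * x n) = a * a * (x n * x n)); ring.
Qed.

HB.instance Definition _ := GRing.isSubmodClosed.Build R (nat -> R)
  square_summable square_summable_closed.

Definition ell2 : Type := {x : nat -> R | x \in square_summable}.

HB.instance Definition _ := SubChoice.on ell2.
HB.instance Definition _ := [SubChoice_isSubLmodule of ell2 by <:].

Definition ell2_dot (x y : ell2) : R := limn (series (val x * val y)).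

Definition ell2_norm (x : ell2) : R := Num.sqrt (ell2_dot x x).

Implicit Types u v w : ell2.

Let ell2_cvg u v : cvgn (series (val u * val v)).
Proof. exact: cvg_sdot (valP u) (valP v). Qed.

Fact ell2_dotC u v : ell2_dot u v = ell2_dot v u.
Proof. by rewrite /ell2_dot mulrC. Qed.

Fact ell2_dotDl u v w : ell2_dot (u + v) w = ell2_dot u w + ell2_dot v w.
Proof.
rewrite /ell2_dot raddfD/= mulrDl.
by rewrite (lim_seriesD (@ell2_cvg _ _) (@ell2_cvg _ _)). Qed.

Fact ell2_dotZl a u v : ell2_dot (a *: u) v = a * ell2_dot u v.
Proof.
rewrite /ell2_dot (_ : _ * _ = a *: (val u * val v)).
  by rewrite (lim_seriesZ _ (@ell2_cvg _ _)).
apply/funext => n.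
by change (a * val u n * val v n = a * (val u n * val v n)); rewrite mulrA.
Qed.

Let dot_term_le u n : val u n ^+ 2 <= ell2_dot u u.
Proof.
have nd : nondecreasing_seq (series (val u * val u)).
  by apply/nondecreasing_series => i _ _; exact: sqr_ge0.
apply: (le_trans _ (nondecreasing_cvgn_le nd (@ell2_cvg u u) n.+1)).
rewrite seriesSr expr2 lerDr /series/=.
by apply: sumr_ge0 => i _; exact: sqr_ge0.
Qed.

Fact ell2_dot_ge0 u : 0 <= ell2_dot u u.
Proof. exact: le_trans (sqr_ge0 (val u 0%N)) (dot_term_le u 0%N). Qed.

Fact ell2_dot_eq0 u : ell2_dot u u = 0 -> u = 0.
Proof.
move=> u0; apply/val_inj/funext => n; apply/eqP.
by rewrite -sqrf_eq0 eq_le sqr_ge0 -u0 dot_term_le.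
Qed.

Fact ell2_CauchySchwarz u v :
  ell2_dot u v ^+ 2 <= ell2_dot u u * ell2_dot v v.
Proof.
have [v0|v_neq0] := eqVneq (ell2_dot v v) 0.
  rewrite (ell2_dot_eq0 v0) [ell2_dot u 0]ell2_dotC -(scale0r 0).
  by rewrite !ell2_dotZl !mul0r mulr0 expr0n.
have v_gt0 : 0 < ell2_dot v v by rewrite lt_def v_neq0 ell2_dot_ge0.
pose b := ell2_dot v v; pose c := ell2_dot u v.
have := ell2_dot_ge0 (b *: u + (- c) *: v).
have -> : ell2_dot (b *: u + (- c) *: v) (b *: u + (- c) *: v)
    = b * (ell2_dot u u * b - c ^+ 2).
  rewrite !ell2_dotDl !ell2_dotZl ![ell2_dot _ (_ + _)]ell2_dotC.
  rewrite !ell2_dotDl !ell2_dotZl [ell2_dot v u]ell2_dotC -/b -/c; ring.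
by rewrite pmulr_rge0// subr_ge0.
Qed.

Fact ell2_normD u v : ell2_norm (u + v) <= ell2_norm u + ell2_norm v.
Proof.
rewrite -(@ler_pXn2r _ 2)// ?nnegrE ?addr_ge0 ?sqrtr_ge0//.
rewrite sqrrD !sqr_sqrtr ?ell2_dot_ge0//.
rewrite ell2_dotDl ![ell2_dot _ (_ + _)]ell2_dotC !ell2_dotDl.
rewrite [ell2_dot v u]ell2_dotC -sqrtrM ?ell2_dot_ge0//.
have : ell2_dot u v <= Num.sqrt (ell2_dot u u * ell2_dot v v).
  apply: (le_trans (ler_norm _)); rewrite -sqrtr_sqr ler_wsqrtr//.
  exact: ell2_CauchySchwarz.
by move=> ?; lra.
Qed.

Fact ell2_normZ a u : ell2_norm (a *: u) = `|a| * ell2_norm u.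
Proof.
rewrite /ell2_norm ell2_dotZl ell2_dotC ell2_dotZl mulrA -expr2.
by rewrite sqrtrM ?sqr_ge0// sqrtr_sqr.
Qed.

Fact ell2_norm_eq0 u : ell2_norm u = 0 -> u = 0.
Proof.
move=> /eqP; rewrite sqrtr_eq0 => u0.
by apply: ell2_dot_eq0; apply/eqP; rewrite eq_le u0 ell2_dot_ge0.
Qed.

HB.instance Definition _ := Lmodule_isNormed.Build R ell2
  ell2_normD ell2_normZ ell2_norm_eq0.

End SquareSummable.

Section FrechetHilbert.
Context (R : realType).

Definition hilbert_space (H : completeNormedModType R) : Prop :=
  exists ip : {dot H for @idfun R}, forall x, `|x| ^+ 2 = ip x x.

Definition hilbertian (V : preTopologicalLmodType R) : Prop :=
  exists2 H : completeNormedModType R, hilbert_space H & linear_homeo V H.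

Record seminorm (V : lmodType R) := Seminorm {
  seminorm_fun :> V -> R;
  seminormD : forall x y,
    seminorm_fun (x + y) <= seminorm_fun x + seminorm_fun y;
  seminormZ : forall a x, seminorm_fun (a *: x) = `|a| * seminorm_fun x }.

Definition seminorm_ker (V : lmodType R) (p : seminorm V) : {pred V} :=
  fun x => p x == 0.

Fact seminorm_ker_closed (V : lmodType R) (p : seminorm V) :
  GRing.subsemimod_closed (seminorm_ker p).
Proof.
have p0 : p 0 = 0 by rewrite -(scale0r 0) seminormZ normr0 mul0r.
have pN x : p (- x) = p x by rewrite -scaleN1r seminormZ normrN1 mul1r.
have p_ge0 x : 0 <= p x.
  by have := seminormD p x (- x); rewrite subrr p0 pN; lra.
split; first split.
- exact/eqP.
- move=> x y /eqP px /eqP py; apply/eqP/le_anti; rewrite p_ge0 andbT.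
  by have := seminormD p x y; rewrite px py addr0.
- by move=> a x /eqP px; apply/eqP; rewrite seminormZ px mulr0.
Qed.

HB.instance Definition _ (V : lmodType R) (p : seminorm V) :=
  GRing.isSubmodClosed.Build R V (seminorm_ker p) (seminorm_ker_closed p).

Definition seminorms_generate (V : preTopologicalLmodType R)
    (p : nat -> seminorm V) : Prop :=
  forall (x : V) (A : set V), nbhs x A <->
    exists n (e : R), [/\ 0 < e &
      forall y, (forall i, (i <= n)%N -> p i (y - x) < e) -> A y].

(* The quotients carry the quotient topology; their spaces are Frechet whenever
   [V] is, which holds for all closed subspaces of [CR] below. *)
Definition frechet_hilbert (V : preTopologicalLmodType R) : Prop :=
  exists2 p : nat -> seminorm V, seminorms_generate p &
    forall n, hilbertian (tvs_quot (seminorm_ker (p n))).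

End FrechetHilbert.

Section EffrosBorel.
Context (R : realType).

Definition compact_convergence : Type := {family compact, R -> R}.

HB.instance Definition _ := GRing.Lmodule.copy compact_convergence (R -> R^o).
HB.instance Definition _ :=
  Topological.copy compact_convergence {family compact, R -> R}.

Definition continuous_mem : {pred compact_convergence} :=
  fun f => `[< continuous (f : R -> R) >].

Fact continuous_mem_closed : GRing.subsemimod_closed continuous_mem.
Proof.
split; first split.
- by apply/asboolP => x; exact: cvg_cst.
- move=> f g /asboolP cf /asboolP cg; apply/asboolP => x.
  by apply: (@cvgD _ R^o); [exact: cf|exact: cg].
- move=> a f /asboolP cf; apply/asboolP => x.
  by apply: (@cvgZl_tmp _ R^o); exact: cf.
Qed.

HB.instance Definition _ := GRing.isSubmodClosed.Build R compact_convergence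
  continuous_mem continuous_mem_closed.

Definition CR : preTopologicalLmodType R := tvs_sub continuous_mem.

Record SF := MkSF {
  SF_set :> set CR;
  SF_closed : closed SF_set;
  SF_submod : submod_closed (fun f => f \in SF_set) }.

Definition SF_mem (X : SF) : {pred CR} := fun f => f \in SF_set X.

Fact SF_mem_closed (X : SF) : GRing.subsemimod_closed (SF_mem X).
Proof. exact: GRing.submod_closed_semi (SF_submod X). Qed.

HB.instance Definition _ (X : SF) :=
  GRing.isSubmodClosed.Build R CR (SF_mem X) (SF_mem_closed X).

Definition SF_tvs (X : SF) : preTopologicalLmodType R := tvs_sub (SF_mem X).

Definition effros_borel : set (set SF) :=
  <<s [set [set X : SF | (X `&` U !=set0)%classic] | U in @open CR] >>.

Definition FH : set SF := [set X | frechet_hilbert (SF_tvs X)].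

Definition iso_class (Y : preTopologicalLmodType R) : set SF :=
  [set X | linear_homeo (SF_tvs X) Y].

End EffrosBorel.

Arguments FH R : clear implicits.

Definition real_seq (R : realType) : preTopologicalLmodType R :=
  countable_power (R^o : preTopologicalLmodType R).

Definition ell2_seq (R : realType) : preTopologicalLmodType R :=
  countable_power (ell2 R : preTopologicalLmodType R).

Definition ell2_plus_real_seq (R : realType) : preTopologicalLmodType R :=
  direct_sum (ell2 R : preTopologicalLmodType R) (real_seq R).

(* Main.v *)
Require Import Defs.
From HB Require Import structures.
From mathcomp Require Import all_boot all_order all_algebra.
From mathcomp Require Import generic_quotient ring_quotient sesquilinear.
From mathcomp Require Import all_classical all_reals all_analysis.
From mathcomp Require Import ring lra.

Set Implicit Arguments.
Unset Strict Implicit.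
Unset Printing Implicit Defensive.

Import Order.TTheory GRing.Theory Num.Theory.
Import numFieldNormedType.Exports.

Local Open Scope classical_set_scope.
Local Open Scope ring_scope.


(** Let [P m x] be the supremum of [|x|] on [[-m, m]], for [x] in a closed subspace
    [X] of the space of continuous functions. Each of the four sets of subspaces
    is described by countably many conditions on these seminorms that quantify
    over finite tuples of [X] through open conditions only. Such conditions are
    Borel ([borel_open]): an open set of tuples is a countable union of products of
    balls, and whether [X] meets a ball is a generator of the Effros structure. The
    content is that the following conditions suffice.

    [hilbertizable]: the topology of [X] is generated by Hilbertian seminorms.
    What is required is the existence, for each finite tuple and each error, of a
    matrix that lies between two seminorms on the combinations of the tuple. By
    compactness ([qform_between]) these matrices fit together to a quadratic form
    on [X].

    [quojective]: every [P n]-ball is, up to [P m]-closure, bounded for all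
    seminorms. Then the completions of [X] for a suitable sequence of forms have
    as successive quotients Hilbert spaces that stabilize, and splitting off
    orthogonal complements writes [X] as a countable product of Hilbert spaces
    ([product_like_of_chain], [product_like_exists]). The quotients are described
    inside [X] by relaxation: the largest form below [B] that is lower
    semicontinuous for [A].

    Conversely such products satisfy both conditions, and the dimensions of the
    factors show in three more conditions. Some factor is infinite-dimensional
    exactly when [non_schwartz] holds, infinitely many are exactly when
    [infinite_steps] holds, and only finitely many are nonzero exactly when the
    space is [normable]. Merging consecutive factors identifies the powers of the
    line and of l2 and their mixed sum ([real_seqP], [ell2_seqP], [ell2_plusP]).

    The Frechet-Hilbert property is
    [hilbertizable /\ (quojective \/ non_schwartz)] ([frechet_hilbertP]). The
    sequence of seminorms in its definition need not be increasing, so that a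
    Frechet-Hilbert space need not be a product of Hilbert spaces. If one of the
    Hilbert quotients is infinite-dimensional, the open mapping onto it excludes
    the Schwartz property; otherwise the local Hilbert spaces are
    finite-dimensional and [X] is quojective. In the other direction, a quojection
    that is Schwartz is a product of finite-dimensional spaces, and the kernels of
    functionals give the structure. If [X] is hilbertizable and not Schwartz, every
    Hilbertian seminorm is dominated by finitely many quotient maps of [X] onto l2
    ([covering_quotients]): each is built from vectors that are orthonormal for the
    given form and bounded for further seminorms, which makes the map onto and
    open, and together they recover all coordinates of an orthonormal basis. *)

(** * Quadratic forms of Hilbertian seminorms *)

(** A seminorm is Hilbertian when its square satisfies the parallelogram law;
    the square is recorded because sums, differences and limits of squares are
    again of this kind. *)
Record qform (R : realType) (V : lmodType R) := QForm {
  qf :> V -> R;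
  qf_ge0 : forall x, 0 <= qf x;
  qfZ : forall a x, qf (a *: x) = a ^+ 2 * qf x;
  qf_par : forall x y, qf (x + y) + qf (x - y) = 2 * (qf x + qf y) }.

Section RealBounds.
Context (R : realType).

Lemma le_natr_bound (c : R) : exists n : nat, c <= n%:R.
Proof. by exists (Num.truncn c).+1; exact/ltW/truncnS_gt. Qed.

Lemma small_invS (e : R) : 0 < e -> exists N, forall n, (N <= n)%N -> (n.+1%:R^-1 : R) < e.
Proof.
move=> e0; exists (Num.truncn e^-1) => n Nn.
rewrite invf_plt ?posrE ?ltr0n//; apply: (lt_le_trans (truncnS_gt _)).
by rewrite ler_nat ltnS.
Qed.

Lemma natr_mul_sum n (d : R) : n%:R * d = \sum_(i < n) d.
Proof. by rewrite sumr_const card_ord mulr_natl. Qed.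

Lemma sum_sqr_mono (f : nat -> R) m n : (m <= n)%N ->
  \sum_(i < m) f i ^+ 2 <= \sum_(i < n) f i ^+ 2.
Proof.
move=> /subnKC <-; rewrite big_split_ord/= lerDl.
by apply: sumr_ge0 => *; exact: sqr_ge0.
Qed.

Lemma common_bound (T : Type) (F G : nat -> T -> R) n :
  (forall m k x, (m <= k)%N -> G m x <= G k x) -> (forall k x, 0 <= G k x) ->
  (forall i, (i <= n)%N -> exists m (C : R), 0 <= C /\ forall x, F i x <= C * G m x) ->
  exists m (C : R), 0 <= C /\ forall i x, (i <= n)%N -> F i x <= C * G m x.
Proof.
move=> Gmono G0; elim: n => [|n IH] H.
  have [m [C [C0 h]]] := H 0%N isT; exists m, C; split => // i x.
  by rewrite leqn0 => /eqP->.
have [m [C [C0 hC]]] := IH (fun i il => H i (leqW il)).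
have [k [D [D0 hD]]] := H n.+1 (leqnn _); exists (maxn m k), (C + D).
split; first exact: addr_ge0.
move=> i x; rewrite leq_eqVlt => /predU1P[->|il].
  by apply: (le_trans (hD x)); apply: ler_pM; rewrite ?G0 ?lerDr// Gmono// leq_maxr.
by apply: (le_trans (hC i x il)); apply: ler_pM; rewrite ?G0 ?lerDl// Gmono// leq_maxl.
Qed.

End RealBounds.

Section Polar.
Context (R : realType) (V : lmodType R).
Implicit Types (q : qform V) (x y z : V) (a b : R).

Definition polar q x y : R := (q (x + y) - q (x - y)) / 4.

Lemma qf0 q : q 0 = 0.
Proof. by rewrite -(scale0r 0) qfZ expr0n mul0r. Qed.

Lemma qfN q x : q (- x) = q x.
Proof. by rewrite -scaleN1r qfZ sqrrN expr1n mul1r. Qed.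

Lemma qfC q x y : q (x - y) = q (y - x).
Proof. by rewrite -qfN opprB. Qed.

Lemma polarC q x y : polar q x y = polar q y x.
Proof. by rewrite /polar (addrC x y) (qfC q x y). Qed.

Lemma polarxx q x : polar q x x = q x.
Proof.
rewrite /polar subrr qf0 subr0 -mulr2n -scaler_nat qfZ; lra.
Qed.

Lemma qfD q x y : q (x + y) = q x + q y + 2 * polar q x y.
Proof. by have := qf_par q x y; rewrite /polar; lra. Qed.

Lemma polarNl q x y : polar q (- x) y = - polar q x y.
Proof.
rewrite /polar -opprD qfN (addrC (- x)) (qfC q y x); lra.
Qed.

Lemma polarNr q x y : polar q x (- y) = - polar q x y.
Proof. by rewrite polarC polarNl polarC. Qed.

Lemma qfB q x y : q (x - y) = q x + q y - 2 * polar q x y.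
Proof. by rewrite qfD qfN polarNr; lra. Qed.

Lemma polar0l q y : polar q 0 y = 0.
Proof. by rewrite /polar add0r sub0r qfN subrr mul0r. Qed.

Let polar_par q x y z :
  polar q (x + z) y + polar q (x - z) y = 2 * polar q x y.
Proof.
have h1 := qf_par q (x + y) z; have h2 := qf_par q (x - y) z.
rewrite /polar.
have -> : x + z + y = x + y + z by rewrite addrAC.
have -> : x - z + y = x + y - z by rewrite addrAC.
have -> : x + z - y = x - y + z by rewrite addrAC.
have -> : x - z - y = x - y - z by rewrite addrAC.
lra.
Qed.

Let polar_double q x y : polar q (x *+ 2) y = 2 * polar q x y.
Proof.
by have := polar_par q x y x; rewrite subrr polar0l addr0 -mulr2n.
Qed.

Lemma polarDl q x y z : polar q (x + y) z = polar q x z + polar q y z.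
Proof.
have h := polar_par q (2^-1 *: (x + y)) z (2^-1 *: (x - y)).
have d := polar_double q (2^-1 *: (x + y)) z.
have halfK u : 2^-1 *: u + 2^-1 *: u = u :> V.
  by rewrite -scalerDl (_ : 2^-1 + 2^-1 = 1) ?scale1r//; field.
rewrite mulr2n halfK in d.
have e3 : 2^-1 *: (x + y) + 2^-1 *: (x - y) = x.
  by rewrite -scalerDr addrACA subrr addr0 scalerDr halfK.
have e4 : 2^-1 *: (x + y) - 2^-1 *: (x - y) = y.
  by rewrite -scalerBr opprB addrC addrA subrK scalerDr halfK.
by rewrite e3 e4 -d in h.
Qed.

Lemma polarDr q x y z : polar q x (y + z) = polar q x y + polar q x z.
Proof. by rewrite polarC polarDl !(polarC q _ x). Qed.

Let polarMn q x y n : polar q (x *+ n) y = n%:R * polar q x y.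
Proof.
elim: n => [|n IH]; first by rewrite mulr0n polar0l mul0r.
by rewrite mulrS polarDl IH -natr1; lra.
Qed.

Let polar_bound q x y : `|polar q x y| <= (q x + q y) / 2.
Proof.
have h1 := qf_ge0 q (x + y); have h2 := qf_ge0 q (x - y).
by move: h1 h2; rewrite qfD qfB ler_norml => h1 h2; apply/andP; split; lra.
Qed.

(** An additive function that is bounded near [0] is linear: [t |-> polar (t x)
    y - t polar x y] is additive and vanishes at the integers, so its values at
    [n t] and at the fractional part of [n t] agree. *)
Lemma polarZl q a x y : polar q (a *: x) y = a * polar q x y.
Proof.
pose psi t := polar q (t *: x) y - t * polar q x y.
have psiD s t : psi (s + t) = psi s + psi t.
  by rewrite /psi scalerDl polarDl; lra.
have psi_nat n : psi n%:R = 0.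
  by rewrite /psi scaler_nat polarMn subrr.
have psiN t : psi (- t) = - psi t.
  by rewrite /psi scaleNr polarNl; lra.
have psiMn n t : psi (n%:R * t) = n%:R * psi t.
  elim: n => [|n IH]; first by rewrite !mul0r (psi_nat 0%N).
  by rewrite -natr1 mulrDl mul1r psiD IH; lra.
pose M := (q x + q y) / 2 + `|polar q x y|.
have psi_le1 t : 0 <= t <= 1 -> `|psi t| <= M.
  move=> /andP[t0 t1]; apply: (le_trans (ler_normB _ _)); apply: lerD.
    apply: (le_trans (polar_bound _ _ _)); rewrite qfZ.
    have : t ^+ 2 * q x <= 1 * q x.
      by rewrite ler_wpM2r ?qf_ge0// expr2 mulr_ile1.
    lra.
  by rewrite normrM (ger0_norm t0) ler_piMl.
suff psi0 t : 0 <= t -> psi t = 0.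
  have : psi a = 0.
    have [/psi0//|/ltW a0] := leP 0 a.
    by rewrite -(opprK a) psiN psi0 ?oppr0// oppr_ge0.
  by rewrite /psi => /eqP; rewrite subr_eq0 => /eqP.
move=> t0; apply/eqP; rewrite -normr_le0 leNgt; apply/negP => psi_gt0.
pose n := (Num.truncn (M / `|psi t|)).+1.
have hn : M < n%:R * `|psi t|.
  by rewrite -ltr_pdivrMr// truncnS_gt.
have nt0 : 0 <= n%:R * t by rewrite mulr_ge0.
have /andP[k1 k2] := truncn_itv nt0.
have e : psi (n%:R * t) = psi (n%:R * t - (Num.truncn (n%:R * t))%:R).
  by rewrite psiD psiN psi_nat subr0.
have h : `|psi (n%:R * t)| <= M.
  by rewrite e psi_le1// subr_ge0 k1/= lerBlDl natr1 ltW.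
by move: h; rewrite psiMn normrM ger0_norm// leNgt hn.
Qed.

Lemma polarZr q a x y : polar q x (a *: y) = a * polar q x y.
Proof. by rewrite polarC polarZl polarC. Qed.

Lemma polar0r q x : polar q x 0 = 0.
Proof. by rewrite polarC polar0l. Qed.

Lemma polarBl q x y z : polar q (x - y) z = polar q x z - polar q y z.
Proof. by rewrite polarDl polarNl. Qed.

Lemma polar_suml q (I : Type) (r : seq I) (P : pred I) (f : I -> V) y :
  polar q (\sum_(i <- r | P i) f i) y = \sum_(i <- r | P i) polar q (f i) y.
Proof.
by elim/big_rec2: _ => [|i u v _ <-]; rewrite ?polar0l// polarDl.
Qed.

Lemma polar_CS q x y : polar q x y ^+ 2 <= q x * q y.
Proof.
have h t : 0 <= q x + t ^+ 2 * q y - 2 * (t * polar q x y).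
  by have := qf_ge0 q (x - t *: y); rewrite qfB polarZr qfZ; lra.
have [y0|yn0] := eqVneq (q y) 0.
  rewrite y0 mulr0; have [->|pn0] := eqVneq (polar q x y) 0; first by rewrite expr0n.
  have := h ((q x + 1) / polar q x y).
  rewrite y0 mulr0 addr0 mulfVK//; have := qf_ge0 q x; lra.
have y_gt0 : 0 < q y by rewrite lt_def yn0 qf_ge0.
have := h (polar q x y / q y).
have -> : q x + (polar q x y / q y) ^+ 2 * q y - 2 * (polar q x y / q y * polar q x y)
   = q x - polar q x y ^+ 2 / q y by field.
by rewrite subr_ge0 ler_pdivrMr.
Qed.

Definition qnorm q x : R := Num.sqrt (q x).

Lemma qnorm_ge0 q x : 0 <= qnorm q x. Proof. exact: sqrtr_ge0. Qed.

Lemma qnorm_sqr q x : qnorm q x ^+ 2 = q x.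
Proof. by rewrite sqr_sqrtr ?qf_ge0. Qed.

Lemma qnormZ q a x : qnorm q (a *: x) = `|a| * qnorm q x.
Proof. by rewrite /qnorm qfZ sqrtrM ?sqr_ge0// sqrtr_sqr. Qed.

Lemma polar_le q x y : `|polar q x y| <= qnorm q x * qnorm q y.
Proof.
rewrite -(@ler_pXn2r _ 2)// ?nnegrE ?mulr_ge0 ?qnorm_ge0//.
by rewrite exprMn !qnorm_sqr real_normK ?num_real// polar_CS.
Qed.

Lemma qnormD q x y : qnorm q (x + y) <= qnorm q x + qnorm q y.
Proof.
rewrite -(@ler_pXn2r _ 2)// ?nnegrE ?addr_ge0 ?qnorm_ge0//.
rewrite sqrrD !qnorm_sqr qfD.
have := ler_norm (polar q x y); have := polar_le q x y; lra.
Qed.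

Definition qf_seminorm q : seminorm V := Seminorm (qnormD q) (qnormZ q).

Lemma qfD_le q x y : q (x + y) <= 2 * (q x + q y).
Proof. by have := qf_par q x y; have := qf_ge0 q (x - y); lra. Qed.

Lemma qfB_le q x y : q (x - y) <= 2 * (q x + q y).
Proof. by have := qfD_le q x (- y); rewrite qfN. Qed.

Lemma qf_trans q y x z : q (x - z) <= 2 * (q (x - y) + q (y - z)).
Proof. by have := qfD_le q (x - y) (y - z); rewrite addrA subrK. Qed.

Lemma polar_eq0 q x y : q x = 0 -> polar q x y = 0.
Proof.
move=> x0; apply/eqP; rewrite -sqrf_eq0 eq_le sqr_ge0 andbT.
by have := polar_CS q x y; rewrite x0 mul0r.
Qed.

Lemma qfD_eq0 q x y : q y = 0 -> q (x + y) = q x.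
Proof. by move=> y0; rewrite qfD y0 polarC polar_eq0// mulr0 !addr0. Qed.

End Polar.

Section SumSeminorm.
Context (R : realType) (V : lmodType R).
Implicit Types (p : seminorm V).

Lemma seminorm0 p : p 0 = 0.
Proof. by rewrite -(scale0r 0) seminormZ normr0 mul0r. Qed.

Lemma seminormN p x : p (- x) = p x.
Proof. by rewrite -scaleN1r seminormZ normrN1 mul1r. Qed.

Lemma seminorm_ge0 p x : 0 <= p x.
Proof. by have := seminormD p x (- x); rewrite subrr seminorm0 seminormN; lra. Qed.

Lemma seminormC p x y : p (x - y) = p (y - x).
Proof. by rewrite -seminormN opprB. Qed.

Lemma seminorm_trans p y x z : p (x - z) <= p (x - y) + p (y - z).
Proof. by have := seminormD p (x - y) (y - z); rewrite addrA subrK. Qed.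

Lemma seminorm_sum p (I : Type) (r : seq I) (Q : pred I) (f : I -> V) :
  p (\sum_(i <- r | Q i) f i) <= \sum_(i <- r | Q i) p (f i).
Proof.
elim/big_rec2: _ => [|i u v _ h]; first by rewrite seminorm0.
by apply: (le_trans (seminormD _ _ _)); rewrite lerD2l.
Qed.

Lemma seminorm_lin p n (a : nat -> R) (x : nat -> V) c :
  (forall i, (i < n)%N -> p (x i) <= c) ->
  p (\sum_(i < n) a i *: x i) <= c * \sum_(i < n) `|a i|.
Proof.
move=> h; apply: (le_trans (seminorm_sum _ _ _ _)); rewrite mulr_sumr.
by apply: ler_sum => i _; rewrite seminormZ mulrC ler_wpM2r// h.
Qed.

End SumSeminorm.

Section QformOps.
Context (R : realType) (V : lmodType R).
Implicit Types (q : qform V) (g : nat -> qform V).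

Definition qzero : qform V.
Proof.
by exists (fun=> 0); [|move=> *; rewrite mulr0|move=> *; rewrite !addr0 mulr0].
Defined.

Definition qadd q1 q2 : qform V.
Proof.
exists (fun x => q1 x + q2 x).
- by move=> x; rewrite addr_ge0 ?qf_ge0.
- by move=> a x; rewrite !qfZ mulrDr.
- by move=> x y; have := qf_par q1 x y; have := qf_par q2 x y; lra.
Defined.

Definition qsum (g : nat -> qform V) n : qform V :=
  iteri n (fun i => qadd ^~ (g i)) qzero.

Lemma qsumE g n x : qsum g n x = \sum_(i < n) g i x.
Proof. by elim: n => [|n IH]; rewrite ?big_ord0// big_ord_recr/= IH. Qed.

Definition qsub q1 q2 (le12 : forall x, q2 x <= q1 x) : qform V.
Proof.
exists (fun x => q1 x - q2 x).
- by move=> x; rewrite subr_ge0.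
- by move=> a x; rewrite !qfZ mulrBr.
- by move=> x y; have := qf_par q1 x y; have := qf_par q2 x y; lra.
Defined.

Definition qcomp (W : lmodType R) (f : {linear W -> V}) q : qform W.
Proof.
exists (fun x => q (f x)).
- by move=> x; exact: qf_ge0.
- by move=> a x; rewrite linearZ qfZ.
- by move=> x y; rewrite linearD linearB qf_par.
Defined.

Lemma ler_qsum g n x i : (i < n)%N -> g i x <= qsum g n x.
Proof.
move=> lin; rewrite qsumE (bigD1 (Ordinal lin))//= lerDl.
by apply: sumr_ge0 => j _; exact: qf_ge0.
Qed.

Lemma qsum_mono g m n x : (m <= n)%N -> qsum g m x <= qsum g n x.
Proof.
move=> /subnK <-; elim: (n - m)%N => [|k IH]//.
by apply: (le_trans IH); rewrite addSn /= lerDl qf_ge0.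
Qed.

End QformOps.

(** * Relaxation of a quadratic form *)

Section Relaxation.
Context (R : realType) (V : lmodType R).
Implicit Types (q : qform V) (x y z : V).

Lemma le_of_lt_add (a b : R) : (forall e, 0 < e -> a < b + e) -> a <= b.
Proof. by move=> h; apply/ler_addgt0Pr => e e0; exact/ltW/h. Qed.

(** Both laws of a quadratic form follow from one inequality each, by applying
    the inequality once more to the transformed vectors. *)
Lemma qform_of_le (q : V -> R) : (forall x, 0 <= q x) ->
  (forall a x, q (a *: x) <= a ^+ 2 * q x) ->
  (forall x y, q (x + y) + q (x - y) <= 2 * (q x + q y)) ->
  exists q' : qform V, q' =1 q.
Proof.
move=> q0 qle qpar.
have qZ a x : q (a *: x) = a ^+ 2 * q x.
  apply/le_anti; rewrite qle/=.
  have [->|a0] := eqVneq a 0; first by rewrite expr0n mul0r.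
  have := qle a^-1 (a *: x); rewrite scalerA mulVf// scale1r exprVn.
  by rewrite mulrC ler_pdivlMr ?exprn_even_gt0// mulrC.
have qp x y : q (x + y) + q (x - y) = 2 * (q x + q y).
  apply/le_anti; rewrite qpar/=.
  have := qpar (x + y) (x - y).
  have -> : x + y + (x - y) = 2 *: x.
    by rewrite addrACA subrr addr0 scaler_nat.
  have -> : x + y - (x - y) = 2 *: y.
    by rewrite opprB addrC addrA subrK -mulr2n scaler_nat.
  rewrite !qZ; lra.
by exists (QForm q0 qZ qp).
Qed.

Section Pair.
Variables (A B : qform V).

Let val n x y : R := B y + n%:R * A (x - y).

Let pinf n x : R := inf [set val n x y | y in setT].

Let val_ge0 n x y : 0 <= val n x y.
Proof. by rewrite addr_ge0 ?mulr_ge0 ?qf_ge0. Qed.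

Let has_pinf n x : has_inf [set val n x y | y in setT].
Proof.
by split; [exists (val n x x), x|exists 0 => _ [y _ <-]; exact: val_ge0].
Qed.

Let pinf_le n x y : pinf n x <= val n x y.
Proof. by apply: ge_inf; [case: (has_pinf n x)|exists y]. Qed.

Let pinf_adh n x e : 0 < e -> exists y, val n x y < pinf n x + e.
Proof.
by move=> e0; have [_ [y _ <-] h] := inf_adherent e0 (has_pinf n x); exists y.
Qed.

Let pinf_ge0 n x : 0 <= pinf n x.
Proof.
by apply: lb_le_inf; [case: (has_pinf n x)|move=> _ [y _ <-]; exact: val_ge0].
Qed.

Let pinf_mono m n x : (m <= n)%N -> pinf m x <= pinf n x.
Proof.
move=> mn; apply: le_of_lt_add => e /(pinf_adh n x)[y]; apply: le_lt_trans.
by apply: (le_trans (pinf_le m x y)); rewrite lerD2l ler_wpM2r ?qf_ge0// ler_nat.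
Qed.

Let pinfZ_le n a x : pinf n (a *: x) <= a ^+ 2 * pinf n x.
Proof.
have h e : 0 < e -> pinf n (a *: x) <= a ^+ 2 * (pinf n x + e).
  move=> /(pinf_adh n x)[y yx]; apply: (le_trans (pinf_le n _ (a *: y))).
  rewrite /val -scalerBr !qfZ mulrCA -mulrDr.
  by rewrite ler_wpM2l ?sqr_ge0// ltW.
apply/ler_addgt0Pr => e e0.
have a0 : 0 < a ^+ 2 + 1 by rewrite ltr_wpDl ?sqr_ge0.
have := h (e / (a ^+ 2 + 1)) (divr_gt0 e0 a0).
suff : a ^+ 2 * (e / (a ^+ 2 + 1)) <= e by lra.
by rewrite mulrCA ler_piMr ?(ltW e0)// ler_pdivrMr// mul1r lerDl.
Qed.

Let pinf_par n x y :
  pinf n (x + y) + pinf n (x - y) <= 2 * (pinf n x + pinf n y).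
Proof.
apply/ler_addgt0Pr => e e0; have e4 : 0 < e / 4 by rewrite divr_gt0.
have [u xu] := pinf_adh n x e4; have [v yv] := pinf_adh n y e4.
have h1 := pinf_le n (x + y) (u + v); have h2 := pinf_le n (x - y) (u - v).
have : val n (x + y) (u + v) + val n (x - y) (u - v) =
    2 * (val n x u + val n y v).
  rewrite /val; have := qf_par B u v.
  have := qf_par A (x - u) (y - v).
  have -> : x - u + (y - v) = x + y - (u + v) by rewrite opprD addrACA.
  have -> : x - u - (y - v) = x - y - (u - v) by rewrite !opprB addrCA [RHS]addrCA (addrAC x).
  by move=> hA hB; rewrite addrACA -mulrDr hA hB; ring.
lra.
Qed.

Let rel x : R := sup [set pinf n x | n in setT].

Let has_rel x : has_sup [set pinf n x | n in setT].
Proof.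
split; first by exists (pinf 0 x), 0%N.
exists (B x) => _ [n _ <-]; apply: (le_trans (pinf_le n x x)).
by rewrite /val subrr qf0 mulr0 addr0.
Qed.

Let le_rel n x : pinf n x <= rel x.
Proof. by apply: sup_upper_bound; [exact: has_rel|exists n]. Qed.

Let rel_adh x e : 0 < e -> exists n, rel x - e < pinf n x.
Proof.
by move=> e0; have [_ [n _ <-] h] := sup_adherent e0 (has_rel x); exists n.
Qed.

Let rel_ge0 x : 0 <= rel x.
Proof. exact: le_trans (pinf_ge0 0 x) (le_rel 0 x). Qed.

Fact relax_key : exists q : qform V, q =1 rel.
Proof.
apply: qform_of_le; first exact: rel_ge0.
- move=> a x; apply: le_of_lt_add => e /(rel_adh (a *: x))[n].
  rewrite ltrBlDr => /lt_le_trans; apply.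
  rewrite lerD2r (le_trans (pinfZ_le _ _ _))// ler_wpM2l ?sqr_ge0//.
- move=> x y; apply/ler_addgt0Pr => e e0; have e4 : 0 < e / 4 by rewrite divr_gt0.
  have [n1 h1] := rel_adh (x + y) e4; have [n2 h2] := rel_adh (x - y) e4.
  have g1 := pinf_mono (x + y) (leq_maxl n1 n2).
  have g2 := pinf_mono (x - y) (leq_maxr n1 n2).
  have := pinf_par (maxn n1 n2) x y.
  have := le_rel (maxn n1 n2) x; have := le_rel (maxn n1 n2) y; lra.
Qed.

(** The largest form below [B] that is lower semicontinuous for the topology of
    [A]: the square of the quotient norm when [B] is completed and divided by
    the kernel of [A]. It is the supremum over [n] of the infimal convolutions
    of [B] and [n A], and these are quadratic. *)
Definition relax : qform V := projT1 (cid relax_key).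

Let relaxE x : relax x = rel x.
Proof. by rewrite /relax; case: cid. Qed.

Lemma relax_adh x e : 0 < e -> exists y, A (x - y) < e /\ B y < relax x + e.
Proof.
move=> e0; pose n := (Num.truncn ((relax x + e) / e)).+1.
have hn : relax x + e < n%:R * e by rewrite -ltr_pdivrMr// truncnS_gt.
have [y] := pinf_adh n x e0; rewrite /val => hy; exists y.
have := le_rel n x; rewrite -relaxE => h.
have By := qf_ge0 B y; have Ay := mulr_ge0 (ler0n R n) (qf_ge0 A (x - y)).
split; last by lra.
have : n%:R * A (x - y) < n%:R * e by lra.
by rewrite ltr_pM2l// ltr0n.
Qed.

Lemma relax_lsc_adh x e : 0 < e ->
  exists2 d, 0 < d & forall y, A (x - y) < d -> relax x - e < B y.
Proof.
move=> e0; have e2 : 0 < e / 2 by rewrite divr_gt0.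
have [n hn] := rel_adh x e2; exists (e / 2 / n.+1%:R).
  by rewrite divr_gt0// ltr0n.
move=> y; rewrite ltr_pdivlMr ?ltr0n// -natr1 mulrDr mulr1 relaxE => hy.
have := pinf_le n x y; rewrite /val mulrC; have := qf_ge0 A (x - y); lra.
Qed.

Lemma relax_le x : relax x <= B x.
Proof.
apply: le_of_lt_add => e e0; have [d d0 /(_ x)] := relax_lsc_adh x e0.
by rewrite subrr qf0 => /(_ d0); lra.
Qed.

Lemma relax_lsc x e : 0 < e ->
  exists2 d, 0 < d & forall y, A (x - y) < d -> relax x - e < relax y.
Proof.
move=> e0; have e2 : 0 < e / 2 by rewrite divr_gt0.
have [d d0 dP] := relax_lsc_adh x e2; exists (d / 4); first by rewrite divr_gt0.
move=> y xy; have m0 : 0 < Num.min (d / 4) (e / 2) by rewrite lt_min !divr_gt0.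
have [z [yz Bz]] := relax_adh y m0; move: yz; rewrite lt_min => /andP[yz _].
have := dP z; have := qf_trans A y x z => h1 h2.
have {}h2 := h2 (le_lt_trans h1 _).
have mle : Num.min (d / 4) (e / 2) <= e / 2 by rewrite ge_min lexx orbT.
by have := h2 ltac:(lra); lra.
Qed.

Lemma relax_le_of x c :
  (forall e, 0 < e -> exists y, A (x - y) < e /\ B y < c + e) -> relax x <= c.
Proof.
move=> h; apply: le_of_lt_add => e e0; have e2 : 0 < e / 2 by rewrite divr_gt0.
have [d d0 dP] := relax_lsc_adh x e2.
have m0 : 0 < Num.min d (e / 2) by rewrite lt_min d0 e2.
have [y [xy By]] := h _ m0.
have : Num.min d (e / 2) <= e / 2 by rewrite ge_min lexx orbT.
by have := dP y; move: xy; rewrite lt_min => /andP[xy _] /(_ xy); lra.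
Qed.

End Pair.

(** [A] is lower semicontinuous for its own topology, so that a bound of [A] by
    [B] passes to the relaxation of [B], with a factor [2] lost in comparing the
    forms at two neighbouring points. *)
Lemma relax_dom (A B : qform V) (C : R) : 0 <= C -> (forall x, A x <= C * B x) ->
  forall x, A x <= 2 * C * relax A B x.
Proof.
move=> C0 AB x; apply/ler_addgt0Pr => e e0.
have e1 : 0 < e / (2 * C + 2) by rewrite divr_gt0// ltr_wpDl// mulr_ge0.
have [y [xy By]] := relax_adh A B x e1.
have h := qfD_le A (x - y) y; rewrite subrK in h.
have := AB y; have : C * B y <= C * (relax A B x + e / (2 * C + 2)).
  by rewrite ler_wpM2l// ltW.
have : e / (2 * C + 2) * (2 * C + 2) = e by rewrite divfK// gt_eqF// ltr_wpDl// mulr_ge0.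
lra.
Qed.

(** Two forms are independent when the first one does not see any change that
    the second one prescribes: [V] is dense in the product of both spaces. *)
Definition indep2 (t g : qform V) :=
  forall x (e : R), 0 < e -> exists y, t (x - y) < e /\ g y < e.

(** A near-minimizer for the relaxation lies near the orthogonal complement of
    the kernel of [A], where [B] and its relaxation agree. *)
Lemma relax_split (A B : qform V) : indep2 A (qsub (relax_le A B)).
Proof.
move=> x e e0; have e2 : 0 < e / 2 by rewrite divr_gt0.
have [d d0 dP] := relax_lsc A B x e2.
have m0 : 0 < Num.min d (e / 2) by rewrite lt_min d0 e2.
have [y [xy By]] := relax_adh A B x m0.
have : Num.min d (e / 2) <= e / 2 by rewrite ge_min lexx orbT.
have := dP y; move: xy; rewrite lt_min => /andP[xy1 xy2] /(_ xy1) h1 h2.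
by exists y; split => /=; lra.
Qed.

(** Near-minimizers for [relax A C] form a Cauchy sequence for [C], by the
    parallelogram law, hence for [B]; lower semicontinuity then turns
    convergence for [A] into convergence for [relax A B]. *)
Lemma relax_strong (A B C : qform V) (K : R) : 0 <= K -> (forall x, B x <= K * C x) ->
  forall x (e : R), 0 < e ->
  exists y, relax A B (x - y) < e /\ C y < relax A C x + e.
Proof.
move=> K0 BC x e e0; pose c := 8 * K + 2.
have c0 : 0 < c by rewrite ltr_wpDl// mulr_ge0.
pose e1 := e / c; have e10 : 0 < e1 by rewrite divr_gt0.
have [d d0 dP] := relax_lsc_adh A C x e10.
have m0 : 0 < Num.min d e1 by rewrite lt_min d0 e10.
have mle : Num.min d e1 <= e1 by rewrite ge_min lexx orbT.
have [y [xy Cy]] := relax_adh A C x m0.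
have [d2 d20 d2P] := relax_lsc_adh A B (x - y) e10.
have m20 : 0 < Num.min d2 (Num.min d e1) by rewrite lt_min d20 m0.
have m2le : Num.min d2 (Num.min d e1) <= e1 by rewrite ge_min mle orbT.
have [z [xz Cz]] := relax_adh A C x m20.
move: xz xy; rewrite !lt_min => /and3P[xz2 xz _] /andP[xy _].
have := d2P (z - y); rewrite opprB addrA subrK => /(_ xz2) h1.
have h2 := dP (2^-1 *: (z + y)).
have {}h2 : relax A C x - e1 < C (2^-1 *: (z + y)).
  apply: h2.
  have -> : x - 2^-1 *: (z + y) = 2^-1 *: ((x - z) + (x - y)).
    have xE : x = 2^-1 *: (x + x).
      by rewrite scalerDr -scalerDl (_ : 2^-1 + 2^-1 = 1) ?scale1r//; field.
    by rewrite {1}xE -scalerBr opprD addrACA.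
  rewrite qfZ; have := qfD_le A (x - z) (x - y).
  rewrite expr2; lra.
have := qf_par C z y; rewrite qfZ expr2 in h2; move=> h3.
have h4 := BC (z - y).
have h5 : K * C (z - y) <= K * (8 * e1) by rewrite ler_wpM2l//; lra.
have cE : e1 * c = e by rewrite divfK// gt_eqF.
have e1e : e1 <= e.
  have : e1 * 1 <= e1 * c by rewrite ler_pM2l// /c; lra.
  by rewrite cE mulr1.
exists y; split; last by lra.
by rewrite /c in cE; lra.
Qed.

End Relaxation.

(** * Product decompositions *)

Section Product.
Context (R : realType) (V : lmodType R) (P : nat -> seminorm V).
Implicit Types (q : qform V) (g : nat -> qform V).

Definition qcont q := exists n (C : R), 0 <= C /\ forall x, q x <= C * P n x ^+ 2.

(** [V] is isomorphic to the product of the Hilbert spaces of the forms [g i],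
    expressed inside [V]: the forms generate the topology, and the image of [V]
    in the product is dense. *)
Definition product_like g := [/\ forall i, qcont (g i),
  forall m, exists n (C : R), 0 <= C /\ forall x, P m x ^+ 2 <= C * qsum g n x &
  forall n (x : nat -> V) (e : R), 0 < e ->
    exists y, forall i, (i < n)%N -> g i (y - x i) < e].

Section Chain.
Variable A : nat -> qform V.
Hypothesis Adom : forall j, exists C : R, 0 <= C /\ forall x, A j x <= C * A j.+1 x.
Hypothesis Acont : forall j, qcont (A j).
Hypothesis Agen :
  forall m, exists j (C : R), 0 <= C /\ forall x, P m x ^+ 2 <= C * A j x.
Hypothesis Aquoj : forall j, exists C : R, 0 <= C /\ forall x (e : R), 0 < e ->
  exists y, A j (x - y) < e /\ A j.+2 y <= C * A j.+1 x + e.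

(** [B j] is the quotient form that [A j.+1] induces on the completion of [V] for
    [A j]. The forms [B j] are cofinal with the [A j], and [Aquoj] makes the
    quotient [s j] of [B j.+1] on that same space equivalent to [B j]. What
    [B j.+1] has beyond [s j] lives on an orthogonal complement, and these
    differences are the factors of the product. *)
Let B j := relax (A j) (A j.+1).
Let s j := relax (B j) (B j.+1).
Let g j := if j is i.+1 then qsub (relax_le (B i) (B i.+1)) else B 0%N.

Let BA j x : B j x <= A j.+1 x. Proof. exact: relax_le. Qed.

Let AB j : exists C : R, 0 <= C /\ forall x, A j x <= C * B j x.
Proof.
have [C [C0 h]] := Adom j; exists (2 * C); split; first by rewrite mulr_ge0.
by move=> x; exact: relax_dom.
Qed.

Let sB j : exists C : R, 0 <= C /\ forall x, s j x <= C * B j x.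
Proof.
have [K [K0 hK]] := Adom j.+1; have [C [C0 hC]] := Aquoj j.
exists C; split => // x.
have : relax (A j) (A j.+2) x <= C * B j x.
  apply: relax_le_of => e e0; pose e1 := e / (C + 5).
  have c0 : 0 < C + 5 by rewrite ltr_wpDl.
  have e10 : 0 < e1 by rewrite divr_gt0.
  have cE : e1 * (C + 5) = e by rewrite divfK// gt_eqF.
  have [y1 [xy1 Ay1]] := relax_adh (A j) (A j.+1) x e10.
  have [y [y1y Ay]] := hC y1 _ e10; exists y.
  have := qf_trans (A j) y1 x y.
  have : C * A j.+1 y1 <= C * (B j x + e1) by rewrite ler_wpM2l// ltW.
  have : 0 <= e1 * C by rewrite mulr_ge0// ltW.
  by split; nra.
move=> h; apply: relax_le_of => e e0.
have [y [xy Ay]] := relax_strong (A j) K0 hK x e0.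
by exists y; split => //; apply: (le_lt_trans (BA j.+1 y)); lra.
Qed.

Let gB j x : g j x <= B j x.
Proof. by case: j => [//|j] /=; rewrite gerBl qf_ge0. Qed.

Let BS j : exists C : R, 0 <= C /\ forall x, B j x <= C * B j.+1 x.
Proof.
have [C [C0 h]] := AB j.+1; exists C; split => // x.
exact: le_trans (BA j x) (h x).
Qed.

Let Bmono i j : (i <= j)%N -> exists C : R, 0 <= C /\ forall x, B i x <= C * B j x.
Proof.
move=> /subnK <-; elim: (j - i)%N => [|k [C [C0 IH]]].
  by exists 1; split => // x; rewrite mul1r.
have [D [D0 h]] := BS (k + i); exists (C * D); split; first exact: mulr_ge0.
by move=> x; apply: (le_trans (IH x)); rewrite -mulrA ler_wpM2l.
Qed.

Let Bqsum j : exists C : R, 0 <= C /\ forall x, B j x <= C * qsum g j.+1 x.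
Proof.
elim: j => [|j [C [C0 IH]]].
  by exists 1; split => // x; rewrite qsumE big_ord1 mul1r.
have [D [D0 h]] := sB j; exists (D * C + 1); split.
  by rewrite addr_ge0// mulr_ge0.
move=> x; rewrite [qsum _ _]/=.
have -> : B j.+1 x = s j x + g j.+1 x by rewrite /= addrC subrK.
rewrite mulrDr; apply: lerD; last first.
  by rewrite mulrDl mul1r lerDr !mulr_ge0 ?qf_ge0.
apply: (le_trans (h x)); have : D * B j x <= D * (C * qsum g j.+1 x).
  by rewrite ler_wpM2l.
by have := qf_ge0 (qsum g j.+1) x; rewrite /= => ? ?; nra.
Qed.

(** The factors [g i] are attained one at a time: [relax_split] moves the last
    coordinate to its target while the earlier ones, being bounded by [B n],
    hardly change. *)
Lemma product_like_of_chain : exists g, product_like g.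
Proof.
exists g; split.
- move=> i; have [n [C [C0 h]]] := Acont i.+1; exists n, C; split => // x.
  exact: le_trans (gB i x) (le_trans (BA i x) (h x)).
- move=> m; have [j [C [C0 h]]] := Agen m; have [D [D0 hD]] := AB j.
  have [E [E0 hE]] := Bqsum j; exists j.+1, (C * (D * E)); split.
    by rewrite !mulr_ge0.
  move=> x; apply: (le_trans (h x)); rewrite -mulrA ler_wpM2l//.
  by apply: (le_trans (hD x)); rewrite -mulrA ler_wpM2l.
- case=> [|n] x; first by exists 0.
  elim: n x => [|n IH] x e e0.
    by exists (x 0%N) => -[|//] _; rewrite subrr qf0.
  have e4 : 0 < e / 4 by rewrite divr_gt0.
  have [y hy] := IH x _ e4.
  have [K [K0 hK]] : exists K, 0 <= K /\ forall i x, (i <= n)%N ->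
      B i x <= K * B n x.
    have [|_ [K hK]] := @common_bound R V B (fun _ => B n) n (fun _ _ _ _ => lexx _)
      (fun _ => qf_ge0 (B n)); last by exists K.
    by move=> i /Bmono[K hK]; exists 0%N, K.
  have c0 : 0 < K + 1 by rewrite ltr_wpDl.
  have e1 : 0 < e / 4 / (K + 1) by rewrite divr_gt0.
  have [z [zB zg]] := relax_split (B n) (B n.+1) (x n.+1 - y) e1.
  have e14 : e / 4 / (K + 1) <= e / 4.
    by rewrite ler_pdivrMr// ler_pMr// lerDr.
  pose w := x n.+1 - y - z.
  exists (y + w) => i; rewrite ltnS leq_eqVlt => /predU1P[->|ilt].
    have -> : y + w - x n.+1 = - z.
      by rewrite /w addrA (addrC y) subrK addrAC subrr sub0r.
    by rewrite qfN /=; move: zg => /=; lra.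
  have := hy i ilt; have := gB i w; have := hK i w ilt.
  have -> : y + w - x i = (y - x i) + w by rewrite addrAC.
  have := qfD_le (g i) (y - x i) w.
  have : K * B n w <= K * (e / 4 / (K + 1)) by rewrite ler_wpM2l// ltW.
  have : (e / 4 / (K + 1)) * (K + 1) = e / 4 by rewrite divfK// gt_eqF.
  move: zB; rewrite -/w; nra.
Qed.

End Chain.

End Product.

(** * Hilbertian seminorms from finite-dimensional data *)

Section Combinations.
Context (R : realType).

Definition comb (V : lmodType R) N (a : nat -> R) (x : nat -> V) : V :=
  \sum_(i < N) a i *: x i.

Definition l1 N (a : nat -> R) : R := \sum_(i < N) `|a i|.

Definition bilin N (q : nat -> nat -> R) (a b : nat -> R) : R :=
  \sum_(i < N) \sum_(j < N) q i j * a i * b j.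

Definition delta i : nat -> R^o := fun k => (k == i)%:R.

Lemma l1_ge0 N a : 0 <= l1 N a.
Proof. by apply: sumr_ge0. Qed.

Lemma sum_delta (W : lmodType R) N i (F : nat -> W) : (i < N)%N ->
  \sum_(k < N) delta i k *: F k = F i.
Proof.
move=> iN; rewrite (bigD1 (Ordinal iN))//= /delta eqxx scale1r big1 ?addr0//.
by move=> k /negPf; rewrite -val_eqE /= => ->; rewrite scale0r.
Qed.

Lemma comb_delta (V : lmodType R) N i (x : nat -> V) : (i < N)%N ->
  comb N (delta i) x = x i.
Proof. exact: sum_delta. Qed.

Lemma comb_lin (V : lmodType R) N c (a b : nat -> R^o) (x : nat -> V) :
  comb N (c *: a + b) x = c *: comb N a x + comb N b x.
Proof.
rewrite /comb scaler_sumr -big_split/=; apply: eq_bigr => i _.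
by rewrite scalerA -scalerDl.
Qed.

Lemma combD (V : lmodType R) N (a b : nat -> R^o) (x : nat -> V) :
  comb N (a + b) x = comb N a x + comb N b x.
Proof. by have := comb_lin N 1 a b x; rewrite !scale1r. Qed.

Lemma combN (V : lmodType R) N (a : nat -> R^o) (x : nat -> V) :
  comb N (- a) x = - comb N a x.
Proof.
by rewrite /comb -sumrN; apply: eq_bigr => i _; rewrite -scaleNr.
Qed.

Lemma combB (V : lmodType R) N a (x y : nat -> V) :
  comb N a (fun i => x i - y i) = comb N a x - comb N a y.
Proof.
by rewrite /comb -sumrB; apply: eq_bigr => i _; rewrite scalerBr.
Qed.

Lemma l1D N (a b : nat -> R^o) : l1 N (a + b) <= l1 N a + l1 N b.
Proof.
by rewrite /l1 -big_split/=; apply: ler_sum => i _; exact: ler_normD.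
Qed.

Lemma l1_delta_le N i : l1 N (delta i) <= 1.
Proof.
rewrite /l1; have [iN|Ni] := ltnP i N.
  rewrite (bigD1 (Ordinal iN))//= big1; first by rewrite /delta eqxx normr1 addr0.
  by move=> k /negPf; rewrite -val_eqE /delta /= => ->; rewrite normr0.
rewrite big1// => k _; rewrite /delta.
by rewrite (_ : (_ == _) = false) ?normr0//; apply/negbTE; rewrite neq_ltn (leq_trans (ltn_ord k) Ni).
Qed.

Lemma bilinDl N q (a b c : nat -> R^o) :
  bilin N q (a + b) c = bilin N q a c + bilin N q b c.
Proof.
rewrite /bilin -big_split/=; apply: eq_bigr => i _.
rewrite -big_split/=; apply: eq_bigr => j _.
by rewrite -[(a + b) i]/(a i + b i); ring.
Qed.

Lemma bilinDr N q (a b c : nat -> R^o) :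
  bilin N q c (a + b) = bilin N q c a + bilin N q c b.
Proof.
rewrite /bilin -big_split/=; apply: eq_bigr => i _.
rewrite -big_split/=; apply: eq_bigr => j _.
by rewrite -[(a + b) j]/(a j + b j); ring.
Qed.

Lemma bilinZl N q t (a c : nat -> R^o) : bilin N q (t *: a) c = t * bilin N q a c.
Proof.
rewrite /bilin mulr_sumr; apply: eq_bigr => i _.
rewrite mulr_sumr; apply: eq_bigr => j _.
by rewrite -[(t *: a) i]/(t * a i); ring.
Qed.

Lemma bilinZr N q t (a c : nat -> R^o) : bilin N q c (t *: a) = t * bilin N q c a.
Proof.
rewrite /bilin mulr_sumr; apply: eq_bigr => i _.
rewrite mulr_sumr; apply: eq_bigr => j _.
by rewrite -[(t *: a) j]/(t * a j); ring.
Qed.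

Lemma bilinN N q (a : nat -> R^o) : bilin N q (- a) (- a) = bilin N q a a.
Proof. by rewrite -scaleN1r bilinZl bilinZr; ring. Qed.

Lemma bilin_delta N q i j : (i < N)%N -> (j < N)%N ->
  bilin N q (delta i) (delta j) = q i j.
Proof.
move=> iN jN; rewrite /bilin.
rewrite -[RHS](sum_delta (fun k => q k j : R^o) iN); apply: eq_bigr => k _.
rewrite -(sum_delta (fun l => q k l : R^o) jN) scaler_sumr.
apply: eq_bigr => l _.
rewrite -[RHS]/(delta i k * (delta j l * q k l)); ring.
Qed.

Lemma bilin_sym N q a :
  bilin N (fun i j => (q i j + q j i) / 2) a a = bilin N q a a.
Proof.
have swap : bilin N (fun i j => q j i) a a = bilin N q a a.
  rewrite /bilin exchange_big; apply: eq_bigr => i _.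
  by apply: eq_bigr => j _; rewrite mulrAC.
have -> : bilin N (fun i j => (q i j + q j i) / 2) a a =
    2^-1 * (bilin N q a a + bilin N (fun i j => q j i) a a).
  rewrite /bilin -big_split mulr_sumr; apply: eq_bigr => i _.
  rewrite -big_split mulr_sumr; apply: eq_bigr => j _.
  by rewrite /=; field.
by rewrite swap; field.
Qed.

Lemma bilin_close N q q' a e : (forall i j, (i < N)%N -> (j < N)%N ->
    `|q i j - q' i j| <= e) ->
  `|bilin N q a a - bilin N q' a a| <= e * l1 N a ^+ 2.
Proof.
move=> h; rewrite /bilin -sumrB; apply: (le_trans (ler_norm_sum _ _ _)).
rewrite expr2 {1}/l1 mulr_suml mulr_sumr; apply: ler_sum => i _.
rewrite -sumrB; apply: (le_trans (ler_norm_sum _ _ _)).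
rewrite mulrA /l1 mulr_sumr; apply: ler_sum => j _.
rewrite -!mulrBl !normrM ler_wpM2r// ler_wpM2r//.
exact: h.
Qed.

(** Tuples with repetitions are combinations of tuples of distinct vectors, which
    is what a function on pairs of vectors can describe. *)
Definition regroup N (idx : nat -> nat) (a : nat -> R) : nat -> R :=
  fun k => \sum_(i < N) (if idx i == k then a i else 0).

Lemma regroupE (W : lmodType R) N K idx (a : nat -> R) (F : nat -> W) :
  (forall i, (i < N)%N -> (idx i < K)%N) ->
  \sum_(i < N) a i *: F (idx i) = \sum_(k < K) regroup N idx a k *: F k.
Proof.
move=> h; under [RHS]eq_bigr do rewrite scaler_suml.
rewrite exchange_big/=; apply: eq_bigr => i _.
rewrite (bigD1 (Ordinal (h i (ltn_ord i))))//= eqxx big1 ?addr0//.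
by move=> k; rewrite -val_eqE /= eq_sym => /negPf->; rewrite scale0r.
Qed.

Lemma l1_regroup N K idx a : (forall i, (i < N)%N -> (idx i < K)%N) ->
  l1 K (regroup N idx a) <= l1 N a.
Proof.
move=> h; rewrite /l1.
apply: (@le_trans _ _ (\sum_(k < K) \sum_(i < N) (if idx i == k then `|a i| else 0))).
  apply: ler_sum => k _; apply: (le_trans (ler_norm_sum _ _ _)).
  by apply: ler_sum => i _; case: ifP => //; rewrite normr0.
rewrite exchange_big/=; apply: ler_sum => i _.
rewrite (bigD1 (Ordinal (h i (ltn_ord i))))//= eqxx big1 ?addr0//.
by move=> k; rewrite -val_eqE /= eq_sym => /negPf->.
Qed.

Lemma bilin_regroup N K idx q (a : nat -> R) :
  (forall i, (i < N)%N -> (idx i < K)%N) ->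
  bilin N (fun i j => q (idx i) (idx j)) a a =
  bilin K q (regroup N idx a) (regroup N idx a).
Proof.
move=> h; rewrite /bilin.
transitivity (\sum_(i < N) a i *:
    ((fun k => \sum_(j < N) a j *: (q k (idx j) : R^o)) (idx i) : R^o)).
  apply: eq_bigr => i _; rewrite scaler_sumr; apply: eq_bigr => j _.
  rewrite -[RHS]/(a i * (a j * q (idx i) (idx j))); ring.
rewrite (regroupE _ (fun k => \sum_(j < N) a j *: (q k (idx j) : R^o)) h).
apply: eq_bigr => k _.
rewrite (regroupE _ (fun l => q k l : R^o) h) scaler_sumr; apply: eq_bigr => l _.
rewrite -[LHS]/(regroup N idx a k * (regroup N idx a l * q k l)); ring.
Qed.

End Combinations.

Section Between.
Context (R : realType) (V : lmodType R) (P : nat -> seminorm V).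

(** Finite tuples admit, up to an arbitrarily small error, a quadratic form
    between [P m ^ 2] and [C P n ^ 2]. The error makes the set of tuples for
    which this fails open. *)
Definition hilb_between m n (C : R) := forall N (x : nat -> V) (e : R), 0 < e ->
  exists q : nat -> nat -> R, forall a,
    P m (comb N a x) ^+ 2 <= bilin N q a a + e * l1 N a ^+ 2 /\
    bilin N q a a <= C * P n (comb N a x) ^+ 2 + e * l1 N a ^+ 2.

Section Compactness.
Variables (m n : nat) (C : R).
Hypotheses (C0 : 0 <= C) (hmn : hilb_between m n C).

(** Values of the approximating forms at pairs of vectors lie in a compact box:
    the polar form at [x] and [y] is bounded by the form at both of them, up to
    the errors committed at the two vectors, their sum and their difference. *)
Let bnd (x y : V) : R := C * (P n x ^+ 2 + P n y ^+ 2) + 6.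

Let K := [set f : forall xy : V * V, R |
  forall xy, `[- bnd xy.1 xy.2, bnd xy.1 xy.2]%classic (f xy)].

Let fits e (f : V * V -> R) N x a :=
  P m (comb N a x) ^+ 2 <= bilin N (fun i j => f (x i, x j)) a a + e * l1 N a ^+ 2 /\
  bilin N (fun i j => f (x i, x j)) a a <= C * P n (comb N a x) ^+ 2 + e * l1 N a ^+ 2.

Let S (le : seq V * R) : set (forall xy : V * V, R) := [set f | K f /\
  forall N x a, (forall i, (i < N)%N -> x i \in le.1) -> fits le.2 f N x a].

Let S_nonempty le : 0 < le.2 -> S le !=set0.
Proof.
case: le => l e0 /= e00; pose e := Num.min e0 1.
have e_gt0 : 0 < e by rewrite lt_min e00 ltr01.
have e_le1 : e <= 1 by rewrite ge_min lexx orbT.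
have e_le : e <= e0 by rewrite ge_min lexx.
pose u := undup l; have [q0 hq0] := hmn (size u) (nth 0 u) e_gt0.
pose q i j := (q0 i j + q0 j i) / 2.
have hq a : P m (comb (size u) a (nth 0 u)) ^+ 2 <=
      bilin (size u) q a a + e * l1 (size u) a ^+ 2 /\
    bilin (size u) q a a <=
      C * P n (comb (size u) a (nth 0 u)) ^+ 2 + e * l1 (size u) a ^+ 2.
  by rewrite bilin_sym.
pose f (xy : V * V) : R := if (xy.1 \in u) && (xy.2 \in u)
  then q (index xy.1 u) (index xy.2 u) else 0.
have bnd_ge0 x y : 0 <= bnd x y.
  by rewrite /bnd addr_ge0// mulr_ge0// addr_ge0 ?sqr_ge0.
exists f; split.
- case=> x y; rewrite /f /=; case: ifP => [/andP[xu yu]|_]; last first.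
    by rewrite in_itv/= oppr_le0 bnd_ge0.
  set i := index x u; set j := index y u.
  have iu : (i < size u)%N by rewrite index_mem.
  have ju : (j < size u)%N by rewrite index_mem.
  have [_ hi] := hq (delta R i); have [_ hj] := hq (delta R j).
  rewrite bilin_delta// comb_delta// nth_index// in hi.
  rewrite bilin_delta// comb_delta// nth_index// in hj.
  have [hp _] := hq (delta R i + delta R j).
  have [hm _] := hq (delta R i - delta R j).
  rewrite bilinDl !bilinDr !bilin_delta// in hp.
  rewrite bilinDl !bilinDr bilinN -[- delta R j]scaleN1r bilinZl bilinZr !bilin_delta// in hm.
  have qs : q j i = q i j by rewrite /q addrC.
  have sq1 k : l1 (size u) (delta R k) ^+ 2 <= 1.
    by rewrite expr_le1 ?l1_ge0 ?l1_delta_le.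
  have sq4 (c : R) : `|c| <= 1 ->
      l1 (size u) (delta R i + c *: delta R j) ^+ 2 <= 4.
    move=> c1; have : l1 (size u) (delta R i + c *: delta R j) <= 2.
      apply: (le_trans (l1D _ _ _)); rewrite (_ : 2 = 1 + 1)//.
      apply: lerD; first exact: l1_delta_le.
      apply: (le_trans _ (l1_delta_le R (size u) j)); apply: ler_sum => k _.
      by rewrite -[(_ *: _) _]/(c * delta R j k) normrM ler_piMl.
    by have := l1_ge0 (size u) (delta R i + c *: delta R j); nra.
  have s1 := sq4 1 ltac:(by rewrite normr1).
  have s2 := sq4 (-1) ltac:(by rewrite normrN1).
  rewrite scale1r in s1.
  have h6 : 0 <= e * (1 - l1 (size u) (delta R i) ^+ 2).
    by rewrite mulr_ge0 ?(ltW e_gt0)// subr_ge0.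
  have h7 : 0 <= e * (1 - l1 (size u) (delta R j) ^+ 2).
    by rewrite mulr_ge0 ?(ltW e_gt0)// subr_ge0.
  have h8 : 0 <= e * (4 - l1 (size u) (delta R i + delta R j) ^+ 2).
    by rewrite mulr_ge0 ?(ltW e_gt0)// subr_ge0.
  have h9 : 0 <= e * (4 - l1 (size u) (delta R i + (-1) *: delta R j) ^+ 2).
    by rewrite mulr_ge0 ?(ltW e_gt0)// subr_ge0.
  have p1 := sqr_ge0 (P m (comb (size u) (delta R i + delta R j) (nth 0 u))).
  have p2 := sqr_ge0 (P m (comb (size u) (delta R i + (-1) *: delta R j) (nth 0 u))).
  have b1 : 0 <= C * P n x ^+ 2 by rewrite mulr_ge0 ?sqr_ge0.
  have b2 : 0 <= C * P n y ^+ 2 by rewrite mulr_ge0 ?sqr_ge0.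
  by rewrite in_itv/= /bnd; apply/andP; split; lra.
- move=> N x a xl /=.
  pose idx k := index (x k) u.
  have idx_lt i : (i < N)%N -> (idx i < size u)%N.
    by move=> iN; rewrite index_mem mem_undup xl.
  have xE i : (i < N)%N -> x i = nth 0 u (idx i).
    by move=> iN; rewrite nth_index// mem_undup xl.
  have combE : comb N a x = comb (size u) (regroup N idx a) (nth 0 u).
    rewrite /comb -(regroupE _ _ idx_lt); apply: eq_bigr => i _.
    by rewrite -xE.
  have bE : bilin N (fun i j => f (x i, x j)) a a =
      bilin (size u) q (regroup N idx a) (regroup N idx a).
    rewrite -(bilin_regroup _ _ idx_lt); apply: eq_bigr => i _.
    by apply: eq_bigr => j _; rewrite /f /= !mem_undup !xl.
  have [h1 h2] := hq (regroup N idx a).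
  rewrite /fits combE bE.
  have : e * l1 (size u) (regroup N idx a) ^+ 2 <= e0 * l1 N a ^+ 2.
    apply: ler_pM; rewrite ?sqr_ge0 ?(ltW e_gt0)//.
    by rewrite lerXn2r ?nnegrE ?l1_ge0// l1_regroup.
  by lra.
Qed.

(** The sets of functions that fit on a finite set of vectors up to a given error
    have the finite intersection property, so Tychonoff's theorem provides a
    function that fits everywhere with no error. *)
Let limit_form : exists f, forall N x a, fits 0 f N x a.
Proof.
have Kc : @compact (prod_topology (fun=> R : topologicalType)) K.
  apply: (@tychonoff (V * V)%type (fun=> R : topologicalType)
    (fun xy => `[- bnd xy.1 xy.2, bnd xy.1 xy.2]%classic)) => xy.
  exact: segment_compact.
pose D := [set le : seq V * R | 0 < le.2].
have FF : ProperFilter (filter_from D S).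
  apply: filter_from_proper; last by move=> le; exact: S_nonempty.
  apply: filter_from_filter; first by exists ([::], 1); rewrite /D/= ltr01.
  move=> [u1 e1] [u2 e2] /= e10 e20; exists (u1 ++ u2, Num.min e1 e2).
    by rewrite /D/= lt_min e10.
  move=> f [Kf hf]; split; (split=> // N x a /= xu).
  - have /= [|h1 h2] := hf N x a; first by move=> i iN; rewrite mem_cat xu.
    have : Num.min e1 e2 * l1 N a ^+ 2 <= e1 * l1 N a ^+ 2.
      by rewrite ler_wpM2r ?sqr_ge0// ge_min lexx.
    by rewrite /fits; lra.
  - have /= [|h1 h2] := hf N x a; first by move=> i iN; rewrite mem_cat xu// orbT.
    have : Num.min e1 e2 * l1 N a ^+ 2 <= e2 * l1 N a ^+ 2.
      by rewrite ler_wpM2r ?sqr_ge0// ge_min lexx orbT.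
    by rewrite /fits; lra.
have FK : filter_from D S K by exists ([::], 1); [rewrite /D/= ltr01|move=> f []].
have [f [Kf cf]] := Kc _ FF FK; exists f => N x a.
have main e : 0 < e -> fits (2 * e) f N x a.
  move=> e0; have FS : filter_from D S (S (mkseq x N, e)).
    by exists (mkseq x N, e).
  pose T := prod_topology (fun _ : V * V => R : topologicalType).
  have near_ij (ij : 'I_N * 'I_N) : nbhs (f : T)
      [set f' : T | `|f (x ij.1, x ij.2) - f' (x ij.1, x ij.2)| < e].
    have := @proj_continuous (V * V)%type (fun=> R) (x ij.1, x ij.2) f.
    by move=> /(_ _ (nbhsx_ballx (f (x ij.1, x ij.2)) _ e0)).
  have near_f := @filter_forall T _ _ _ (nbhs_filter (f : T)) near_ij.
  have [f' [[_ hf'] close]] := cf _ _ FS near_f.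
  have /= [|h1 h2] := hf' N x a.
    by move=> i iN; apply/mapP; exists i => //; rewrite mem_iota.
  have : `|bilin N (fun i j => f (x i, x j)) a a -
      bilin N (fun i j => f' (x i, x j)) a a| <= e * l1 N a ^+ 2.
    apply: bilin_close => i j iN jN.
    exact/ltW/(close (Ordinal iN, Ordinal jN)).
  by rewrite ler_norml => /andP[h3 h4]; split; lra.
have lim0 u v : (forall e, 0 < e -> u <= v + 2 * e * l1 N a ^+ 2) -> u <= v + 0 * l1 N a ^+ 2.
  move=> h; rewrite mul0r addr0; apply/ler_addgt0Pr => e e0.
  pose c := 2 * (l1 N a ^+ 2 + 1).
  have c0 : 0 < c by rewrite mulr_gt0// ltr_wpDl ?sqr_ge0.
  apply: (le_trans (h (e / c) (divr_gt0 e0 c0))); rewrite lerD2l.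
  have d0 : 0 < e / c by rewrite divr_gt0.
  have dE : e / c * c = e by rewrite divfK ?gt_eqF.
  set d := e / c in d0 dE *; rewrite /c in dE; lra.
by split; apply: lim0 => e /main[].
Qed.

(** The laws of a quadratic form are relations between finitely many vectors. They
    hold for the limit because a vanishing combination has value [0], being
    bounded by [C P n ^ 2], and a vector of value [0] is orthogonal to
    everything. *)
Lemma qform_between : exists h : qform V,
  (forall x, P m x ^+ 2 <= h x) /\ forall x, h x <= C * P n x ^+ 2.
Proof.
have [f hf] := limit_form.
have f_ge N x a : P m (comb N a x) ^+ 2 <= bilin N (fun i j => f (x i, x j)) a a.
  by have [] := hf N x a; rewrite mul0r addr0.
have f_le N x a : bilin N (fun i j => f (x i, x j)) a a <= C * P n (comb N a x) ^+ 2.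
  by have [_] := hf N x a; rewrite mul0r addr0.
have b_ge0 N x a : 0 <= bilin N (fun i j => f (x i, x j)) a a.
  exact: le_trans (sqr_ge0 _) (f_ge N x a).
have bZ N x t (a : nat -> R^o) : bilin N (fun i j => f (x i, x j)) (t *: a) (t *: a) =
    t ^+ 2 * bilin N (fun i j => f (x i, x j)) a a.
  by rewrite bilinZl bilinZr mulrA -expr2.
have bP N x (a b : nat -> R^o) (q := fun i j => f (x i, x j)) :
  bilin N q (a + b) (a + b) + bilin N q (a - b) (a - b) =
  2 * (bilin N q a a + bilin N q b b).
  rewrite !bilinDl !bilinDr bilinN -[- b]scaleN1r !bilinZl !bilinZr; lra.
pose Q N x : qform (nat -> R^o) := QForm (b_ge0 N x) (bZ N x) (bP N x).
have Qeq N x (a b : nat -> R^o) : comb N a x = comb N b x -> Q N x a = Q N x b.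
  move=> ab; rewrite -[in LHS](subrK b a) addrC qfD_eq0//.
  apply/le_anti; rewrite qf_ge0 andbT.
  apply: (le_trans (f_le N x (a - b))).
  by rewrite combD combN ab subrr seminorm0 expr0n mulr0.
have Qdelta N x i : (i < N)%N -> Q N x (delta R i) = f (x i, x i).
  by move=> iN; rewrite /= bilin_delta.
have combZ N t a (x : nat -> V) : comb N (t *: a) x = t *: comb N a x.
  by rewrite /comb scaler_sumr; apply: eq_bigr => i _; rewrite scalerA.
have hZ t x : f (t *: x, t *: x) = t ^+ 2 * f (x, x).
  pose y k := nth 0 [:: x; t *: x] k.
  have := Qeq 2%N y (t *: delta R 0) (delta R 1).
  rewrite combZ !comb_delta// => /(_ erefl).
  by rewrite qfZ !Qdelta.
have hP x y : f (x + y, x + y) + f (x - y, x - y) = 2 * (f (x, x) + f (y, y)).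
  pose z k := nth 0 [:: x; y; x + y; x - y] k.
  have := Qeq 4%N z (delta R 0 + delta R 1) (delta R 2).
  have := Qeq 4%N z (delta R 0 - delta R 1) (delta R 3).
  rewrite !combD combN !comb_delta// => /(_ erefl) e1 /(_ erefl) e2.
  have := qf_par (Q 4%N z) (delta R 0) (delta R 1).
  by rewrite e1 e2 !Qdelta.
have diag x : f (x, x) = bilin 1 (fun=> fun=> f (x, x)) (delta R 0) (delta R 0).
  by rewrite bilin_delta.
have h0 x : 0 <= f (x, x).
  by rewrite diag; exact: b_ge0 1%N (fun=> x) _.
exists (QForm h0 hZ hP); split => x /=; rewrite diag.
  by have := f_ge 1%N (fun=> x) (delta R 0); rewrite comb_delta.
by have := f_le 1%N (fun=> x) (delta R 0); rewrite comb_delta.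
Qed.

End Compactness.

End Between.

(** * Ranks of quadratic forms *)

Section Rank.
Context (R : realType) (V : lmodType R).
Implicit Types (q : qform V) (b x : nat -> V) (a : nat -> R).

Definition orthonormal q N b := forall i j, (i < N)%N -> (j < N)%N ->
  polar q (b i) (b j) = (i == j)%:R.

Definition infinite_rank q := forall N, exists b, orthonormal q N b.

Definition functional (f : V -> R) :=
  forall c u v, f (c *: u + v) = c * f u + f v.

(** The kernel has finite codimension; functionals are used rather than a basis,
    so that finite rank passes to sums by concatenation. *)
Definition finite_rank q := exists N (f : nat -> V -> R),
  (forall i, functional (f i)) /\
  forall u, (forall i, (i < N)%N -> f i u = 0) -> q u = 0.

Lemma functional0 f : functional f -> f 0 = 0.
Proof. by move=> h; have := h 1 0 0; rewrite scale1r addr0; lra. Qed.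

Lemma functional_comb f N a x : functional f ->
  f (comb N a x) = \sum_(i < N) a i * f (x i).
Proof.
move=> h; rewrite /comb; elim/big_rec2: _ => [|i u v _ <-]; last exact: h.
exact: functional0.
Qed.

Lemma functional_polar q u : functional (fun v => polar q v u).
Proof. by move=> c v w; rewrite polarDl polarZl. Qed.

Lemma polar_comb q N a x u :
  polar q (comb N a x) u = \sum_(i < N) a i * polar q (x i) u.
Proof. exact: functional_comb (functional_polar q u). Qed.

Lemma polar_comb_orthonormal q N b a j : orthonormal q N b -> (j < N)%N ->
  polar q (comb N a b) (b j) = a j.
Proof.
move=> ob jN; rewrite polar_comb (bigD1 (Ordinal jN))//= ob// eqxx mulr1.
rewrite big1 ?addr0// => i; rewrite -val_eqE /= => /negPf ij.
by rewrite ob// ij mulr0.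
Qed.

Lemma qf_orthonormal q N b a : orthonormal q N b ->
  q (comb N a b) = \sum_(i < N) a i ^+ 2.
Proof.
move=> ob; rewrite -polarxx polar_comb; apply: eq_bigr => i _.
by rewrite polarC polar_comb_orthonormal// expr2.
Qed.

Definition qproj q N b u := comb N (fun i => polar q u (b i)) b.

Lemma polar_sub_proj q N b u j : orthonormal q N b -> (j < N)%N ->
  polar q (u - qproj q N b u) (b j) = 0.
Proof. by move=> ob jN; rewrite polarBl polar_comb_orthonormal// subrr. Qed.

Lemma qf_sub_proj q N b u : orthonormal q N b ->
  q (u - qproj q N b u) = q u - \sum_(i < N) polar q u (b i) ^+ 2.
Proof.
move=> ob; rewrite qfB qf_orthonormal// polarC polar_comb.
under [in X in _ - 2 * X]eq_bigr do rewrite [polar q (b _) u]polarC -expr2.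
lra.
Qed.

(** An orthonormal family of maximal length exhausts the form, since a vector with
    a nonzero residual would give a longer one. *)
Lemma rank_dichotomy q : infinite_rank q \/
  exists N b, orthonormal q N b /\
    forall u, q u = \sum_(i < N) polar q u (b i) ^+ 2.
Proof.
have [|/existsNP nN] := pselect (infinite_rank q); [by left|right].
have ex : exists N, `[< ~ exists b, orthonormal q N b >].
  by case: nN => N h; exists N; exact/asboolP.
case: (ex_minnP ex) => -[/asboolP[]|N /asboolP hN minN].
  by exists (fun=> 0).
have [b ob] : exists b, orthonormal q N b.
  by apply: contrapT => h; have := minN N; rewrite ltnn => /(_ (introT (asboolP _) h)).
exists N, b; split => // u; apply/eqP; rewrite -subr_eq0 -qf_sub_proj//.
apply: contrapT => /negP qr; apply: hN.
set r := u - qproj q N b u in qr *.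
have r_gt0 : 0 < q r by rewrite lt_def qr qf_ge0.
have nr : qnorm q r != 0 by rewrite gt_eqF// sqrtr_gt0.
exists (fun i => if (i < N)%N then b i else (qnorm q r)^-1 *: r) => i j.
have bj k : (k < N)%N -> polar q ((qnorm q r)^-1 *: r) (b k) = 0.
  by move=> kN; rewrite polarZl polar_sub_proj// mulr0.
rewrite !ltnS leq_eqVlt => /predU1P[->|iN]; rewrite leq_eqVlt => /predU1P[->|jN].
- rewrite ltnn eqxx polarxx qfZ -[q r]qnorm_sqr -exprMn mulVf ?expr1n//.
- by rewrite ltnn jN bj// gtn_eqF.
- by rewrite iN ltnn polarC bj// ltn_eqF.
- by rewrite iN jN ob.
Qed.

Lemma finite_rankP q : ~ infinite_rank q -> finite_rank q.
Proof.
have [//|[N [b [ob qE]]] _] := rank_dichotomy q.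
exists N, (fun i u => polar q u (b i)); split => [i|u h].
  exact: functional_polar.
by rewrite qE big1// => i _; rewrite h// expr0n.
Qed.

Lemma finite_rank_qsum (t : nat -> qform V) n :
  (forall i, finite_rank (t i)) -> finite_rank (qsum t n).
Proof.
move=> ft; elim: n => [|n [N [f [ff IH]]]].
  by exists 0%N, (fun _ _ => 0); split => // i c u v; rewrite mulr0 addr0.
have [N' [f' [ff' fg]]] := ft n.
exists (N + N')%N, (fun i => if (i < N)%N then f i else f' (i - N)%N).
split => [i|u h]; first by case: ifP.
rewrite [LHS]/= IH ?fg ?addr0// => i iN; last first.
  by have := h i (ltn_addr _ iN); rewrite iN.
have := h (N + i)%N; rewrite ltn_add2l => /(_ iN).
by rewrite ltnNge leq_addr/= addKn.
Qed.

(** More vectors than functionals: some nontrivial combination is killed. *)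
Lemma kill_functionals N (f : nat -> V -> R) x : (forall i, functional (f i)) ->
  exists a, 0 < l1 N.+1 a /\ forall i, (i < N)%N -> f i (comb N.+1 a x) = 0.
Proof.
move=> ff; pose M := \matrix_(i < N.+1, j < N) f j (x i).
have : kermx M != 0.
  by rewrite kermx_eq0 /row_free neq_ltn ltnS rank_leq_col.
case/rowV0Pn => v /sub_kermxP vM v0.
exists (fun i => v 0 (inord i)); split.
  rewrite lt_def l1_ge0 andbT; apply: contra v0; rewrite psumr_eq0// => /allP h.
  apply/eqP/rowP => i; rewrite mxE; have := h i (mem_index_enum _).
  by rewrite normr_eq0 inord_val => /eqP.
move=> j jN; rewrite functional_comb//.
have := congr1 (fun A : 'rV_N => A 0 (Ordinal jN)) vM; rewrite !mxE => vM0.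
by rewrite -[RHS]vM0; apply: eq_bigr => i _; rewrite mxE inord_val.
Qed.

Lemma infinite_not_finite q : infinite_rank q -> ~ finite_rank q.
Proof.
move=> iq [N [f [ff fq]]]; have [b ob] := iq N.+1.
have [a [a0 af]] := kill_functionals N b ff.
have := fq _ af; rewrite qf_orthonormal// => /eqP.
rewrite psumr_eq0 => [/allP h|i _]; last exact: sqr_ge0.
move: a0; rewrite /l1 big1 ?ltxx// => i _; apply/eqP; rewrite normr_eq0.
by have := h i (mem_index_enum _); rewrite /= sqrf_eq0.
Qed.

Lemma finite_rank_basis q : finite_rank q -> exists Nb : nat * (nat -> V),
  orthonormal q Nb.1 Nb.2 /\ forall u, q u = \sum_(j < Nb.1) polar q u (Nb.2 j) ^+ 2.
Proof.
by move=> fq; have [/infinite_not_finite/(_ fq)[]|[N [b h]]] := rank_dichotomy q; exists (N, b).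
Qed.

Lemma l1_le_sqrt N a : l1 N a <= N%:R * Num.sqrt (\sum_(i < N) a i ^+ 2).
Proof.
apply: (@le_trans _ _ (\sum_(i < N) Num.sqrt (\sum_(i < N) a i ^+ 2))).
  apply: ler_sum => i _; rewrite -sqrtr_sqr ler_wsqrtr//.
  by rewrite (bigD1 i)//= lerDl; apply: sumr_ge0 => j _; exact: sqr_ge0.
by rewrite sumr_const card_ord mulr_natl.
Qed.

(** Orthonormal vectors of [t] can be moved to vectors that [g] hardly sees. *)
Lemma indep2_lift (t g : qform V) N (eta : R) : indep2 t g -> infinite_rank t ->
  0 < eta -> exists y, forall a (s := Num.sqrt (\sum_(i < N) a i ^+ 2)),
  [/\ (1 - eta) * s <= qnorm t (comb N a y),
      qnorm t (comb N a y) <= (1 + eta) * s & qnorm g (comb N a y) <= eta * s].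
Proof.
move=> tg /(_ N)[b ob] eta0; pose e := eta / N.+1%:R.
have e0 : 0 < e by rewrite divr_gt0// ltr0n.
(* The error [e] per vector is [eta] over the dimension, since the l1 norm of
   the coefficients is compared with their Euclidean norm. *)
have ex i : exists y, t (b i - y) < e ^+ 2 /\ g y < e ^+ 2.
  by apply: tg; rewrite exprn_gt0.
have [y hy] := choice ex; exists y => a s.
have sq (q : qform V) u : q u < e ^+ 2 -> qnorm q u <= e.
  by move=> /ltW h; rewrite -(ler_sqr) ?nnegrE ?qnorm_ge0 ?(ltW e0)// qnorm_sqr.
have el1 : e * l1 N a <= eta * s.
  have h1 := l1_le_sqrt N a; rewrite -/s in h1.
  have s0 : 0 <= s := sqrtr_ge0 _.
  apply: (le_trans (ler_wpM2l (ltW e0) h1)).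
  rewrite mulrA ler_wpM2r// /e mulrAC ler_pdivrMr ?ltr0n//.
  by rewrite ler_wpM2l ?(ltW eta0)// ler_nat.
have tb : qnorm t (comb N a b) = s by rewrite /qnorm qf_orthonormal.
have d : qnorm t (comb N a b - comb N a y) <= eta * s.
  rewrite -combB; apply: le_trans el1.
  apply: (@seminorm_lin _ _ (qf_seminorm t) N a (fun i => b i - y i) e) => i _.
  by rewrite /=; apply: sq; case: (hy i).
split.
- have := qnormD t (comb N a b - comb N a y) (comb N a y); rewrite subrK tb; lra.
- have := qnormD t (comb N a y - comb N a b) (comb N a b).
  by rewrite subrK tb {2}/qnorm qfC -/(qnorm _ _); lra.
- apply: le_trans el1.
  apply: (@seminorm_lin _ _ (qf_seminorm g) N a y e) => i _.
  by rewrite /=; apply: sq; case: (hy i).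
Qed.

End Rank.

(** * The countable conditions *)

Section Conditions.
Context (R : realType) (V : lmodType R) (P : nat -> seminorm V).

(** The topology is generated by Hilbertian seminorms. *)
Definition hilbertizable := forall m, exists n (C : nat), hilb_between P m n C%:R.

(** Every [P n]-bounded set is, up to the closure for [P m], bounded for all the
    other seminorms: in the presence of Hilbertian seminorms, the dense images
    in the local Hilbert spaces stabilize, so that [V] is a quojection. *)
Definition quojective := forall m, exists n, forall k, exists C : nat,
  forall x (e : R), 0 < e -> P n x < 1 -> exists y, P k y < C%:R /\ P m (x - y) < e.

(** [P n] dominates [c P k] strictly on some subspace of dimension [N]; the
    margin [e] makes this an open condition on the basis. *)
Definition dominates n k (c : R) N := exists (x : nat -> V) (e : R), 0 < e /\
  forall a, c * P k (comb N a x) + e * l1 N a <= P n (comb N a x).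

(** For Hilbertian seminorms, the negation of being a Schwartz space. *)
Definition non_schwartz := exists n, forall k, exists j : nat, forall N,
  dominates n k j.+1%:R^-1 N.

(** In a product of Hilbert spaces: infinitely many of them are
    infinite-dimensional. Beyond those that determine [P m] there is room for
    domination by arbitrary constants in every dimension. *)
Definition infinite_steps := forall m, exists n, forall j N : nat,
  dominates n m j%:R N.

Definition normable := exists m, forall n, exists C : nat, forall x,
  P n x <= C%:R * P m x.

Hypothesis Pmono : forall m n x, (m <= n)%N -> P m x <= P n x.

Lemma Pmono2 m n x : (m <= n)%N -> P m x ^+ 2 <= P n x ^+ 2.
Proof. by move=> mn; rewrite lerXn2r ?nnegrE ?seminorm_ge0// Pmono. Qed.

Lemma qcont_qsum g n : (forall i, qcont P (g i)) -> qcont P (qsum g n).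
Proof.
move=> h; elim: n => [|n [m [C [C0 IH]]]].
  by exists 0%N, 0; split => // x; rewrite mul0r.
have [k [D [D0 hD]]] := h n; exists (maxn m k), (C + D).
split; first exact: addr_ge0.
move=> x; rewrite [qsum _ _]/= mulrDl; apply: lerD.
  by apply: (le_trans (IH x)); rewrite ler_wpM2l// Pmono2// leq_maxl.
by apply: (le_trans (hD x)); rewrite ler_wpM2l// Pmono2// leq_maxr.
Qed.

(** The Gram matrix of a form fits without error. *)
Lemma hilbertizable_of_forms :
  (forall m, exists h, qcont P h /\ exists C : R, 0 <= C /\ forall x, P m x ^+ 2 <= C * h x) ->
  hilbertizable.
Proof.
move=> H m; have [h [[n [C [C0 hC]]] [D [D0 hD]]]] := H m.
have [j jC] := le_natr_bound (D * C).
exists n, j => N x e e0; exists (fun i k => D * polar h (x i) (x k)) => a.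
have -> : bilin N (fun i k => D * polar h (x i) (x k)) a a = D * h (comb N a x).
  rewrite -polarxx polar_comb mulr_sumr; apply: eq_bigr => i _.
  rewrite polarC polar_comb mulr_sumr mulr_sumr; apply: eq_bigr => k _.
  by rewrite polarC; ring.
have e1 : 0 <= e * l1 N a ^+ 2 by rewrite mulr_ge0 ?sqr_ge0// ltW.
split.
  by apply: (le_trans (hD _)); rewrite lerDl.
apply: ler_wpDr => //; apply: (le_trans (ler_wpM2l D0 (hC _))).
by rewrite mulrA ler_wpM2r ?sqr_ge0.
Qed.

Lemma hilbertizableP : hilbertizable -> forall m, exists (h : qform V) n (C : R), 0 <= C /\
  forall x, P m x ^+ 2 <= h x <= C * P n x ^+ 2.
Proof.
move=> H m; have [n [C hC]] := H m.
have [h [h1 h2]] := qform_between (ler0n R C) hC.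
by exists h, n, C%:R; split => // x; rewrite h1 h2.
Qed.

Section ProductLike.
Variable g : nat -> qform V.
Hypothesis pg : product_like P g.

Let gcont i : qcont P (g i). Proof. by case: pg. Qed.

Let ggen m i0 : exists n (C : R), [/\ (i0 <= n)%N, 0 <= C &
  forall x, P m x ^+ 2 <= C * qsum g n x].
Proof.
have [_ /(_ m)[n [C [C0 h]]] _] := pg; exists (maxn i0 n), C.
split; rewrite ?leq_maxl// => x; apply: (le_trans (h x)).
by rewrite ler_wpM2l// qsum_mono// leq_maxr.
Qed.

Let gindep n (x : nat -> V) e : 0 < e ->
  exists y, forall i, (i < n)%N -> g i (y - x i) < e.
Proof. by case: pg => _ _; exact. Qed.

Lemma product_like_hilbertizable : hilbertizable.
Proof.
apply: hilbertizable_of_forms => m; have [n [C [_ C0 h]]] := ggen m 0.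
exists (qsum g n); split; first exact: qcont_qsum.
by exists C.
Qed.

(** Replacing by zero the coordinates beyond those that determine [P m] gives a
    vector that is bounded for every seminorm. *)
Lemma product_like_quojective : quojective.
Proof.
move=> m; have [n0 [C [_ C0 hC]]] := ggen m 0.
have [n [D [D0 hD]]] := qcont_qsum n0 gcont.
exists n => k; have [L [K [n0L K0 hK]]] := ggen k n0.
have [j jK] := le_natr_bound (K * (2 * D + L.+1%:R) + 1).
exists j.+1 => x e e0 Px.
pose d := Num.min (1 / 2) (e ^+ 2 / (C * L.+1%:R + 1)).
have c1 : 0 < C * L.+1%:R + 1 by rewrite ltr_wpDl// mulr_ge0.
have d0 : 0 < d by rewrite lt_min !divr_gt0// exprn_gt0.
have d1 : d <= 1 / 2 by rewrite ge_min lexx.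
have d2 : d * (C * L.+1%:R + 1) <= e ^+ 2.
  by rewrite -ler_pdivlMr// ge_min lexx orbT.
have [y hy] := gindep L (fun i => if (i < n0)%N then x else 0) d0.
have sx : qsum g n0 x <= D.
  apply: (le_trans (hD x)); rewrite ler_piMr// expr_le1 ?seminorm_ge0//.
  exact: ltW.
have nL : n0%:R * d <= L.+1%:R * d by rewrite ler_pM2r// ler_nat leqW.
exists y; split.
- have : qsum g L y <= 2 * qsum g n0 x + L.+1%:R * (2 * d).
    rewrite -(subnKC n0L) !qsumE big_split_ord/=.
    have s1 : \sum_(i < n0) g i y <= 2 * (\sum_(i < n0) g i x) + n0%:R * (2 * d).
      have -> : n0%:R * (2 * d) = \sum_(i < n0) (2 * d).
        exact: natr_mul_sum.
      rewrite mulr_sumr -big_split/=; apply: ler_sum => i _.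
      have := hy i (leq_trans (ltn_ord i) n0L); rewrite ltn_ord => /ltW h.
      by have := qfD_le (g i) (y - x) x; rewrite subrK; lra.
    have s2 : \sum_(i < L - n0) g (n0 + i)%N y <= (L - n0)%:R * (2 * d).
      have -> : (L - n0)%:R * (2 * d) = \sum_(i < L - n0) (2 * d).
        exact: natr_mul_sum.
      apply: ler_sum => i _.
      have := hy (n0 + i)%N; rewrite -ltn_subRL ltn_ord => /(_ isT).
      rewrite (_ : (n0 + i < n0)%N = false); last by rewrite ltnNge leq_addr.
      by rewrite subr0; lra.
    rewrite (subnKC n0L).
    have -> : L.+1%:R * (2 * d) = n0%:R * (2 * d) + (L - n0)%:R * (2 * d) + 2 * d.
      by rewrite -mulrDl -natrD subnKC// -natr1 mulrDl mul1r.
    lra.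
  move=> sy; have : P k y ^+ 2 < j.+1%:R ^+ 2.
    apply: (le_lt_trans (hK y)).
    have h1 : K * qsum g L y <= K * (2 * D + L.+1%:R).
      rewrite ler_wpM2l// (le_trans sy)//.
      have : L.+1%:R * (2 * d) <= L.+1%:R * 1 by rewrite ler_wpM2l//; lra.
      lra.
    have j1 : (1 : R) <= j.+1%:R by rewrite ler1n.
    have : (j.+1%:R : R) <= j.+1%:R ^+ 2 by rewrite expr2 ler_peMr.
    have : (j%:R : R) < j.+1%:R by rewrite ltr_nat.
    lra.
  by rewrite ltr_pXn2r// ?nnegrE ?seminorm_ge0.
- have s : qsum g n0 (x - y) <= L.+1%:R * d.
    apply: le_trans nL; rewrite qsumE.
    have -> : n0%:R * d = \sum_(i < n0) d by exact: natr_mul_sum.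
    apply: ler_sum => i _.
    have := hy i (leq_trans (ltn_ord i) n0L); rewrite ltn_ord qfC.
    exact: ltW.
  have : P m (x - y) ^+ 2 < e ^+ 2.
    apply: (le_lt_trans (hC _)); apply: (le_lt_trans (ler_wpM2l C0 s)).
    by nra.
  by rewrite ltr_pXn2r// ?nnegrE ?seminorm_ge0// ltW.
Qed.

(** On a subspace of large dimension some vector is killed by the finitely many
    functionals that describe the factors from [i0] on, and [P n] sees only the
    first [i0] factors of it. *)
Lemma finite_tail i0 : (forall i, (i0 <= i)%N -> finite_rank (g i)) ->
  forall n, exists N (C : R), 0 <= C /\ forall x : nat -> V, exists a,
    0 < l1 N a /\ P n (comb N a x) ^+ 2 <= C * qsum g i0 (comb N a x).
Proof.
move=> fin n; have [I [C [i0I C0 hC]]] := ggen n i0.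
have [N [f [ff fI]]] := @finite_rank_qsum _ _ (fun k => g (i0 + k)%N) (I - i0)
  (fun k => fin (i0 + k)%N (leq_addr k i0)).
exists N.+1, C; split => // x.
have [a [a0 af]] := kill_functionals N x ff.
exists a; split => //; apply: (le_trans (hC _)); rewrite ler_wpM2l//.
have := fI _ af; rewrite !qsumE => tail0.
by rewrite -[in leLHS](subnKC i0I) big_split_ord/= tail0 addr0.
Qed.

Lemma finite_not_non_schwartz : (forall i, finite_rank (g i)) -> ~ non_schwartz.
Proof.
move=> fin [n hn]; have [j hj] := hn 0%N.
have [N [C [C0 hN]]] := finite_tail (i0 := 0) (fun i _ => fin i) n.
have [x [e [e0 hx]]] := hj N; have [a [a0 ha]] := hN x.
have p0 := seminorm_ge0 (P n) (comb N a x).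
have := hx a; rewrite /= mulr0 in ha.
have pn : P n (comb N a x) = 0.
  by apply/eqP; rewrite -sqrf_eq0 eq_le ha sqr_ge0.
have := mulr_gt0 e0 a0.
have : 0 <= j.+1%:R^-1 * P 0%N (comb N a x).
  by rewrite mulr_ge0 ?invr_ge0 ?ler0n ?seminorm_ge0.
rewrite pn => h1 h2; rewrite leNgt => /negP; apply.
exact: ltr_wpDl.
Qed.

(** A seminorm [P m] that bounds the first [i0] factors cannot be dominated with
    large constants on subspaces of large dimension. *)
Lemma eventually_finite_not_infinite_steps i0 :
  (forall i, (i0 <= i)%N -> finite_rank (g i)) -> ~ infinite_steps.
Proof.
move=> fin H; have [m [D [D0 hD]]] := qcont_qsum i0 gcont.
have [n hn] := H m; have [N [C [C0 hN]]] := finite_tail fin n.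
have [j hj] := le_natr_bound (C * D + 1).
have [x [e [e0 hx]]] := hn j N; have [a [a0 ha]] := hN x.
have := hx a; set u := comb N a x in ha *.
have pm := seminorm_ge0 (P m) u; have pn := seminorm_ge0 (P n) u.
have el := mulr_gt0 e0 a0.
have : P n u ^+ 2 <= C * (D * P m u ^+ 2).
  by apply: (le_trans ha); rewrite ler_wpM2l.
rewrite leNgt => /negP + h; apply.
have j1 : 1 <= j%:R :> R by apply: le_trans hj; rewrite lerDr mulr_ge0.
have : (j%:R * P m u) ^+ 2 < P n u ^+ 2.
  by rewrite ltr_pXn2r// ?nnegrE ?mulr_ge0//; lra.
apply: le_lt_trans; rewrite exprMn mulrA ler_wpM2r ?sqr_ge0//.
by apply: (@le_trans _ _ j%:R); [lra|rewrite expr2 ler_peMr].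
Qed.

End ProductLike.

Lemma sqrt_bound (c u v : R) : 0 <= c -> 0 <= u -> 0 <= v ->
  u ^+ 2 <= c * v ^+ 2 -> u <= Num.sqrt c * v.
Proof.
move=> c0 u0 v0 h; rewrite -(@ler_pXn2r _ 2)// ?nnegrE ?mulr_ge0 ?sqrtr_ge0//.
by rewrite exprMn sqr_sqrtr.
Qed.

(** A Hilbert space quotient of infinite dimension contradicts the Schwartz
    property once its unit vectors lift uniformly, which the independence of
    [t] from complementary forms [g] expresses. *)
Lemma non_schwartz_of_indep t : qcont P t -> infinite_rank t ->
  (forall k, exists g (C : R), [/\ indep2 t g, 0 <= C &
    forall x, P k x ^+ 2 <= C * (t x + g x)]) -> non_schwartz.
Proof.
move=> [n [C [C0 hC]]] it H; exists n => k.
have [g [D [tg D0 hD]]] := H k.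
pose c := Num.sqrt C + 1; pose d := Num.sqrt (3 * D).
have c0 : 0 < c by rewrite ltr_wpDl ?sqrtr_ge0.
have d0 : 0 <= d by exact: sqrtr_ge0.
have [j hj] := le_natr_bound (4 * c * d); exists j => N.
have eta0 : 0 < 1 / 2 :> R by rewrite divr_gt0.
have [y hy] := indep2_lift N tg it eta0.
exists y, ((4 * c)^-1 / N.+1%:R); split; first by rewrite divr_gt0 ?invr_gt0 ?mulr_gt0 ?ltr0n.
move=> a; have [h1 h2 h3] := hy a.
set s := Num.sqrt _ in h1 h2 h3; set u := comb N a y in h1 h2 h3 *.
have s0 : 0 <= s by exact: sqrtr_ge0.
have g1 : (2 * c)^-1 * s <= P n u.
  have tn : qnorm t u <= c * P n u.
    have : qnorm t u <= Num.sqrt C * P n u.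
      by apply: sqrt_bound; rewrite ?qnorm_ge0 ?seminorm_ge0// qnorm_sqr.
    by have := seminorm_ge0 (P n) u; rewrite /c; lra.
  rewrite mulrC ler_pdivrMr ?mulr_gt0//; nra.
have g2 : P k u <= d * s.
  apply: sqrt_bound; rewrite ?mulr_ge0 ?seminorm_ge0//.
  apply: (le_trans (hD u)); rewrite -!qnorm_sqr (mulrC 3) -mulrA ler_wpM2l//.
  by have := qnorm_ge0 t u; have := qnorm_ge0 g u; nra.
have g3 : j.+1%:R^-1 * P k u <= (4 * c)^-1 * s.
  rewrite mulrC ler_pdivrMr ?ltr0n//; apply: (le_trans g2).
  rewrite mulrAC ler_wpM2r// mulrC ler_pdivlMr ?mulr_gt0// mulrC.
  by apply: (le_trans hj); rewrite ler_nat.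
have g4 : (4 * c)^-1 / N.+1%:R * l1 N a <= (4 * c)^-1 * s.
  rewrite -mulrA ler_wpM2l ?invr_ge0 ?mulr_ge0 ?(ltW c0)//.
  rewrite mulrC ler_pdivrMr ?ltr0n//; apply: (le_trans (l1_le_sqrt N a)).
  by rewrite mulrC ler_wpM2l// ler_nat.
have E : (2 * c)^-1 * s = (4 * c)^-1 * s + (4 * c)^-1 * s.
  by field; rewrite gt_eqF.
by apply: (le_trans (lerD g3 g4)); rewrite -E.
Qed.

Section ProductLike2.
Variable g : nat -> qform V.
Hypothesis pg : product_like P g.

Lemma product_like_indep2 i n :
  indep2 (g i) (qsum (fun l => if l == i then qzero V else g l) n).
Proof.
have [gc gg gi] := pg; move=> x e e0.
have e1 : 0 < e / n.+1%:R by rewrite divr_gt0 ?ltr0n.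
have [y hy] := gi (maxn i.+1 n) (fun l => if l == i then x else 0) _ e1.
exists y; split.
  have := hy i; rewrite leq_max leqnn eqxx => /(_ isT); rewrite qfC => /lt_le_trans; apply.
  by rewrite ler_pdivrMr ?ltr0n// ler_peMr ?(ltW e0)// ler1n.
apply: (@le_lt_trans _ _ (n%:R * (e / n.+1%:R))).
  rewrite natr_mul_sum qsumE; apply: ler_sum => l _.
  case: ifP => [_|li]; first by rewrite /= ltW.
  have := hy l; rewrite leq_max ltn_ord orbT li subr0 => /(_ isT).
  exact: ltW.
by rewrite mulrCA gtr_pMr// ltr_pdivrMr ?ltr0n// mul1r ltr_nat.
Qed.

Lemma infinite_non_schwartz i : infinite_rank (g i) -> non_schwartz.
Proof.
have [gc gg gi] := pg; move=> ii; apply: (non_schwartz_of_indep (gc i) ii) => k.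
have [n [C [C0 hC]]] := gg k.
pose g' l := if l == i then qzero V else g l.
exists (qsum g' n), C; split => //; first exact: product_like_indep2.
- move=> x; apply: (le_trans (hC x)); rewrite ler_wpM2l// !qsumE.
  have [iltn|nlei] := ltnP i n.
    rewrite (bigD1 (Ordinal iltn))//= lerD2l [leRHS](bigD1 (Ordinal iltn))//=.
    apply: ler_wpDl; first exact: qf_ge0.
    by apply: ler_sum => l; rewrite -val_eqE /g' /= => /negPf->.
  apply: ler_wpDl; first exact: qf_ge0.
  apply: ler_sum => l _; rewrite /g'.
  by rewrite (_ : (_ == _) = false)//; apply/negbTE; rewrite neq_ltn (leq_trans (ltn_ord l) nlei).
Qed.

(** Given [m], an infinite-dimensional factor outside of those that determine
    [P m] contains subspaces on which [P m] is as small as one wishes. *)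
Lemma infinite_infinite_steps :
  (forall i, exists2 l, (i <= l)%N & infinite_rank (g l)) -> infinite_steps.
Proof.
have [gc gg gi] := pg; move=> H m; have [L [D [D0 hD]]] := gg m.
have [i Li ii] := H L; have [n [C [C0 hC]]] := gc i; exists n => j N.
have tg : indep2 (g i) (qsum g L).
  move=> x e /(product_like_indep2 i L x)[y [xy gy]]; exists y; split => //.
  apply: le_lt_trans gy; rewrite !qsumE; apply: ler_sum => l _.
  by rewrite ltn_eqF// (leq_trans (ltn_ord l) Li).
pose c := Num.sqrt C + 1; pose d := Num.sqrt D.
have c0 : 0 < c by rewrite ltr_wpDl ?sqrtr_ge0.
have d0 : 0 <= d by exact: sqrtr_ge0.
pose eta := (4 * (c * d * j%:R + 1))^-1.
have w0 : 0 < 4 * (c * d * j%:R + 1).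
  by rewrite mulr_gt0// ltr_wpDl// !mulr_ge0// ltW.
have eta0 : 0 < eta by rewrite invr_gt0.
have etaE : eta * (4 * (c * d * j%:R + 1)) = 1 by rewrite mulVf ?gt_eqF.
have cdj : 0 <= c * d * j%:R by rewrite !mulr_ge0// ltW.
have [y hy] := indep2_lift N tg ii eta0.
exists y, ((4 * c)^-1 / N.+1%:R); split; first by rewrite divr_gt0 ?invr_gt0 ?mulr_gt0 ?ltr0n.
move=> a; have [h1 h2 h3] := hy a.
set s := Num.sqrt _ in h1 h2 h3; set u := comb N a y in h1 h2 h3 *.
have s0 : 0 <= s by exact: sqrtr_ge0.
have g4 : (4 * c)^-1 / N.+1%:R * l1 N a <= (4 * c)^-1 * s.
  rewrite -mulrA ler_wpM2l ?invr_ge0 ?mulr_ge0 ?(ltW c0)//.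
  rewrite mulrC ler_pdivrMr ?ltr0n//; apply: (le_trans (l1_le_sqrt N a)).
  by rewrite mulrC ler_wpM2l// ler_nat.
have tn : qnorm (g i) u <= c * P n u.
  have : qnorm (g i) u <= Num.sqrt C * P n u.
    by apply: sqrt_bound; rewrite ?qnorm_ge0 ?seminorm_ge0// qnorm_sqr.
  by have := seminorm_ge0 (P n) u; rewrite /c; lra.
have pm : P m u <= d * (eta * s).
  apply: (@le_trans _ _ (d * qnorm (qsum g L) u)); last by rewrite ler_wpM2l.
  by apply: sqrt_bound; rewrite ?qnorm_ge0 ?seminorm_ge0// qnorm_sqr.
have k4 : c * ((4 * c)^-1 * s) = s / 4 by field; rewrite gt_eqF.
have key : c * (j%:R * P m u) <= s / 4.
  have : c * j%:R * P m u <= c * j%:R * (d * (eta * s)).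
    by rewrite ler_wpM2l// mulr_ge0// ltW.
  have -> : c * j%:R * (d * (eta * s)) = (c * d * j%:R) * eta * s by ring.
  have : c * d * j%:R * eta * s <= 1 / 4 * s.
    rewrite ler_wpM2r//; nra.
  lra.
have h4 : (1 - eta) * s <= c * P n u by exact: le_trans h1 tn.
have eta4 : eta * s <= 1 / 4 * s by rewrite ler_wpM2r//; nra.
rewrite -(ler_pM2l c0) mulrDr.
have : c * ((4 * c)^-1 / N.+1%:R * l1 N a) <= s / 4.
  by rewrite -k4 ler_wpM2l// ltW.
move: (c * (_ * l1 N a)) => w; move: key; move: (c * (j%:R * _)) => v; lra.
Qed.

(** A nonzero factor outside of those that determine [P m] has vectors that [P m]
    nearly annihilates. *)
Lemma nonzero_not_normable :
  (forall i, exists2 l, (i <= l)%N & exists x, g l x != 0) -> ~ normable.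
Proof.
have [gc gg gi] := pg; move=> H [m hm].
have [L [D [D0 hD]]] := gg m; have [i Li [x gx]] := H L.
have [n [C [C0 hC]]] := gc i; have [K hK] := hm n.
pose M := C * (K%:R ^+ 2 * D).
have M0 : 0 <= M by rewrite !mulr_ge0 ?sqr_ge0.
have bound u : g i u <= M * qsum g L u.
  apply: (le_trans (hC u)).
  have -> : M * qsum g L u = C * (K%:R ^+ 2 * (D * qsum g L u)) by rewrite /M !mulrA.
  rewrite ler_wpM2l//.
  apply: (@le_trans _ _ ((K%:R * P m u) ^+ 2)).
    by rewrite lerXn2r ?nnegrE ?mulr_ge0 ?seminorm_ge0.
  by rewrite exprMn ler_wpM2l ?sqr_ge0.
have gx0 : 0 < g i x by rewrite lt_def gx qf_ge0.
pose e := g i x / (2 * (M * L%:R + 1) + 1).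
have w0 : 0 < 2 * (M * L%:R + 1) + 1 by rewrite ltr_wpDl// mulr_ge0// addr_ge0// mulr_ge0.
have e0 : 0 < e by rewrite divr_gt0.
have eE : e * (2 * (M * L%:R + 1) + 1) = g i x by rewrite divfK// gt_eqF.
have [y hy] := gi i.+1 (fun l => if l == i then x else 0) _ e0.
have := hy i (leqnn _); rewrite eqxx => yx.
have : qsum g L y <= L%:R * e.
  have -> : L%:R * e = \sum_(l < L) e by exact: natr_mul_sum.
  rewrite qsumE; apply: ler_sum => l _.
  have lti := leq_trans (ltn_ord l) Li.
  have := hy l (ltnW lti); rewrite (ltn_eqF lti) subr0.
  exact: ltW.
move=> /(ler_wpM2l M0) yL.
have := qfD_le (g i) (x - y) y; rewrite subrK qfC.
have := bound y; nra.
Qed.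

Lemma finitely_nonzero_normable i0 :
  (forall i x, (i0 <= i)%N -> g i x = 0) -> normable.
Proof.
have [gc gg gi] := pg; move=> H.
have [m [D [D0 hD]]] := qcont_qsum i0 gc; exists m => n.
have [L [C [C0 hC]]] := gg n.
have [j hj] := le_natr_bound (Num.sqrt (C * D)); exists j => x.
have : P n x ^+ 2 <= C * D * P m x ^+ 2.
  apply: (le_trans (hC x)); rewrite -mulrA ler_wpM2l//.
  apply: le_trans (hD x); apply: (le_trans (qsum_mono g x (leq_addl i0 L))).
  by elim: L {hC} => [|L IH]; rewrite ?addn0// addnS /= H ?addr0 ?leq_addr.
move=> /sqrt_bound h; apply: (le_trans (h _ _ _)); rewrite ?seminorm_ge0 ?mulr_ge0//.
by rewrite ler_wpM2r ?seminorm_ge0.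
Qed.

End ProductLike2.

(** The indices [M j] are chosen so that the forms at consecutive indices dominate
    each other's seminorms and each index absorbs the one that [quojective]
    provides for its predecessor. *)
Lemma product_like_exists : hilbertizable -> quojective ->
  exists g, product_like P g.
Proof.
move=> /hilbertizableP/choice[h /choice[nx /choice[K hK]]] /choice[nq hq].
pose M := fix M j := if j is i.+1 then
  maxn (maxn (nx (M i)) (nq (nx (M i)))) i.+1 else 0%N.
pose A j := h (M j).
have hl j x : P (M j) x ^+ 2 <= A j x.
  by have [_ /(_ x)/andP[]] := hK (M j).
have hu j x : A j x <= K (M j) * P (nx (M j)) x ^+ 2.
  by have [_ /(_ x)/andP[]] := hK (M j).
have K0 j : 0 <= K (M j) by have [] := hK (M j).
apply: (@product_like_of_chain _ _ _ A).
- move=> j; exists (K (M j)); split => // x; apply: (le_trans (hu j x)).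
  rewrite ler_wpM2l//; apply: le_trans (hl j.+1 x).
  by rewrite Pmono2// /= !leq_max leqnn.
- by move=> j; exists (nx (M j)), (K (M j)).
- move=> m; exists m, 1; split => // x; rewrite mul1r; apply: le_trans (hl m x).
  by rewrite Pmono2//; case: m => [//|m] /=; rewrite leq_max leqnn orbT.
- move=> j; have [C hC] := hq (nx (M j)) (nx (M j.+2)).
  pose D := K (M j.+2) * C%:R ^+ 2.
  have D0 : 0 <= D by rewrite mulr_ge0 ?sqr_ge0.
  exists (8 * D); split; first exact: mulr_ge0.
  move=> x e e0.
  pose t := qnorm (A j.+1) x; have t0 : 0 <= t by exact: qnorm_ge0.
  pose d := Num.min 1 (e / (2 * D + 1)).
  have w0 : 0 < 2 * D + 1 by rewrite ltr_wpDl// mulr_ge0.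
  have d0 : 0 < d by rewrite lt_min ltr01 divr_gt0.
  have dw : d * (2 * D + 1) <= e by rewrite -ler_pdivlMr// ge_min lexx orbT.
  have d1 : d <= 1 by rewrite ge_min lexx.
  pose s := 2 * t + d; have s0 : 0 < s by rewrite ltr_wpDl// mulr_ge0.
  have Px : P (nq (nx (M j))) (s^-1 *: x) < 1.
    rewrite seminormZ gtr0_norm ?invr_gt0// mulrC ltr_pdivrMr// mul1r.
    apply: (@le_lt_trans _ _ t); last by rewrite /s; lra.
    apply: (@le_trans _ _ (P (M j.+1) x)).
      by apply: Pmono; rewrite /= !leq_max leqnn orbT.
    by rewrite -(@ler_pXn2r _ 2)// ?nnegrE ?seminorm_ge0// qnorm_sqr.
  pose r := (K (M j) + 1) * s ^+ 2.
  have r0 : 0 < r by rewrite mulr_gt0 ?exprn_gt0// ltr_wpDl.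
  pose e1 := Num.min 1 (e / r).
  have e10 : 0 < e1 by rewrite lt_min ltr01 divr_gt0.
  have [y [yC yx]] := hC _ _ e10 Px.
  exists (s *: y); split.
    have -> : x - s *: y = s *: (s^-1 *: x - y).
      by rewrite scalerBr scalerA divff ?scale1r// gt_eqF.
    rewrite qfZ; apply: (@le_lt_trans _ _ (s ^+ 2 * (K (M j) * e1))).
      rewrite ler_wpM2l ?sqr_ge0//; apply: (le_trans (hu _ _)).
      rewrite ler_wpM2l//; apply: (@le_trans _ _ (e1 ^+ 2)).
        by rewrite lerXn2r ?nnegrE ?seminorm_ge0 ?(ltW e10)// ltW.
      by rewrite expr2 ler_piMr ?(ltW e10)// ge_min lexx.
    have : e1 * r <= e by rewrite -ler_pdivlMr// ge_min lexx orbT.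
    rewrite /r; have : 0 < e1 * s ^+ 2 by rewrite mulr_gt0 ?exprn_gt0.
    lra.
  rewrite qfZ; have Ay : A j.+2 y <= D.
    apply: (le_trans (hu _ _)); rewrite /D ler_wpM2l//.
    by rewrite lerXn2r ?nnegrE ?seminorm_ge0// ltW.
  have s2 : s ^+ 2 <= 8 * t ^+ 2 + 2 * d.
    by have := sqr_ge0 (2 * t - d); rewrite /s; nra.
  have -> : A j.+1 x = t ^+ 2 by rewrite qnorm_sqr.
  have := ler_wpM2l (sqr_ge0 s) Ay.
  have := ler_wpM2r D0 s2; nra.
Qed.

End Conditions.

(** * The sequence space l2 *)

Section Ell2.
Context (R : realType).
Implicit Types (u v : ell2 R).

Lemma ell2_cvg u : cvgn (series (val u * val u)).
Proof. by have /asboolP := valP u. Qed.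

Lemma ell2_norm_sqr u : `|u| ^+ 2 = limn (series (val u * val u)).
Proof.
by rewrite -[`|u|]/(ell2_norm u) /ell2_norm sqr_sqrtr// ell2_dot_ge0.
Qed.

Lemma ell2_series u n : series (val u * val u) n = \sum_(i < n) val u i ^+ 2.
Proof.
by rewrite /series /= big_mkord; apply: eq_bigr => i _; rewrite expr2.
Qed.

Let nd_series (x : nat -> R) : nondecreasing_seq (series (x * x)).
Proof. by apply/nondecreasing_series => i _ _; exact: sqr_ge0. Qed.

Lemma ell2_sum_le u n : \sum_(i < n) val u i ^+ 2 <= `|u| ^+ 2.
Proof.
rewrite ell2_norm_sqr -ell2_series.
by have := nondecreasing_cvgn_le (nd_series (val u)) (@ell2_cvg u) n.
Qed.

Lemma ell2_norm_le u (C : R) : (forall n, \sum_(i < n) val u i ^+ 2 <= C) ->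
  `|u| ^+ 2 <= C.
Proof.
move=> h; rewrite ell2_norm_sqr; apply: (limr_le (@ell2_cvg u)).
by apply: nearW => n; rewrite ell2_series.
Qed.

Lemma ell2_coord_le u n : `|val u n| <= `|u|.
Proof.
rewrite -(@ler_pXn2r _ 2)// ?nnegrE// real_normK ?num_real//.
apply: le_trans (ell2_sum_le u n.+1); rewrite big_ord_recr/= lerDr.
by apply: sumr_ge0 => i _; exact: sqr_ge0.
Qed.

Lemma square_summableP (x : nat -> R) (C : R) :
  (forall n, \sum_(i < n) x i ^+ 2 <= C) -> x \in @square_summable R.
Proof.
move=> h; apply/asboolP; apply: (nondecreasing_is_cvgn (nd_series x)).
exists C => _ [n _ <-]; apply: le_trans (h n).
by rewrite /series /= big_mkord; apply: ler_sum => i _; rewrite expr2.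
Qed.

Definition mk_ell2 (x : nat -> R) (h : x \in @square_summable R) : ell2 R := Sub x h.

(** The tails of an element of l2 are small; [v] stands for such a tail. *)
Lemma ell2_trunc u (e : R) : 0 < e -> exists N, forall n v, (N <= n)%N ->
  (forall i, (i < n)%N -> val v i = 0) -> (forall i, (n <= i)%N -> val v i = val u i) ->
  `|v| < e.
Proof.
move=> e0; have e20 : 0 < e ^+ 2 by rewrite exprn_gt0.
have /cvgrPdist_lt /(_ _ e20)[N _ hn] := @ell2_cvg u.
exists N => n v Nn v0 vu.
have e4 : `|v| ^+ 2 < e ^+ 2; last first.
  by rewrite -(@ltr_pXn2r _ 2)// ?nnegrE// ltW.
have := hn n Nn; rewrite -ell2_norm_sqr ell2_series.
move=> /(le_lt_trans (ler_norm _)); apply: le_lt_trans.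
apply: ell2_norm_le => m; have [mn|/ltnW nm] := leqP m n.
  rewrite big1 ?subr_ge0 ?ell2_sum_le// => i _.
  by rewrite v0 ?expr0n// (leq_trans (ltn_ord i)).
rewrite lerBrDr; apply: le_trans (ell2_sum_le u m).
rewrite -(subnKC nm) !big_split_ord/= big1 ?add0r => [|i _]; last first.
  by rewrite v0 ?expr0n.
rewrite addrC; apply: lerD => //.
by apply: ler_sum => i _; rewrite vu// leq_addr.
Qed.

Definition qell2 : qform (ell2 R).
Proof.
exists (fun u => `|u| ^+ 2) => [u|a u|u v]; first exact: sqr_ge0.
- by rewrite normrZ exprMn real_normK ?num_real.
- have E w : `|w| ^+ 2 = ell2_dot w w.
    by rewrite -[`|w|]/(ell2_norm w) sqr_sqrtr// ell2_dot_ge0.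
  have NE w z : ell2_dot (- w) z = - ell2_dot w z.
    by rewrite -scaleN1r ell2_dotZl mulN1r.
  have DE w z z' : ell2_dot w (z + z') = ell2_dot w z + ell2_dot w z'.
    by rewrite ell2_dotC ell2_dotDl !(ell2_dotC _ w).
  have NE' w z : ell2_dot w (- z) = - ell2_dot w z by rewrite ell2_dotC NE ell2_dotC.
  rewrite !E !ell2_dotDl !DE !NE' !NE (ell2_dotC v u); lra.
Defined.

Lemma qnorm_ell2 u : qnorm qell2 u = `|u|.
Proof. by rewrite /qnorm /= sqrtr_sqr normr_id. Qed.

End Ell2.

(** * Orthonormal bases *)

Definition bundle_linear (R : realType) (V W : lmodType R) (f : V -> W)
  (fl : linear f) : {linear V -> W} := HB.pack f (GRing.isLinear.Build R V W _ f fl).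

Section Bases.
Context (R : realType) (V : lmodType R).
Implicit Types (q : qform V).

(** Dependent choice on the list of the earlier terms. *)
Lemma seq_choice (Q : nat -> seq V -> V -> Prop) :
  (forall n s, exists z, Q n s z) ->
  exists b : nat -> V, forall n, Q n (mkseq b n) (b n).
Proof.
move=> H; have [f hf] := choice (fun ns : nat * seq V => H ns.1 ns.2).
pose S := fix S n := if n is m.+1 then rcons (S m) (f (m, S m)) else [::].
exists (fun n => f (n, S n)) => n.
suff -> : mkseq (fun n => f (n, S n)) n = S n by exact: (hf (n, S n)).
by elim: n => [//|n IH]; rewrite mkseqS IH.
Qed.

Definition orthonormal_seq q (b : nat -> V) :=
  forall i j, polar q (b i) (b j) = (i == j)%:R.

Definition parseval q (b : nat -> V) := forall x e, 0 < e ->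
  exists N, forall n, (N <= n)%N -> q (x - qproj q n b x) < e.

Lemma orthonormal_seqW q b N : orthonormal_seq q b -> orthonormal q N b.
Proof. by move=> h i j _ _; exact: h. Qed.

Lemma qproj_lin q N b (c : R) x y :
  qproj q N b (c *: x + y) = c *: qproj q N b x + qproj q N b y.
Proof.
rewrite /qproj /comb scaler_sumr -big_split/=; apply: eq_bigr => i _.
by rewrite polarDl polarZl scalerA -scalerDl.
Qed.

Lemma qprojB q N b x y : qproj q N b (x - y) = qproj q N b x - qproj q N b y.
Proof. by rewrite addrC -scaleN1r qproj_lin scaleN1r addrC. Qed.

Lemma bessel q b x n : orthonormal_seq q b ->
  \sum_(i < n) polar q x (b i) ^+ 2 <= q x.
Proof.
by move=> ob; rewrite -subr_ge0 -qf_sub_proj ?qf_ge0.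
Qed.

Lemma residual_mono q b x m n : orthonormal_seq q b -> (m <= n)%N ->
  q (x - qproj q n b x) <= q (x - qproj q m b x).
Proof.
move=> ob mn; rewrite !qf_sub_proj; try exact: orthonormal_seqW.
rewrite lerD2l lerN2 -(subnKC mn) big_split_ord/= lerDl.
by apply: sumr_ge0 => i _; exact: sqr_ge0.
Qed.

(** An orthonormal basis is built by treating the vectors of a dense sequence at
    even steps; at odd steps the next basis vector may be prescribed by any
    condition [Z] that can be met orthogonally to finitely many vectors. *)
Lemma basis_with_requests q (d : nat -> V) (Z : nat -> seq V -> V -> Prop) :
  (forall x e, 0 < e -> exists k, q (x - d k) < e) ->
  (forall k s, exists z, [/\ q z = 1, forall u, u \in s -> polar q z u = 0 & Z k s z]) ->
  exists b, [/\ orthonormal_seq q b, parseval q b &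
    forall k, Z k (mkseq b k.*2.+1) (b k.*2.+1)].
Proof.
move=> dd HZ.
pose res s x := x - \sum_(w <- s) polar q x w *: w : V.
pose ok n s z := [/\ q z = 1, forall u, u \in s -> polar q z u = 0 &
  if odd n then Z n./2 s z else
    q (res s (d n./2)) = 0 \/ exists c, res s (d n./2) = c *: z].
have [|b hb] := @seq_choice (fun n s z =>
    (forall w, w \in s -> q w = 1) ->
    (forall i j, (i < size s)%N -> (j < size s)%N -> i != j ->
       polar q (nth 0 s i) (nth 0 s j) = 0) -> ok n s z).
  move=> n s.
  have [/asboolP[s1 s2]|/asboolPn ns] := boolP `[< (forall w, w \in s -> q w = 1) /\
     (forall i j, (i < size s)%N -> (j < size s)%N -> i != j ->
       polar q (nth 0 s i) (nth 0 s j) = 0) >]; last first.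
    by exists 0 => h1 h2; case: ns.
  have [on|en] := boolP (odd n).
    have [z [z1 z2 z3]] := HZ n./2 s; exists z => _ _; split => //.
    by rewrite on.
  have [r0|r0] := eqVneq (q (res s (d n./2))) 0.
    have [z [z1 z2 z3]] := HZ n./2 s; exists z => _ _; split => //.
    by rewrite (negPf en); left.
  have rpos : 0 < qnorm q (res s (d n./2)).
    by rewrite sqrtr_gt0 lt_def r0 qf_ge0.
  exists ((qnorm q (res s (d n./2)))^-1 *: res s (d n./2)) => _ _; split.
  - by rewrite qfZ -[q (res _ _)]qnorm_sqr -exprMn mulVf ?expr1n// gt_eqF.
  - move=> u us; rewrite polarZl polarBl polar_suml.
    rewrite (big_nth 0) big_mkord.
    have us' := us; rewrite -index_mem in us'.
    rewrite (bigD1 (Ordinal us'))//= big1 => [|i].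
      by rewrite nth_index// polarZl polarxx s1// mulr1 addr0 subrr mulr0.
    rewrite -val_eqE /= => iu; have := s2 i _ (ltn_ord i) us' iu.
    by rewrite nth_index// polarZl => ->; rewrite mulr0.
  - rewrite (negPf en); right; exists (qnorm q (res s (d n./2))).
    by rewrite scalerA divff ?scale1r// gt_eqF.
have hok n : (forall i j, (i < n)%N -> (j < n)%N -> polar q (b i) (b j) = (i == j)%:R)
    /\ ok n (mkseq b n) (b n).
  elim: n => [|n [IH okn]].
    by split => //; apply: hb.
  have on1 i j : (i < n.+1)%N -> (j < n.+1)%N -> polar q (b i) (b j) = (i == j)%:R.
    have [h1 h2 _] := okn.
    have bn k : (k < n)%N -> polar q (b n) (b k) = 0.
      by move=> kn; apply: h2; apply/mapP; exists k; rewrite ?mem_iota.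
    rewrite ltnS leq_eqVlt => /predU1P[->|iN]; rewrite ltnS leq_eqVlt => /predU1P[->|jN].
    - by rewrite eqxx polarxx.
    - by rewrite bn// gtn_eqF.
    - by rewrite polarC bn// ltn_eqF.
    - exact: IH.
  split => //; apply: hb.
    move=> w /mapP[k]; rewrite mem_iota => /andP[_ kn] ->.
    by have := on1 k k kn kn; rewrite polarxx eqxx.
  move=> i j; rewrite size_mkseq => iN jN ij.
  by rewrite !nth_mkseq// on1// (negPf ij).
have ob : orthonormal_seq q b.
  move=> i j; have [h _] := hok (maxn i j).+1.
  by apply: h; rewrite ltnS ?leq_maxl ?leq_maxr.
have resE n x : res (mkseq b n) x = x - qproj q n b x.
  by rewrite /res big_map /qproj /comb (_ : iota 0 n = index_iota 0 n) ?big_mkord// /index_iota subn0.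
exists b; split => //.
- move=> x e e0; have [k xk] := dd x e e0.
  exists k.*2.+1 => n kn; apply: le_lt_trans xk.
  apply: (le_trans (residual_mono _ ob kn)).
  have dk0 : q (d k - qproj q k.*2.+1 b (d k)) = 0.
    have [_ [_ _]] := hok k.*2; rewrite odd_double doubleK resE.
    have step : d k - qproj q k.*2.+1 b (d k) =
        d k - qproj q k.*2 b (d k) - polar q (d k) (b k.*2) *: b k.*2.
      by rewrite /qproj /comb big_ord_recr/= opprD addrA.
    case=> [r0|[c rc]].
      have : q (d k - qproj q k.*2.+1 b (d k)) <= q (d k - qproj q k.*2 b (d k)).
        exact: residual_mono.
      by rewrite r0 => h; apply/le_anti; rewrite h qf_ge0.
    have -> : d k - qproj q k.*2.+1 b (d k) = 0; last exact: qf0.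
    rewrite step rc -scalerBl.
    suff -> : polar q (d k) (b k.*2) = c by rewrite subrr scale0r.
    have := congr1 (fun v => polar q v (b k.*2)) rc.
    rewrite polarBl polarZl /qproj polar_comb ob eqxx mulr1 big1 ?subr0// => i _.
    by rewrite ob (ltn_eqF (ltn_ord i)) mulr0.
  have -> : x - qproj q k.*2.+1 b x =
      (x - d k - qproj q k.*2.+1 b (x - d k)) + (d k - qproj q k.*2.+1 b (d k)).
    by rewrite qprojB opprB addrACA subrK addrAC subrr sub0r.
  rewrite qfD_eq0// qf_sub_proj; last exact: orthonormal_seqW.
  by rewrite gerBl; apply: sumr_ge0 => i _; exact: sqr_ge0.
- by move=> k; have [_ [_ _]] := hok k.*2.+1; rewrite /= odd_double uphalf_double.
Qed.

(** Among more orthonormal vectors than [s] has elements, some combination is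
    orthogonal to [s]. *)
Lemma unit_orthogonal q : infinite_rank q -> forall s : seq V, exists z,
  q z = 1 /\ forall u, u \in s -> polar q z u = 0.
Proof.
move=> iq s; have [b ob] := iq (size s).+1.
have [a [a0 ha]] := kill_functionals (f := fun i v => polar q v (nth 0 s i)) (size s) b
  (fun i => functional_polar q (nth 0 s i)).
set z := comb _ a b in ha.
have qz : q z != 0.
  rewrite qf_orthonormal// psumr_eq0 => [|i _]; last exact: sqr_ge0.
  apply: contraL a0 => /allP h; rewrite /l1 big1 ?ltxx// => i _.
  by apply/eqP; rewrite normr_eq0; have := h i (mem_index_enum _); rewrite /= sqrf_eq0.
have nz : qnorm q z != 0 by rewrite gt_eqF// sqrtr_gt0 lt_def qz qf_ge0.
exists ((qnorm q z)^-1 *: z); split.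
  by rewrite qfZ -[q z]qnorm_sqr -exprMn mulVf ?expr1n.
move=> u us; rewrite polarZl -(nth_index 0 us) ha ?mulr0//.
by rewrite index_mem.
Qed.

Lemma orthonormal_basis q (d : nat -> V) : infinite_rank q ->
  (forall x e, 0 < e -> exists k, q (x - d k) < e) ->
  exists b, orthonormal_seq q b /\ parseval q b.
Proof.
move=> iq dd; have [|b [ob pb _]] := @basis_with_requests q d (fun _ _ _ => True) dd.
  by move=> _ s; have [z [z1 z2]] := unit_orthogonal iq s; exists z.
by exists b.
Qed.

(** Coordinates with respect to vectors satisfying a Bessel inequality. *)
Lemma coordinate_map q (v : nat -> V) (C : R) :
  (forall x n, \sum_(i < n) polar q x (v i) ^+ 2 <= C * q x) ->
  exists T : {linear V -> ell2 R},
    (forall x i, val (T x) i = polar q x (v i)) /\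
    forall x, `|T x| ^+ 2 <= C * q x.
Proof.
move=> h; have mem x : (fun i => polar q x (v i)) \in @square_summable R.
  exact: square_summableP (h x).
pose T x := mk_ell2 (mem x).
have Tlin : linear T.
  move=> c x y; apply/val_inj/funext => i.
  by rewrite /= polarDl polarZl.
by exists (bundle_linear Tlin); split => // x; apply: ell2_norm_le => n; exact: h.
Qed.

Lemma isometry_of_basis q b : orthonormal_seq q b -> parseval q b ->
  exists T : {linear V -> ell2 R}, [/\ forall x, `|T x| ^+ 2 = q x,
    forall x i, val (T x) i = polar q x (b i) &
    forall u e, 0 < e -> exists x, `|T x - u| < e].
Proof.
move=> ob pb.
have [|T [T1 T2]] := @coordinate_map q b 1.
  by move=> x n; rewrite mul1r bessel.
exists T; split => //.
- move=> x; apply/le_anti/andP; split; first by have := T2 x; rewrite mul1r.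
  apply/ler_addgt0Pr => e e0; have [N /(_ _ (leqnn N))] := pb x e e0.
  rewrite qf_sub_proj; last exact: orthonormal_seqW.
  have := ell2_sum_le (T x) N; under eq_bigr do rewrite T1.
  lra.
- move=> u e e0; have [n hn] := ell2_trunc u e0.
  exists (comb n (val u) b); rewrite -normrN opprB; apply: (hn n) => // i.
    move=> ilt; rewrite -[val _ i]/(val u i - val (T (comb n (val u) b)) i).
    by rewrite T1 polar_comb_orthonormal ?subrr//; exact: orthonormal_seqW.
  move=> ni; rewrite -[val _ i]/(val u i - val (T (comb n (val u) b)) i).
  rewrite T1 polar_comb big1 ?subr0// => k _.
  by rewrite ob ltn_eqF ?mulr0// (leq_trans (ltn_ord k)).
Qed.

End Bases.

(** * Frechet spaces given by seminorms *)

Section Frechet.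
Context (R : realType).

(** The facts on a separable Frechet space that are used, relative to an increasing
    sequence of seminorms; completeness and separation are sequential, which is
    all that a metrizable topology requires. *)
Record frechet (V : preTopologicalLmodType R) (P : nat -> seminorm V) : Prop := {
  frechet_mono : forall m n x, (m <= n)%N -> P m x <= P n x;
  frechet_nbhs : forall (x : V) (A : set V), nbhs x A <->
    exists m (e : R), 0 < e /\ forall y, P m (y - x) < e -> A y;
  frechet_complete : forall u : nat -> V,
    (forall m (e : R), 0 < e -> exists N, forall i j, (N <= i)%N -> (N <= j)%N ->
      P m (u i - u j) < e) ->
    exists x, forall m (e : R), 0 < e -> exists N, forall i, (N <= i)%N ->
      P m (u i - x) < e;
  frechet_sep : forall x, (forall m, P m x = 0) -> x = 0;
  frechet_dense : exists d : nat -> V, forall x m (e : R), 0 < e ->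
    exists k, P m (x - d k) < e }.

(** In contrast with [product_like], prescribed coordinates are attained exactly,
    and the forms separate points: [Y] is the product itself. *)
Record product_model (Y : preTopologicalLmodType R) (h : nat -> qform Y) : Prop := {
  model_gen : seminorms_generate (fun i => qf_seminorm (h i));
  model_sep : forall y, (forall i, h i y = 0) -> y = 0;
  model_indep : forall n (y : nat -> Y), exists z, forall i, (i < n)%N ->
    h i (z - y i) = 0 }.

Lemma seminorm_bound (V : lmodType R) (p q : seminorm V) (e : R) : 0 < e ->
  (forall x, p x < e -> q x < 1) -> forall x, q x <= 2 / e * p x.
Proof.
move=> e0 h x; apply/ler_addgt0Pr => d d0.
pose t := 2 / e * p x + d.
have px := seminorm_ge0 p x.
have t0 : 0 < t by rewrite ltr_wpDl// mulr_ge0// divr_ge0// ltW.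
have := h (t^-1 *: x); rewrite !seminormZ gtr0_norm ?invr_gt0//.
rewrite mulrC ltr_pdivrMr// [t^-1 * q x]mulrC ltr_pdivrMr// mul1r => H.
apply/ltW/H; rewrite /t mulrDr.
have -> : e * (2 / e * p x) = 2 * p x by field; rewrite gt_eqF.
have := mulr_gt0 e0 d0; lra.
Qed.

Section OneSpace.
Variables (V : preTopologicalLmodType R) (P : nat -> seminorm V).
Hypothesis fV : frechet P.

Let Pmono := frechet_mono fV.

Lemma frechet_bound (q : seminorm V) : nbhs (0 : V) [set x | q x < 1] ->
  exists n (C : R), 0 <= C /\ forall x, q x <= C * P n x.
Proof.
move=> /(frechet_nbhs fV)[n [e [e0 h]]]; exists n, (2 / e).
split; first by rewrite divr_ge0// ltW.
by apply: seminorm_bound => // x px; apply: h; rewrite subr0.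
Qed.

Lemma frechet_ball x m (e : R) : 0 < e -> nbhs x [set y | P m (y - x) < e].
Proof. by move=> e0; apply/(frechet_nbhs fV); exists m, e. Qed.

Section Model.
Variables (Y : preTopologicalLmodType R) (h : nat -> qform Y).
Hypothesis mY : product_model h.

(** By completeness, a linear embedding with dense range is onto. *)
Lemma linear_homeo_of_dense (T : {linear V -> Y}) :
  (forall i, exists n (C : R), 0 <= C /\ forall x, h i (T x) <= C * P n x ^+ 2) ->
  (forall m, exists n (C : R), 0 <= C /\
    forall x, P m x ^+ 2 <= C * \sum_(i < n) h i (T x)) ->
  (forall y n (e : R), 0 < e -> exists x, forall i, (i < n)%N -> h i (T x - y) < e) ->
  linear_homeo V Y.
Proof.
move=> Tc Te Td.
have surj y : exists x, T x = y.
  have ex k : exists x, forall i, (i < k)%N -> h i (T x - y) < k.+1%:R^-1.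
    by apply: Td; rewrite invr_gt0 ltr0n.
  have [u hu] := choice ex.
  have small (e : R) n : 0 < e -> exists N, forall k i, (N <= k)%N -> (i < n)%N ->
      h i (T (u k) - y) < e.
    move=> /small_invS[N hN]; exists (maxn n N) => k i; rewrite geq_max => /andP[nk Nk] ilt.
    exact: lt_trans (hu k i (leq_trans ilt nk)) (hN k Nk).
  have [|x hx] := frechet_complete fV (u := u).
    move=> m e e0; have [n [C [C0 hC]]] := Te m.
    pose w := C * n%:R * 4 + 1.
    have w0 : 0 < w by rewrite ltr_wpDl// !mulr_ge0.
    have d0 : 0 < e ^+ 2 / w by rewrite divr_gt0// exprn_gt0.
    have [N hN] := small _ n d0; exists N => i j Ni Nj.
    have : P m (u i - u j) ^+ 2 < e ^+ 2.
      apply: (le_lt_trans (hC _)).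
      have : \sum_(k < n) h k (T (u i - u j)) <= n%:R * (4 * (e ^+ 2 / w)).
        have -> : n%:R * (4 * (e ^+ 2 / w)) = \sum_(k < n) 4 * (e ^+ 2 / w).
          exact: natr_mul_sum.
        apply: ler_sum => k _; rewrite linearB.
        have := qf_trans (h k) y (T (u i)) (T (u j)).
        have := hN i k Ni (ltn_ord k); have := hN j k Nj (ltn_ord k).
        by rewrite [X in _ -> _ -> X]/=; rewrite (qfC _ y); lra.
      move=> /(ler_wpM2l C0)/le_lt_trans; apply.
      have : e ^+ 2 / w * w = e ^+ 2 by rewrite divfK// gt_eqF.
      by rewrite /w; lra.
    by rewrite ltr_pXn2r// ?nnegrE ?seminorm_ge0// ltW.
  exists x; apply/eqP; rewrite -subr_eq0; apply/eqP/(model_sep mY) => i.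
  apply/le_anti; rewrite qf_ge0 andbT; apply: le_of_lt_add => e e0; rewrite add0r.
  have [n [C [C0 hC]]] := Tc i.
  have w0 : 0 < C + 1 by rewrite ltr_wpDl.
  have e4 : 0 < e / 4 by rewrite divr_gt0.
  have d0 : 0 < Num.min 1 (e / 4 / (C + 1)) by rewrite lt_min ltr01 divr_gt0.
  have [N hN] := hx n _ d0; have [M hM] := small _ i.+1 e4.
  have := hM (maxn N M) i (leq_maxr _ _) (ltnSn _).
  have := hN (maxn N M) (leq_maxl _ _); set k := maxn N M => xk yk.
  apply: (le_lt_trans (qf_trans (h i) (T (u k)) _ _)).
  have : h i (T x - T (u k)) <= e / 4.
    rewrite -linearB; apply: (le_trans (hC _)); rewrite seminormC.
    apply: (@le_trans _ _ (C * (e / 4 / (C + 1)))).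
      rewrite ler_wpM2l//; apply: (@le_trans _ _ (P n (u k - x))).
        rewrite expr2 ler_piMr ?seminorm_ge0// (le_trans (ltW xk))//.
        by rewrite ge_min lexx.
      by apply: (le_trans (ltW xk)); rewrite ge_min lexx orbT.
    rewrite mulrCA ler_piMr ?(ltW e4)// ler_pdivrMr// mul1r lerDl.
    exact: ler01.
  lra.
have inj x y : T x = T y -> x = y.
  move=> xy; apply/eqP; rewrite -subr_eq0; apply/eqP/(frechet_sep fV) => m.
  have [n [C [C0 hC]]] := Te m; apply/eqP; rewrite -sqrf_eq0 eq_le sqr_ge0 andbT.
  apply: (le_trans (hC _)); rewrite linearB xy subrr big1 ?mulr0// => i _.
  exact: qf0.
have [g gK] := choice surj.
have Kg : cancel T g by move=> x; apply: inj; rewrite gK.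
exists T, g; split => //.
- move=> x A /(model_gen mY)[n [e [e0 hA]]].
  have [m [C [C0 hC]]] := @common_bound _ _ (fun i z => h i (T z)) (fun m z => P m z ^+ 2) n
    (fun m k z mk => Pmono2 Pmono z mk) (fun m z => sqr_ge0 _) (fun i _ => Tc i).
  have w0 : 0 < C + 1 by rewrite ltr_wpDl.
  have d0 : 0 < Num.min 1 (e ^+ 2 / (C + 1)).
    by rewrite lt_min ltr01 divr_gt0// exprn_gt0.
  apply/(frechet_nbhs fV); exists m, (Num.min 1 (e ^+ 2 / (C + 1))); split => // z zx.
  apply: hA => i ilt /=; rewrite -linearB.
  have zx1 : P m (z - x) <= 1 by apply: (le_trans (ltW zx)); rewrite ge_min lexx.
  have zx2 : P m (z - x) < e ^+ 2 / (C + 1).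
    by apply: (lt_le_trans zx); rewrite ge_min lexx orbT.
  rewrite -(@ltr_pXn2r _ 2)// ?nnegrE ?qnorm_ge0 ?(ltW e0)// qnorm_sqr.
  apply: (le_lt_trans (hC i _ ilt)).
  rewrite ltr_pdivlMr// in zx2; have p0 := seminorm_ge0 (P m) (z - x).
  have : P m (z - x) ^+ 2 <= P m (z - x) by rewrite expr2 ler_piMr.
  move=> /(ler_wpM2l C0); nra.
- move=> y A /(frechet_nbhs fV)[m [e [e0 hA]]].
  have [n [C [C0 hC]]] := Te m.
  pose w := C * n%:R + 1.
  have w0 : 0 < w by rewrite ltr_wpDl// mulr_ge0.
  have d0 : 0 < e ^+ 2 / w by rewrite divr_gt0// exprn_gt0.
  apply/(model_gen mY); exists n, (Num.sqrt (e ^+ 2 / w)).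
  split; first by rewrite sqrtr_gt0.
  move=> z hz; apply: hA.
  have -> : g z - g y = g (z - y).
    by apply: inj; rewrite linearB !gK.
  have : P m (g (z - y)) ^+ 2 < e ^+ 2.
    apply: (le_lt_trans (hC _)); rewrite gK.
    have : \sum_(i < n) h i (z - y) <= n%:R * (e ^+ 2 / w).
      have -> : n%:R * (e ^+ 2 / w) = \sum_(i < n) e ^+ 2 / w.
        exact: natr_mul_sum.
      apply: ler_sum => i _; have /ltW := hz i (ltnW (ltn_ord i)).
      by rewrite /= ler_sqrt// ltW.
    move=> /(ler_wpM2l C0)/le_lt_trans; apply.
    have : e ^+ 2 / w * w = e ^+ 2 by rewrite divfK// gt_eqF.
    by rewrite /w; lra.
  by rewrite ltr_pXn2r// ?nnegrE ?seminorm_ge0// ltW.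
Qed.

(** A linear homeomorphism pulls the factors of the product back to [V]. *)
Lemma product_like_of_homeo : linear_homeo V Y ->
  exists f : {linear V -> Y}, (forall y, exists x, f x = y) /\
    product_like P (fun i => qcomp f (h i)).
Proof.
case=> f [g [cf cg fK gK]]; exists f; split; first by move=> y; exists (g y).
have g0 : g 0 = 0 by rewrite -(linear0 f) fK.
split.
- move=> i; have [|n [C [C0 hC]]] := @frechet_bound (qf_seminorm (qcomp f (h i))).
    have : nbhs (f 0) [set y | qnorm (h i) y < 1].
      apply/(model_gen mY); exists i, 1; split => // y hy.
      by have := hy i (leqnn i); rewrite /= linear0 subr0.
    by move=> /cf.
  exists n, (C ^+ 2); split; first exact: sqr_ge0.
  move=> x; rewrite -qnorm_sqr -exprMn lerXn2r ?nnegrE ?qnorm_ge0 ?hC//.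
  by rewrite mulr_ge0 ?seminorm_ge0.
- move=> m; have : nbhs (g 0) [set x | P m x < 1].
    by have := frechet_ball 0 m ltr01; rewrite g0; apply: filterS => x; rewrite /= subr0.
  move=> /cg/(model_gen mY)[n [e [e0 hn]]].
  exists n.+1, ((2 / e) ^+ 2); split; first exact: sqr_ge0.
  move=> x; have hS : P m x <= 2 / e * qnorm (qsum (fun i => qcomp f (h i)) n.+1) x.
    apply: (seminorm_bound (p := qf_seminorm (qsum (fun i => qcomp f (h i)) n.+1))) => // z /= hz.
    have := hn (f z); rewrite /= fK; apply => i ilt; rewrite subr0.
    apply: le_lt_trans hz; rewrite ler_wsqrtr//.
    by apply: (le_trans (ler_qsum (fun i => qcomp f (h i)) z (i := i) (n := n.+1) _)).
  rewrite -[qsum _ _ x]qnorm_sqr -exprMn lerXn2r ?nnegrE ?seminorm_ge0//.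
  by rewrite mulr_ge0 ?qnorm_ge0// divr_ge0// ltW.
- move=> n x e e0; have [z hz] := model_indep mY n (f \o x).
  by exists (g z) => i ilt; rewrite /= linearB gK hz.
Qed.

End Model.

End OneSpace.

(** * The product spaces *)

Lemma nbhs_initialP (S : choiceType) (T : topologicalType) (f : S -> T)
    (x : initial_topology f) (A : set S) :
  nbhs x A <-> exists2 B, nbhs (f x) B & f @^-1` B `<=` A.
Proof.
split=> [[_ [[B oB <-] Bx BA]]|[B Bx BA]].
  by exists B => //; exact: open_nbhs_nbhs.
by apply: (@filterS _ (nbhs x) _ _ _ BA); exact: (@initial_continuous S T f x _ Bx).
Qed.

Definition normed_by (V : preTopologicalLmodType R) (p : seminorm V) :=
  forall (x : V) (A : set V), nbhs x A <->
    exists2 e : R, 0 < e & forall y, p (y - x) < e -> A y.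

Definition power_coord (V : preTopologicalLmodType R) (i : nat)
  (x : countable_power V) : V := x i.

Lemma power_coord_linear V i : linear (@power_coord V i).
Proof. by []. Qed.

HB.instance Definition _ V i := GRing.isLinear.Build R (countable_power V) V _
  (@power_coord V i) (@power_coord_linear V i).

Lemma power_generate (V : preTopologicalLmodType R) (q : qform V) :
  normed_by (qf_seminorm q) ->
  seminorms_generate (fun i => qf_seminorm (qcomp (@power_coord V i) q)).
Proof.
move=> nV x A.
pose box ne : set (countable_power V) :=
  [set y | forall i, (i <= ne.1)%N -> qnorm q (y i - x i) < ne.2].
pose D := [set ne : nat * R | 0 < ne.2].
have FF : Filter (filter_from D box).
  apply: filter_from_filter; first by exists (0%N, 1); rewrite /D/= ltr01.
  move=> [n e] [m d] /= e0 d0; exists (maxn n m, Num.min e d).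
    by rewrite /D/= lt_min e0.
  move=> y hy; split => i /= ilt.
    have := hy i; rewrite /= leq_max ilt => /(_ isT)/lt_le_trans; apply.
    by rewrite ge_min lexx.
  have := hy i; rewrite /= leq_max ilt orbT => /(_ isT)/lt_le_trans; apply.
  by rewrite ge_min lexx orbT.
split=> [xA|[n [e [e0 hA]]]].
  have /(_ A xA)[[n e] e0 hA] : filter_from D box --> (x : {ptws nat -> V}).
    apply/cvg_sup => i B /nbhs_initialP[C Cx CB].
    have [e e0 hC] := (nV _ _).1 Cx.
    exists (i, e) => // y hy; apply: CB; apply: hC.
    exact: (hy i).
  by exists n, e; split => // y hy; apply: hA.
have near_i (i : 'I_n.+1) : nbhs (x : {ptws nat -> V})
    [set y : {ptws nat -> V} | qnorm q (y i - x i) < e].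
  have /(_ [set v | qnorm q (v - x i) < e]) h := @proj_continuous nat (fun=> V) i x.
  by apply: h; apply/nV; exists e.
have := @filter_forall {ptws nat -> V} _ _ _ (nbhs_filter (x : {ptws nat -> V})) near_i.
apply: filterS => y hy; apply: hA => i ilt.
exact: (hy (Ordinal (ilt : (i < n.+1)%N))).
Qed.

Lemma power_model (V : preTopologicalLmodType R) (q : qform V) :
  normed_by (qf_seminorm q) -> (forall x, q x = 0 -> x = 0) ->
  product_model (fun i => qcomp (@power_coord V i) q).
Proof.
move=> nV q0; split; first exact: power_generate.
- by move=> y hy; apply/funext => i; apply: q0; exact: hy.
- move=> n y; exists (fun i => y i i) => i _ /=.
  by rewrite -[power_coord _ _]/(y i i - y i i) subrr qf0.
Qed.

Lemma normed_normP (W : normedModType R) (x : W) (A : set W) : nbhs x A <->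
  exists2 e : R, 0 < e & forall y, `|y - x| < e -> A y.
Proof.
split=> [/(@nbhs_normP R W x A)[e e0 h]|[e e0 h]].
  by exists e => // y; rewrite distrC => yx; apply: h.
by apply/(@nbhs_normP R W x A); exists e => // y yx; apply: h; rewrite distrC.
Qed.

Lemma normed_ell2 : normed_by (qf_seminorm (qell2 R)).
Proof.
move=> x A; rewrite (normed_normP (W := ell2 R) x A).
by split=> -[e e0 h]; exists e => // y hy; apply: h; rewrite /= qnorm_ell2 in hy *.
Qed.

Definition qline : qform (R^o).
Proof.
exists (fun x : R^o => (x : R) ^+ 2) => [x|a x|x y]; first exact: sqr_ge0.
- exact: exprMn.
- have E (a b : R) : (a + b) ^+ 2 + (a - b) ^+ 2 = 2 * (a ^+ 2 + b ^+ 2) by ring.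
  exact: E.
Defined.

Lemma qnorm_line (x : R) : qnorm qline x = `|x|.
Proof. exact: sqrtr_sqr. Qed.

Lemma normed_line : normed_by (V := R^o) (qf_seminorm qline).
Proof.
move=> x A; rewrite (normed_normP (W := R^o) x A).
by split=> -[e e0 h]; exists e => // y hy; apply: h; rewrite /= qnorm_line in hy *.
Qed.

Lemma ell2_seq_model :
  product_model (fun i => qcomp (@power_coord (ell2 R) i) (qell2 R)).
Proof.
apply: power_model; first exact: normed_ell2.
by move=> x /eqP; rewrite /= sqrf_eq0 normr_eq0 => /eqP.
Qed.

Lemma real_seq_model :
  product_model (fun i => qcomp (@power_coord R^o i) qline).
Proof.
apply: power_model; first exact: normed_line.
by move=> x /eqP; rewrite /= sqrf_eq0 => /eqP.
Qed.

Section DirectSum.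
Variables (V W : preTopologicalLmodType R).

Definition sum_fst (x : direct_sum V W) : V := x.1.
Definition sum_snd (x : direct_sum V W) : W := x.2.

Lemma sum_fst_linear : linear sum_fst. Proof. by []. Qed.
Lemma sum_snd_linear : linear sum_snd. Proof. by []. Qed.

HB.instance Definition _ := GRing.isLinear.Build R (direct_sum V W) V _
  sum_fst sum_fst_linear.
HB.instance Definition _ := GRing.isLinear.Build R (direct_sum V W) W _
  sum_snd sum_snd_linear.

Definition sum_forms (q : qform V) (h : nat -> qform W) i :=
  if i is j.+1 then qcomp sum_snd (h j) else qcomp sum_fst q.

Lemma sum_model (q : qform V) (h : nat -> qform W) :
  normed_by (qf_seminorm q) -> (forall x, q x = 0 -> x = 0) ->
  product_model h -> product_model (sum_forms q h).
Proof.
move=> nV q0 mW; split.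
- move=> [v w] A; split.
    case=> -[B C] /= [Bv Cw] BC.
    have [e e0 hB] := (nV _ _).1 Bv; have [n [d [d0 hC]]] := (model_gen mW _ _).1 Cw.
    exists n.+1, (Num.min e d); split; first by rewrite lt_min e0.
    move=> [v' w'] hy; apply: BC; split => /=.
      by apply: hB; have := hy 0%N isT; rewrite lt_min => /andP[].
    apply: hC => i ilt; have := hy i.+1; rewrite ltnS => /(_ ilt).
    by rewrite lt_min => /andP[].
  case=> n [e [e0 hA]].
  exists ([set v' | qnorm q (v' - v) < e],
          [set w' | forall i, (i <= n)%N -> qnorm (h i) (w' - w) < e]) => /=.
    split; first by apply/nV; exists e.
    by apply/(model_gen mW); exists n, e.
  move=> [v' w'] /= [hv hw]; apply: hA => -[_|i ilt]; first exact: hv.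
  exact: (hw i (ltnW ilt)).
- move=> [v w] hy; congr pair; first by apply: q0; exact: (hy 0%N).
  by apply: (model_sep mW) => i; exact: (hy i.+1).
- move=> n y; have [z hz] := model_indep mW n (fun i => (y i.+1).2).
  exists ((y 0%N).1, z) => -[_|i ilt].
    by have := qf0 q; rewrite -{1}(subrr (y 0%N).1).
  exact: (hz i (ltnW ilt)).
Qed.

End DirectSum.

Lemma ell2_plus_real_seq_model : product_model
  (sum_forms (V := ell2 R) (W := real_seq R) (qell2 R)
    (fun i => qcomp (@power_coord R^o i) qline)).
Proof.
apply: sum_model; [exact: normed_ell2| |exact: real_seq_model].
by move=> x /eqP; rewrite /= sqrf_eq0 normr_eq0 => /eqP.
Qed.

End Frechet.

(** * Classification of product decompositions *)

Section Enumeration.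

(** The basis vectors of infinitely many finite-dimensional factors form one
    sequence. *)
Lemma enumerate_pairs (N : nat -> nat) :
  (forall i, exists2 l, (i <= l)%N & (0 < N l)%N) ->
  exists e : nat -> nat * nat, [/\ forall k, ((e k).2 < N (e k).1)%N,
    injective e & forall i j, (j < N i)%N -> exists k, e k = (i, j)].
Proof.
move=> H; pose A := [set ij : nat * nat | (ij.2 < N ij.1)%N].
have [|l hl] := @choice _ _ (fun i k => (i <= k)%N /\ (0 < N k)%N).
  by move=> i; have [k k1 k2] := H i; exists k.
pose s := fix s k := if k is m.+1 then l (s m).+1 else l 0%N.
have sinj : injective s.
  have smono : {homo s : i j / (i < j)%N >-> (i < j)%N}.
    by apply: homo_ltn => [? ? ?|k]; [exact: ltn_trans|case: (hl (s k).+1)].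
  move=> i j; case: (ltngtP i j) => // /smono; first by move=> + ij; rewrite ij ltnn.
  by move=> + ij; rewrite ij ltnn.
have sN k : (0 < N (s k))%N by case: k => [|k]; [case: (hl 0%N)|case: (hl (s k).+1)].
have le1 : ([set: nat] #<= A)%card.
  apply: (@card_le_trans _ _ _ ((fun k => (s k, 0%N)) @` setT)).
    have : ((fun k => (s k, 0%N)) @` setT #= [set: nat])%card.
      by apply: inj_card_eq => i j _ _ [] /sinj.
    by rewrite card_eq_le => /andP[].
  by apply: subset_card_le => _ [k _ <-] /=; exact: sN.
have le2 : (A #<= [set: nat])%card by exact: countableP.
have /card_set_bijP[e [e1 e2 e3]] : ([set: nat] #= A)%card by rewrite card_eq_le le1 le2.
exists e; split.
- by move=> k; exact: e1.
- by move=> i j; apply: e2; rewrite inE.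
- by move=> i j ij; have [k _ <-] := e3 (i, j) ij; exists k.
Qed.

End Enumeration.

Section RankTransport.
Context (R : realType).

Lemma polar_comp (V W : lmodType R) (f : {linear V -> W}) (q : qform W) x y :
  polar (qcomp f q) x y = polar q (f x) (f y).
Proof. by rewrite /polar /= linearD linearB. Qed.

Lemma infinite_rank_comp (V W : lmodType R) (f : {linear V -> W}) (q : qform W) :
  (forall y, exists x, f x = y) -> infinite_rank q -> infinite_rank (qcomp f q).
Proof.
move=> sf iq N; have [b ob] := iq N; have [c hc] := choice (fun i => sf (b i)).
by exists c => i j iN jN; rewrite polar_comp !hc ob.
Qed.

Lemma infinite_rank_le (V : lmodType R) (p q : qform V) :
  (forall x, p x <= q x) -> infinite_rank p -> infinite_rank q.
Proof.
move=> pq ip; apply: contrapT => /finite_rankP[N [f [ff fq]]].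
apply: (infinite_not_finite ip); exists N, f; split => // u /fq qu.
by apply/le_anti; rewrite qf_ge0 andbT -qu.
Qed.

Definition ell2_basis_fun j : nat -> R := fun k => (k == j)%:R.

Lemma ell2_basis_mem j : ell2_basis_fun j \in @square_summable R.
Proof.
apply: (@square_summableP _ _ 1) => n.
apply: (@le_trans _ _ (l1 n (delta R j))); last exact: l1_delta_le.
apply: ler_sum => i _; rewrite /ell2_basis_fun /delta.
by case: eqP => _; rewrite ?expr1n ?normr1// expr0n normr0.
Qed.

Definition ell2_basis j : ell2 R := mk_ell2 (ell2_basis_mem j).

Lemma polar_ell2 (u v : ell2 R) : polar (qell2 R) u v = ell2_dot u v.
Proof.
have E w : `|w| ^+ 2 = ell2_dot w w.
  by rewrite -[`|w|]/(ell2_norm w) sqr_sqrtr// ell2_dot_ge0.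
have NE w z : ell2_dot (- w) z = - ell2_dot w z.
  by rewrite -scaleN1r ell2_dotZl mulN1r.
have NE' w z : ell2_dot w (- z) = - ell2_dot w z by rewrite ell2_dotC NE ell2_dotC.
have DE w z z' : ell2_dot w (z + z') = ell2_dot w z + ell2_dot w z'.
  by rewrite ell2_dotC ell2_dotDl !(ell2_dotC _ w).
rewrite /polar /= !E !ell2_dotDl !DE !NE' !NE (ell2_dotC v u); lra.
Qed.

Lemma polar_ell2_basis (u : ell2 R) j : polar (qell2 R) u (ell2_basis j) = val u j.
Proof.
rewrite polar_ell2 /ell2_dot; apply: lim_near_cst => //.
near=> n.
have jn : (j < n)%N by near: n; exists j.+1.
rewrite /series /= big_mkord (bigD1 (Ordinal jn))//= big1 ?addr0.
  by rewrite -[LHS]/(val u j * (j == j)%:R) eqxx mulr1.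
move=> i; rewrite -val_eqE /= => /negPf ij.
by rewrite -[LHS]/(val u i * (val i == j)%:R) ij mulr0.
Unshelve. all: by end_near. Qed.

Lemma infinite_rank_ell2 : infinite_rank (qell2 R).
Proof.
by move=> N; exists ell2_basis => i j _ _; rewrite polar_ell2_basis /= eq_sym.
Qed.

End RankTransport.

Section Classification.
Context (R : realType) (V : preTopologicalLmodType R) (P : nat -> seminorm V).
Hypothesis fV : frechet P.

Let Pmono := frechet_mono fV.

Lemma qcont_dense q : qcont P q -> exists d : nat -> V, forall x e, 0 < e ->
  exists k, q (x - d k) < e.
Proof.
move=> [n [C [C0 hC]]]; have [d hd] := frechet_dense fV; exists d => x e e0.
have w0 : 0 < C + 1 by rewrite ltr_wpDl.
have d0 : 0 < Num.min 1 (e / (C + 1)) by rewrite lt_min ltr01 divr_gt0.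
have [k hk] := hd x n _ d0; exists k; apply: (le_lt_trans (hC _)).
have p0 := seminorm_ge0 (P n) (x - d k).
have h1 : P n (x - d k) <= 1 by apply: (le_trans (ltW hk)); rewrite ge_min lexx.
have h2 : P n (x - d k) < e / (C + 1) by apply: (lt_le_trans hk); rewrite ge_min lexx orbT.
rewrite ltr_pdivlMr// in h2.
have : P n (x - d k) ^+ 2 <= P n (x - d k) by rewrite expr2 ler_piMr.
move=> /(ler_wpM2l C0); nra.
Qed.

(** Consecutive factors are merged, so that each block can be made
    infinite-dimensional, or the infinite-dimensional factors all be put into the
    first one. *)
Definition block (g : nat -> qform V) (f : nat -> nat) k :=
  qsum (fun i => g (f k + i)%N) (f k.+1 - f k).

Lemma product_like_blocks g f : product_like P g -> f 0%N = 0%N ->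
  (forall k, (f k <= f k.+1)%N) -> (forall i, exists k, (i < f k)%N) ->
  product_like P (block g f).
Proof.
move=> [gc gg gi] f0 fm fu.
have sumE n x : qsum (block g f) n x = qsum g (f n) x.
  elim: n => [|n IH]; first by rewrite f0.
  by rewrite [LHS]/= IH /block !qsumE -[in RHS](subnKC (fm n)) big_split_ord.
have fmono : {homo f : i j / (i <= j)%N >-> (i <= j)%N}.
  by apply: homo_leq => //; exact: leq_trans.
split.
- by move=> k; apply: qcont_qsum.
- move=> m; have [n [C [C0 hC]]] := gg m; have [k nk] := fu n.
  exists k, C; split => // x; apply: (le_trans (hC x)); rewrite ler_wpM2l// sumE.
  by rewrite qsum_mono// ltnW.
- move=> n x e e0.
  pose blk i := ex_minn (fu i).
  have blkE k i : (f k <= i)%N -> (i < f k.+1)%N -> blk i = k.+1.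
    move=> ki ik; rewrite /blk; case: ex_minnP => l il lmin.
    apply/eqP; rewrite eqn_leq lmin// ltnNge; apply/negP => /fmono lk.
    by have := leq_trans il (leq_trans lk ki); rewrite ltnn.
  have e1 : 0 < e / (f n).+1%:R by rewrite divr_gt0 ?ltr0n.
  have [y hy] := gi (f n) (fun i => x (blk i).-1) _ e1.
  exists y => k kn; rewrite qsumE.
  have fkn : (f k.+1 <= f n)%N by exact: fmono.
  apply: (@le_lt_trans _ _ (\sum_(i < f k.+1 - f k) e / (f n).+1%:R)).
    apply: ler_sum => i _.
    have ik : (f k + i < f k.+1)%N by rewrite -ltn_subRL.
    have := hy (f k + i)%N (leq_trans ik fkn).
    by rewrite (blkE k _ (leq_addr _ _) ik) => /ltW.
  rewrite sumr_const card_ord -[_ *+ _ in ltLHS]mulr_natl mulrA ltr_pdivrMr ?ltr0n// mulrC.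
  by rewrite ltr_pM2l// ltr_nat ltnS (leq_trans _ fkn)// leq_subr.
Qed.

(** A zero factor in front reduces products of lines to the case of a Hilbert
    space followed by lines. *)
Lemma product_like_cons0 g : product_like P g ->
  product_like P (fun i => if i is j.+1 then g j else qzero V).
Proof.
move=> [gc gg gi]; split.
- case=> [|i]; last exact: gc.
  by exists 0%N, 0; split => // x; rewrite mul0r.
- move=> m; have [n [C [C0 hC]]] := gg m; exists n.+1, C; split => // x.
  by apply: (le_trans (hC x)); rewrite ler_wpM2l// !qsumE big_ord_recl /= add0r.
- move=> n x e e0; have [y hy] := gi n (fun i => x i.+1) _ e0.
  by exists y => -[|i] ilt //=; apply: hy; exact: ltnW.
Qed.

Section Tail.
Variable g : nat -> qform V.
Hypotheses (pg : product_like P g) (fg : forall i, finite_rank (g i.+1)).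
Hypothesis ng : forall i, exists2 l, (i <= l)%N & exists x, g l.+1 x != 0.

(** The coordinates of all the finite-dimensional factors, in one sequence. *)
Lemma tail_functionals : exists psi : nat -> V -> R,
  [/\ forall k, functional (psi k),
      forall k, exists i, forall x, psi k x ^+ 2 <= g i.+1 x,
      forall i, exists n (C : R), 0 <= C /\
        forall x, g i.+1 x <= C * \sum_(k < n) psi k x ^+ 2 &
      forall x0 c n (e : R), 0 < e -> exists x, g 0%N (x - x0) < e /\
        forall k, (k < n)%N -> `|psi k x - c k| < e].
Proof.
have [_ _ gi] := pg.
have [Nb hNb] := choice (fun i => finite_rank_basis (fg i)).
have ob i : orthonormal (g i.+1) (Nb i).1 (Nb i).2 by case: (hNb i).
have gE i u : g i.+1 u = \sum_(j < (Nb i).1) polar (g i.+1) u ((Nb i).2 j) ^+ 2.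
  by case: (hNb i).
have [|e [e1 e2 e3]] := @enumerate_pairs (fun i => (Nb i).1).
  move=> i; have [l il [x gx]] := ng i; exists l => //.
  rewrite lt0n; apply: contra gx => /eqP N0; rewrite gE N0 big_ord0//.
pose psi k x := polar (g (e k).1.+1) x ((Nb (e k).1).2 (e k).2).
have unit_b k : g (e k).1.+1 ((Nb (e k).1).2 (e k).2) = 1.
  by rewrite -polarxx ob// eqxx.
exists psi; split.
- by move=> k; exact: functional_polar.
- move=> k; exists (e k).1 => x.
  by have := polar_CS (g (e k).1.+1) x ((Nb (e k).1).2 (e k).2); rewrite unit_b mulr1.
- move=> i.
  have [n hn] : exists n, forall j, (j < (Nb i).1)%N -> exists2 k, (k < n)%N & e k = (i, j).
    suff : forall N, (N <= (Nb i).1)%N -> exists n, forall j, (j < N)%N ->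
      exists2 k, (k < n)%N & e k = (i, j) by exact.
    elim=> [|N IH] NN; first by exists 0%N.
    have [n hn] := IH (ltnW NN); have [k ek] := e3 i N NN.
    exists (maxn n k.+1) => j; rewrite ltnS leq_eqVlt => /predU1P[->|jN].
      by exists k => //; rewrite leq_max ltnSn orbT.
    by have [l ln el] := hn j jN; exists l => //; rewrite leq_max ln.
  exists n, (Nb i).1%:R; split => // x.
  rewrite gE mulr_natl -[X in _ *+ X]card_ord -sumr_const.
  apply: ler_sum => j _; have [k kn ek] := hn j (ltn_ord j).
  rewrite (bigD1 (Ordinal kn))//= {1}/psi ek/= lerDl.
  by apply: sumr_ge0 => l _; exact: sqr_ge0.
- move=> x0 c n d d0.
  have [kap hk] : exists kap : nat -> nat -> nat, forall k, kap (e k).1 (e k).2 = k.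
    have [|kap hkap] := @choice _ _ (fun ij m => forall k, e k = ij -> m = k).
      move=> ij; have [[k ek]|nk] := pselect (exists k, e k = ij).
        by exists k => l el; apply: e2; rewrite ek el.
      by exists 0%N => k ek; case: nk; exists k.
    by exists (fun i j => kap (i, j)) => k; apply: hkap; case: (e k).
  pose xi i := comb (Nb i).1 (fun j => c (kap i j)) (Nb i).2.
  pose I := (\max_(k < n) (e k).1).+2.
  have m0 : 0 < Num.min d (d ^+ 2) by rewrite lt_min d0 exprn_gt0.
  have [y hy] := gi I (fun i => if i is i'.+1 then xi i' else x0) _ m0.
  exists y; split.
    by apply: (lt_le_trans (hy 0%N isT)); rewrite ge_min lexx.
  move=> k kn.
  have kI : ((e k).1.+1 < I)%N.
    by rewrite /I !ltnS (leq_bigmax (Ordinal kn)).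
  have -> : c k = psi k (xi (e k).1).
    by rewrite /psi /xi polar_comb_orthonormal ?hk.
  rewrite /psi -polarBl.
  rewrite -(@ltr_pXn2r _ 2)// ?nnegrE ?(ltW d0)// real_normK ?num_real//.
  apply: (le_lt_trans (polar_CS _ _ _)); rewrite unit_b mulr1.
  by apply: (lt_le_trans (hy _ kI)); rewrite ge_min lexx orbT.
Qed.

Lemma tail_generates (psi : nat -> V -> R) :
  (forall i, exists n (C : R), 0 <= C /\
     forall x, g i.+1 x <= C * \sum_(k < n) psi k x ^+ 2) ->
  forall m, exists n (C : R), 0 <= C /\
    forall x, P m x ^+ 2 <= C * (g 0%N x + \sum_(k < n) psi k x ^+ 2).
Proof.
move=> H m; have [_ /(_ m)[L [D [D0 hD]]] _] := pg.
have [n [C [C0 hC]]] : exists n (C : R), 0 <= C /\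
    forall x, qsum g L x <= C * (g 0%N x + \sum_(k < n) psi k x ^+ 2).
  elim: L {hD} => [|L [n [C [C0 IH]]]].
    by exists 0%N, 0; split => // x; rewrite mul0r.
  have s0 k x : 0 <= \sum_(k < k) psi k x ^+ 2 by apply: sumr_ge0 => *; exact: sqr_ge0.
  case: L IH => [|L] IH.
    exists 0%N, 1; split => // x; rewrite big_ord0 addr0 mul1r.
    by rewrite qsumE big_ord1.
  have [n' [C' [C'0 hC']]] := H L; exists (maxn n n'), (C + C').
  split; first exact: addr_ge0.
  move=> x.
  rewrite [qsum _ _]/= mulrDl; apply: lerD.
    by apply: (le_trans (IH x)); rewrite ler_wpM2l// lerD2l (sum_sqr_mono (fun k => psi k x))// leq_maxl.
  apply: (le_trans (hC' x)); rewrite ler_wpM2l//.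
  by apply: ler_wpDl; [exact: qf_ge0|rewrite (sum_sqr_mono (fun k => psi k x))// leq_maxr].
exists n, (D * C); split; first exact: mulr_ge0.
by move=> x; apply: (le_trans (hD x)); rewrite -mulrA ler_wpM2l.
Qed.

End Tail.

Lemma homeo_ell2_seq g : product_like P g -> (forall i, infinite_rank (g i)) ->
  linear_homeo V (ell2_seq R).
Proof.
move=> pg ig; have [gc gg gi] := pg.
have ex i : exists T : {linear V -> ell2 R}, (forall x, `|T x| ^+ 2 = g i x) /\
    forall u e, 0 < e -> exists x, `|T x - u| < e.
  have [d hd] := qcont_dense (gc i).
  have [b [ob pb]] := orthonormal_basis (ig i) hd.
  by have [T [T1 _ T2]] := isometry_of_basis ob pb; exists T.
have [S hS] := choice ex.
pose T x : ell2_seq R := fun i => S i x.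
have Tlin : linear T by move=> c x y; apply/funext => i; rewrite /T linearP.
pose L : {linear V -> ell2_seq R} := bundle_linear Tlin.
have hL i x : qcomp (@power_coord R (ell2 R) i) (qell2 R) (L x) = g i x.
  by have [<- _] := hS i.
apply: (linear_homeo_of_dense fV (ell2_seq_model R) (T := L)).
- move=> i; have [n [C [C0 hC]]] := gc i; exists n, C; split => // x.
  by rewrite hL.
- move=> m; have [n [C [C0 hC]]] := gg m; exists n, C; split => // x.
  by apply: (le_trans (hC x)); rewrite ler_wpM2l// qsumE; apply: ler_sum => i _; rewrite hL.
- move=> y n e e0.
  pose d := Num.min 1 (e / 4); have d0 : 0 < d by rewrite lt_min ltr01 divr_gt0.
  have d1 : d <= 1 by rewrite ge_min lexx.
  have d4 : d <= e / 4 by rewrite ge_min lexx orbT.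
  have [x hx] := choice (fun i => (hS i).2 (y i) d d0).
  have [z hz] := gi n x _ d0; exists z => i ilt.
  rewrite -[L z - y](subrKA (L (x i))) -linearB.
  apply: (le_lt_trans (qfD_le _ _ _)); rewrite hL.
  have h2 : qcomp (@power_coord R (ell2 R) i) (qell2 R) (L (x i) - y) <= d.
    rewrite -[X in X <= _]/(`|S i (x i) - y i| ^+ 2).
    have := hx i; have := normr_ge0 (S i (x i) - y i).
    move: (`|_|) => t t0 td; rewrite expr2; nra.
  move: h2 d4 (hz i ilt); move: (g i _) (qcomp _ _ _) => t1 t2.
  by clear; lra.
Qed.

Lemma homeo_ell2_plus g : product_like P g -> infinite_rank (g 0%N) ->
  (forall i, finite_rank (g i.+1)) ->
  (forall i, exists2 l, (i <= l)%N & exists x, g l.+1 x != 0) ->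
  linear_homeo V (ell2_plus_real_seq R).
Proof.
move=> pg ig fg ng; have [gc gg gi] := pg.
have [d hd] := qcont_dense (gc 0%N).
have [b [ob pb]] := orthonormal_basis ig hd.
have [S [S1 _ S2]] := isometry_of_basis ob pb.
have [psi [psil psig psit psid]] := tail_functionals pg fg ng.
pose T x : ell2_plus_real_seq R := (S x, fun k => psi k x).
have Tlin : linear T.
  move=> c x y; rewrite /T linearP.
  congr pair; apply/funext => k; exact: psil.
pose L : {linear V -> ell2_plus_real_seq R} := bundle_linear Tlin.
apply: (linear_homeo_of_dense fV (ell2_plus_real_seq_model R) (T := L)).
- case=> [|k].
    have [n [C [C0 hC]]] := gc 0%N; exists n, C; split => // x.
    by rewrite -[X in X <= _]/(`|S x| ^+ 2) S1.
  have [i hi] := psig k; have [n [C [C0 hC]]] := gc i.+1.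
  by exists n, C; split => // x; apply: (le_trans (hi x)).
- move=> m; have [n [C [C0 hC]]] := tail_generates pg psit m.
  exists n.+1, C; split => // x; apply: (le_trans (hC x)); rewrite ler_wpM2l//.
  by rewrite big_ord_recl -S1.
- move=> [u c] n e e0.
  pose d0 := Num.min 1 (e / 4); have d00 : 0 < d0 by rewrite lt_min ltr01 divr_gt0.
  have d1 : d0 <= 1 by rewrite ge_min lexx.
  have d4 : d0 <= e / 4 by rewrite ge_min lexx orbT.
  have [x0 hx0] := S2 u d0 d00.
  have [x [x1 x2]] := psid x0 c n d0 d00.
  have sq (t : R) : 0 <= t -> t < d0 -> t ^+ 2 < e / 2 by move=> t0 td; rewrite expr2; nra.
  exists x => -[_|k kn].
    rewrite -[X in X < _]/(`|S x - u| ^+ 2) -[S x - u](subrKA (S x0)).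
    have e1 : `|S x - S x0| ^+ 2 = g 0%N (x - x0) by rewrite -S1 linearB.
    apply: (le_lt_trans (qfD_le (qell2 R) (S x - S x0) (S x0 - u))).
    rewrite [X in 2 * (X + _)]e1.
    have : `|S x0 - u| ^+ 2 <= d0.
      have := hx0; have := normr_ge0 (S x0 - u).
      by move: (`|_|) => t t0 td; rewrite expr2; nra.
    rewrite -[qell2 R (S x0 - u)]/(`|S x0 - u| ^+ 2).
    move: x1 d4; move: (g 0%N _) (_ ^+ 2) => t1 t2.
    by clear; lra.
  rewrite -[X in X < _]/((psi k x - c k) ^+ 2) -real_normK ?num_real//.
  by apply: (lt_trans (sq _ _ (x2 k (ltnW kn)))) => //; lra.
Qed.

Lemma homeo_real_seq g : product_like P g -> (forall i, finite_rank (g i)) ->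
  (forall i, exists2 l, (i <= l)%N & exists x, g l x != 0) ->
  linear_homeo V (real_seq R).
Proof.
move=> pg0 fg ng; have pg := product_like_cons0 pg0; have [gc gg gi] := pg.
have [psi [psil psig psit psid]] := tail_functionals pg fg ng.
pose T x : real_seq R := fun k => psi k x.
have Tlin : linear T by move=> c x y; apply/funext => k; exact: psil.
pose L : {linear V -> real_seq R} := bundle_linear Tlin.
apply: (linear_homeo_of_dense fV (real_seq_model R) (T := L)).
- move=> k; have [i hi] := psig k; have [n [C [C0 hC]]] := gc i.+1.
  by exists n, C; split => // x; apply: (le_trans (hi x)).
- move=> m; have [n [C [C0 hC]]] := tail_generates pg psit m.
  by exists n, C; split => // x; apply: (le_trans (hC x)); rewrite ler_wpM2l//= add0r.
- move=> c n e e0.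
  pose d0 := Num.min 1 (e / 4); have d00 : 0 < d0 by rewrite lt_min ltr01 divr_gt0.
  have d1 : d0 <= 1 by rewrite ge_min lexx.
  have d4 : d0 <= e / 4 by rewrite ge_min lexx orbT.
  have [x [x1 x2]] := psid 0 c n d0 d00.
  exists x => k kn.
  rewrite -[X in X < _]/((psi k x - c k) ^+ 2) -real_normK ?num_real//.
  have := x2 k kn; have := normr_ge0 (psi k x - c k).
  by move: (`|_|) => t t0 td; rewrite expr2; nra.
Qed.

Lemma not_infinitely Q : ~ (forall i, exists2 l, (i <= l)%N & Q l) ->
  exists i, forall l, (i <= l)%N -> ~ Q l.
Proof.
move=> /existsNP[i h]; exists i => l il Ql; apply: h; by exists l.
Qed.

(** When infinitely many factors are infinite-dimensional, blocks that end with
    one of them are all copies of l2. *)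
Theorem ell2_seqP : linear_homeo V (ell2_seq R) <->
  [/\ hilbertizable P, quojective P & infinite_steps P].
Proof.
split.
  move=> /(product_like_of_homeo fV (ell2_seq_model R))[f [sf pg]].
  split; [exact: product_like_hilbertizable pg|exact: product_like_quojective pg|].
  apply: (infinite_infinite_steps pg) => i; exists i => //.
  apply: infinite_rank_comp => //; apply: infinite_rank_comp; last exact: infinite_rank_ell2.
  by move=> y; exists (fun=> y).
case=> hP qP sP; have [g pg] := product_like_exists Pmono hP qP.
have inf : forall i, exists2 l, (i <= l)%N & infinite_rank (g l).
  apply: contrapT => /not_infinitely[i hi].
  by apply: (eventually_finite_not_infinite_steps Pmono pg (i0 := i)) sP => l /hi/finite_rankP.
have [|l hl] := @choice _ _ (fun i k => (i <= k)%N /\ infinite_rank (g k)).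
  by move=> i; have [k k1 k2] := inf i; exists k.
pose f := fix f k := if k is m.+1 then (l (f m)).+1 else 0%N.
have fl k : (f k <= l (f k))%N by case: (hl (f k)).
apply: (@homeo_ell2_seq (block g f)).
  apply: product_like_blocks => //; first by move=> k; exact: leqW.
  move=> i; exists i.+1; elim: i => [//|i IH].
  by apply: (leq_ltn_trans IH); exact: (fl i.+1).
move=> k; have [_ ik] := hl (f k).
apply: (@infinite_rank_le _ _ (g (l (f k)))) => // x.
rewrite /block; have lk : (l (f k) - f k < f k.+1 - f k)%N by rewrite /= subSn.
have := ler_qsum (fun i => g (f k + i)%N) x lk.
by rewrite subnKC.
Qed.

(** Finitely many infinite-dimensional factors, at least one, merge into one copy
    of l2; the remaining factors are finite-dimensional, and infinitely many of
    them are nonzero because the space is not normable. *)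
Theorem ell2_plusP : linear_homeo V (ell2_plus_real_seq R) <->
  [/\ hilbertizable P, quojective P, non_schwartz P, ~ infinite_steps P & ~ normable P].
Proof.
split.
  move=> /(product_like_of_homeo fV (ell2_plus_real_seq_model R))[f [sf pg]].
  split; [exact: product_like_hilbertizable pg|exact: product_like_quojective pg| | |].
  - apply: (infinite_non_schwartz pg (i := 0%N)).
    apply: infinite_rank_comp => //; apply: infinite_rank_comp; last exact: infinite_rank_ell2.
    by move=> y; exists (y, 0).
  - apply: (eventually_finite_not_infinite_steps Pmono pg (i0 := 1%N)) => -[//|i] _.
    exists 1%N, (fun _ x => (f x).2 i : R); split => [_ c u v|u /(_ 0%N isT) h].
      by rewrite linearP.
    by rewrite -[LHS]/(((f u).2 i : R) ^+ 2) h expr0n.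
  - apply: (nonzero_not_normable pg) => i; exists i.+1 => //.
    have [x hx] := sf (0, fun=> 1); exists x.
    rewrite -[X in X != _]/(((f x).2 i : R) ^+ 2) hx /=.
    by rewrite expr1n oner_eq0.
case=> hP qP nP sP mP; have [g pg] := product_like_exists Pmono hP qP.
have fin : exists i, forall l, (i <= l)%N -> ~ infinite_rank (g l).
  apply: not_infinitely => inf; apply: sP.
  exact: (infinite_infinite_steps pg).
have [i0 hi0] := fin.
pose f k := if k is m.+1 then (i0 + m)%N else 0%N.
have bE k x : block g f k.+1 x = g (i0 + k)%N x.
  by rewrite /block /f addnS subSn// subnn qsumE big_ord1 addn0.
have pb : product_like P (block g f).
  apply: product_like_blocks => //; first by case=> [|k] //=; rewrite addnS.
  by move=> i; exists i.+2; rewrite /f addnS ltnS leq_addl.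
have fb i : finite_rank (block g f i.+1).
  have [N [h [h1 h2]]] := finite_rankP (hi0 (i0 + i)%N (leq_addr _ _)).
  by exists N, h; split => // u /h2; rewrite bE.
apply: (homeo_ell2_plus pb) => //.
  apply: contrapT => /finite_rankP fb0.
  by apply: (finite_not_non_schwartz pb) nP => -[|i].
apply: contrapT => /not_infinitely[i hi]; apply: mP.
apply: (finitely_nonzero_normable Pmono pb (i0 := i.+1)) => -[//|l] x il.
apply/eqP; apply: contrapT => /negP nx.
by apply: (hi l il); exists x.
Qed.

(** No factor is infinite-dimensional, and infinitely many are nonzero. *)
Theorem real_seqP : linear_homeo V (real_seq R) <->
  [/\ hilbertizable P, quojective P, ~ non_schwartz P & ~ normable P].
Proof.
split.
  move=> /(product_like_of_homeo fV (real_seq_model R))[f [sf pg]].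
  split; [exact: product_like_hilbertizable pg|exact: product_like_quojective pg| |].
  - apply: (finite_not_non_schwartz pg) => i.
    exists 1%N, (fun _ x => f x i : R); split => [_ c u v|u /(_ 0%N isT) h].
      by rewrite linearP.
    by rewrite -[LHS]/((f u i : R) ^+ 2) h expr0n.
  - apply: (nonzero_not_normable pg) => i; exists i => //.
    have [x hx] := sf (fun=> 1); exists x.
    rewrite -[X in X != _]/((f x i : R) ^+ 2) hx /=.
    by rewrite expr1n oner_eq0.
case=> hP qP nP mP; have [g pg] := product_like_exists Pmono hP qP.
apply: (homeo_real_seq pg).
  move=> i; apply: finite_rankP => ii; apply: nP.
  exact: (infinite_non_schwartz pg ii).
apply: contrapT => /not_infinitely[i hi]; apply: mP.
apply: (finitely_nonzero_normable Pmono pg (i0 := i)) => l x il.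
apply/eqP; apply: contrapT => /negP nx.
by apply: (hi l il); exists x.
Qed.

End Classification.

(** * Hilbert spaces and quadratic forms *)

Section HilbertSpaces.
Context (R : realType).

Lemma hilbert_space_qform (H : completeNormedModType R) (q : qform H) :
  (forall x, `|x| ^+ 2 = q x) -> hilbert_space H.
Proof.
move=> qE.
have bil : bilinear_for (GRing.Scale.Law.clone _ _ *%R _)
    (GRing.Scale.Law.clone _ _ (idfun \; *%R) _) (polar q).
  by split=> u c x y; rewrite ?polarDl ?polarZl ?polarDr ?polarZr.
have herm x y : polar q x y = (-1) ^+ false * idfun (polar q y x).
  by rewrite mul1r polarC.
have pos x : x != 0 -> 0 < polar q x x.
  by move=> x0; rewrite polarxx -qE exprn_gt0 ?normr_gt0.
pose b1 := bilinear_isBilinear.Build R H H R _ _ (polar q) bil.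
pose b2 := isHermitianSesquilinear.Build R H false idfun (polar q) herm.
pose b3 := isDotProduct.Build R H (polar q) pos.
pose D : {dot H for @idfun R} := HB.pack (polar q) b1 b2 b3.
by exists D => x; rewrite qE -polarxx.
Qed.

Lemma hilbert_spaceP (H : completeNormedModType R) : hilbert_space H ->
  exists q : qform H, forall x, `|x| ^+ 2 = q x.
Proof.
case=> ip ipE.
have par (x y : H) : `|x + y| ^+ 2 + `|x - y| ^+ 2 = 2 * (`|x| ^+ 2 + `|y| ^+ 2).
  by rewrite !ipE !linearDl !linearDr /= !linearNl !linearNr /=; lra.
have hZ (a : R) (x : H) : `|a *: x| ^+ 2 = a ^+ 2 * `|x| ^+ 2.
  by rewrite normrZ exprMn real_normK ?num_real.
by exists (QForm (fun x => sqr_ge0 `|x|) hZ par).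
Qed.

(** * Completeness of l2 *)

(** The coordinatewise limit of a Cauchy filter is a limit in norm because partial
    sums of squares are continuous in the coordinates. *)
Lemma ell2_complete (F : set_system (ell2 R)) : ProperFilter F -> cauchy F -> cvg F.
Proof.
move=> FF /cauchyP Fc.
have ex n : exists c, F (ball c (n.+1%:R^-1 : R)).
  by apply: Fc; rewrite invr_gt0 ltr0n.
have [c hc] := choice ex.
have cc n m : `|c n - c m| < n.+1%:R^-1 + m.+1%:R^-1.
  have [u [un um]] := filter_ex (filterI (hc n) (hc m)).
  rewrite -ball_normE /= in un; rewrite -ball_normE /= in um.
  rewrite -[c n - c m](subrKA u); apply: (le_lt_trans (ler_normD _ _)).
  by apply: ltrD => //; rewrite distrC.
have cvx i : cvgn (fun n => val (c n) i : R).
  apply: cauchy_cvg; apply/cauchyP => e e0.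
  have e2 : 0 < e / 2 by rewrite divr_gt0.
  have [N hN] := small_invS e2.
  exists (val (c N) i); exists N => // n /= Nn.
  rewrite -ball_normE /=.
  rewrite -[X in `|X|]/(val (c N - c n) i).
  apply: (le_lt_trans (ell2_coord_le _ _)); apply: (lt_trans (cc N n)).
  by rewrite [e]splitr ltrD// hN.
pose x i := limn (fun n => val (c n) i : R).
have bound n k : \sum_(i < k) (val (c n) i - x i) ^+ 2 <= (2 * n.+1%:R^-1) ^+ 2.
  have cv : (fun m => \sum_(i < k) (val (c n) i - val (c m) i) ^+ 2) @ \oo -->
      \sum_(i < k) (val (c n) i - x i) ^+ 2.
    elim: k => [|k IH].
      by under eq_fun do rewrite big_ord0; rewrite big_ord0; exact: cvg_cst.
    under eq_fun do rewrite big_ord_recr/=; rewrite big_ord_recr/=.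
    apply: (cvgD IH); under eq_fun do rewrite expr2; rewrite expr2.
    by apply: cvgM; (apply: cvgB; [exact: cvg_cst|exact: (cvx k)]).
  apply: (cvgr_to_le cv); exists n => // m /= nm.
  apply: (le_trans (ell2_sum_le (c n - c m) k)).
  rewrite lerXn2r ?nnegrE ?mulr_ge0 ?invr_ge0//.
  apply: (le_trans (ltW (cc n m))).
  have : (m.+1%:R^-1 : R) <= n.+1%:R^-1 by rewrite lef_pV2 ?posrE ?ltr0n// ler_nat.
  move: (m.+1%:R^-1) (n.+1%:R^-1) => s t; lra.
have memd : (fun i => val (c 0%N) i - x i) \in @square_summable R.
  exact: square_summableP (bound 0%N).
pose d := mk_ell2 memd; pose u := c 0%N - d.
have uE n i : val (c n - u) i = val (c n) i - x i.
  rewrite -[LHS]/(val (c n) i - (val (c 0%N) i - (val (c 0%N) i - x i))).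
  by ring.
have cu n : `|c n - u| <= 2 * n.+1%:R^-1.
  rewrite -(@ler_pXn2r _ 2)// ?nnegrE ?mulr_ge0 ?invr_ge0//.
  apply: ell2_norm_le => k; under eq_bigr do rewrite uE.
  exact: bound.
apply/cvg_ex; exists u; apply/cvgrPdist_lt => e e0.
have e3 : 0 < e / 3 by rewrite divr_gt0.
have [N hN] := small_invS e3.
apply: filterS (hc N) => v; rewrite -ball_normE /= => vN.
rewrite -[u - v](subrKA (c N)); apply: (le_lt_trans (ler_normD _ _)).
rewrite distrC; have := cu N; have := hN N (leqnn _).
move: vN; move: (N.+1%:R^-1) => t; lra.
Qed.

HB.instance Definition _ := Uniform_isComplete.Build (ell2 R) ell2_complete.

Lemma hilbert_ell2 : hilbert_space (ell2 R).
Proof. by apply: (@hilbert_space_qform (ell2 R) (qell2 R)). Qed.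

Definition line_space : completeNormedModType R := R^o.

Lemma hilbert_line : hilbert_space line_space.
Proof.
apply: (@hilbert_space_qform line_space (qline R)) => x.
by rewrite real_normK ?num_real.
Qed.

HB.instance Definition _ := Uniform_isComplete.Build 'rV[R]_0 (@mx_complete R 1 0).

(** A functional may vanish, in which case the quotient by its kernel is the zero
    space. *)
Definition zero_space : completeNormedModType R := 'rV[R]_0.

Lemma hilbert_zero : hilbert_space zero_space.
Proof.
apply: (@hilbert_space_qform zero_space (qzero zero_space)) => x.
have -> : x = 0 by apply/rowP => -[].
by rewrite normr0 expr0n.
Qed.

End HilbertSpaces.

(** * Quotients by kernels of seminorms *)

Section QuotientMap.
Context (R : realType) (V : preTopologicalLmodType R) (S : submodClosed V).
Local Open Scope quotient_scope.

Definition quot_pi (x : V) : tvs_quot S := \pi_(Quotient.quot (submod_mem S)) x.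

Lemma quot_piK (w : tvs_quot S) : quot_pi (repr w) = w.
Proof. exact: reprK. Qed.

Lemma quot_pi_eq x y : quot_pi x = quot_pi y <-> x - y \in S.
Proof.
rewrite -[_ \in S]/(x - y \in submod_mem S) Quotient.idealrBE.
by split=> [pixy|/eqP //]; exact/eqP.
Qed.

Lemma quot_pi_linear : linear quot_pi.
Proof.
move=> a x y; rewrite /quot_pi Quotient.pi_add; congr (_ + _).
apply/quot_pi_eq; rewrite -scalerBr rpredZ//; apply/quot_pi_eq.
by rewrite quot_piK.
Qed.

Lemma quot_openP (B : set (tvs_quot S)) : open B <-> open (quot_pi @^-1` B).
Proof. by []. Qed.

HB.instance Definition _ := GRing.isLinear.Build R V (tvs_quot S) _ quot_pi quot_pi_linear.

End QuotientMap.

Section HilbertQuotients.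
Context (R : realType) (V : preTopologicalLmodType R) (P : nat -> seminorm V).
Hypothesis fV : frechet P.

Let Pmono := frechet_mono fV.

Lemma frechet_open (A : set V) : (forall x, A x -> exists k (e : R), 0 < e /\
  forall y, P k (y - x) < e -> A y) -> open A.
Proof.
by move=> h; rewrite openE => x /h Ax; apply/(frechet_nbhs fV).
Qed.

Lemma frechet_openP (A : set V) x : open A -> A x -> exists k (e : R), 0 < e /\
  forall y, P k (y - x) < e -> A y.
Proof. by move=> oA Ax; apply/(frechet_nbhs fV); exact: open_nbhs_nbhs. Qed.

Lemma frechet_continuous (H : normedModType R) (T : {linear V -> H}) n (C : R) :
  0 <= C -> (forall x, `|T x| <= C * P n x) -> continuous T.
Proof.
move=> C0 hT x A /normed_normP[e e0 hA].
apply/(frechet_nbhs fV); exists n, (e / (C + 1)).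
have c1 : 0 < C + 1 by rewrite ltr_wpDl.
split; first by rewrite divr_gt0.
move=> y; rewrite ltr_pdivlMr// => hy; apply: hA; rewrite -linearB.
apply: (le_lt_trans (hT _)); have := seminorm_ge0 (P n) (y - x); nra.
Qed.

(** An open continuous surjection identifies the quotient with its range. *)
Lemma hilbertian_of_onto (H : completeNormedModType R) (T : {linear V -> H})
    (p : seminorm V) :
  hilbert_space H -> (forall x, p x = `|T x|) ->
  (exists n (C : R), 0 <= C /\ forall x, `|T x| <= C * P n x) ->
  (forall k, exists C : R, 0 <= C /\ forall u, exists y, T y = u /\ P k y <= C * `|u|) ->
  hilbertian (tvs_quot (seminorm_ker p)).
Proof.
move=> hH pT [n [C [C0 hC]]] Topen; exists H => //.
have Teq x y : quot_pi (seminorm_ker p) x = quot_pi (seminorm_ker p) y <-> T x = T y.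
  rewrite quot_pi_eq; split=> [/eqP|xy].
    by rewrite pT linearB => /eqP; rewrite normr_eq0 subr_eq0 => /eqP.
  by apply/eqP; rewrite pT linearB xy subrr normr0.
pose f (w : tvs_quot (seminorm_ker p)) : H := T (repr w).
have fpi x : f (quot_pi _ x) = T x by apply/Teq; exact: quot_piK.
have flin : linear f.
  move=> a v w; rewrite -[v]quot_piK -[w]quot_piK -linearP !fpi; exact: linearP.
have surj u : exists y, T y = u by have [K [_ /(_ u)[y [yu _]]]] := Topen 0%N; exists y.
have [s hs] := choice surj.
exists (bundle_linear flin), (fun u => quot_pi _ (s u)).
have Tcont := frechet_continuous C0 hC.
split.
- apply/continuousP => A oA; apply/quot_openP.
  rewrite (_ : _ @^-1` _ = T @^-1` A); first by move/continuousP : Tcont; exact.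
  by apply/seteqP; split=> x; rewrite /preimage/= -(fpi x).
- apply/continuousP => B /quot_openP oB.
  rewrite openE => u /= Bu; have [k [e [e0 he]]] := frechet_openP oB Bu.
  have [K [K0 hK]] := Topen k.
  apply/normed_normP; exists (e / (K + 1)).
    by rewrite divr_gt0// ltr_wpDl.
  move=> v vu; have [z [Tz Pz]] := hK (v - u).
  change (B (quot_pi (seminorm_ker p) (s v))).
  have -> : quot_pi (seminorm_ker p) (s v) = quot_pi _ (s u + z).
    by apply/Teq; rewrite linearD !hs Tz addrC subrK.
  apply: he; rewrite addrC addKr; apply: (le_lt_trans Pz).
  rewrite ltr_pdivlMr ?ltr_wpDl// in vu.
  by have := normr_ge0 (v - u); nra.
- by move=> w; rewrite -[w in RHS]quot_piK; apply/Teq; rewrite hs.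
- by move=> u; rewrite -[RHS]hs; exact: fpi.
Qed.

(** A continuous operator whose image of every neighbourhood is dense in a ball
    is onto and open: the usual successive approximation. *)
Lemma onto_of_almost_open (H : normedModType R) (T : {linear V -> H}) :
  (exists n (C : R), 0 <= C /\ forall x, `|T x| <= C * P n x) ->
  (forall k, exists C : R, 0 <= C /\ forall u (e : R), 0 < e ->
     exists y, `|T y - u| < e /\ P k y <= C * `|u|) ->
  forall k, exists C : R, 0 <= C /\ forall u, exists y, T y = u /\ P k y <= C * `|u|.
Proof.
move=> [n [D [D0 hD]]] ao k.
have [C hC] := choice ao; have C0 j : 0 <= C j by case: (hC j).
have ex j : exists Y : H * R -> V, forall ue, 0 < ue.2 ->
    `|T (Y ue) - ue.1| < ue.2 /\ P j (Y ue) <= C j * `|ue.1|.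
  have [|Y hY] := @choice _ _ (fun (ue : H * R) y => 0 < ue.2 ->
    `|T y - ue.1| < ue.2 /\ P j y <= C j * `|ue.1|); last by exists Y.
  move=> [u e]; have [e0|_] := ltP 0 e; last by exists 0.
  by have [y hy] := (hC j).2 u e e0; exists y.
have [Y hY] := choice ex.
exists (C k + 1); split; first exact: addr_ge0.
move=> u; have [->|u0] := eqVneq u 0.
  by exists 0; rewrite linear0 seminorm0 normr0 mulr0.
have nu : 0 < `|u| by rewrite normr_gt0.
pose w j : R := 2^-1 ^+ j.+1.
have w0 j : 0 < w j by rewrite exprn_gt0// invr_gt0.
have wS j : w j.+1 = w j / 2 by rewrite /w exprS mulrC.
pose e j := `|u| * w j / (1 + C (k + j.+1)%N).
have e0 j : 0 < e j by rewrite divr_gt0 ?mulr_gt0// ltr_pwDl.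
(* [r j] is what remains after [j] corrections; the error [e j] is divided by the
   next constant [C], so that the next correction is small although the
   constants are not controlled. The seminorm index moves with [j] in order that
   the corrections be summable for every seminorm. *)
pose r := fix r j := if j is i.+1 then r i - T (Y (k + i)%N (r i, e i)) else u.
pose y j := Y (k + j)%N (r j, e j).
have rS j : r j.+1 = r j - T (y j) by [].
have rlt j : `|r j.+1| < e j.
  by rewrite rS distrC; have [] := hY (k + j)%N (r j, e j) (e0 j).
have Py j : P (k + j)%N (y j) <= C (k + j)%N * `|r j|.
  by have [] := hY (k + j)%N (r j, e j) (e0 j).
have PyS j : P (k + j.+1)%N (y j.+1) <= `|u| * w j.
  apply: (le_trans (Py j.+1)); apply: (le_trans (ler_wpM2l (C0 _) (ltW (rlt j)))).
  rewrite /e mulrA ler_pdivrMr ?ltr_pwDl// [leLHS]mulrC.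
  by rewrite ler_wpM2l ?mulr_ge0 ?(ltW nu) ?(ltW (w0 j))// lerDr.
pose s j := \sum_(i < j) y i.
have sS j : s j.+1 = s j + y j by rewrite /s big_ord_recr.
have Ts j : T (s j) = u - r j.
  elim: j => [|j IH]; first by rewrite /s big_ord0 linear0 subrr.
  by rewrite sS linearD IH rS opprB addrCA addrC.
have diff m j l : (m <= k + j)%N -> P m (s (j.+1 + l)%N - s j.+1) <= `|u| * (w j * 2 - w (j + l)%N * 2).
  move=> mk; elim: l => [|l IH]; first by rewrite !addn0 !subrr seminorm0 mulr0.
  rewrite addnS sS addrAC; apply: (le_trans (seminormD _ _ _)).
  apply: (le_trans (lerD IH (le_trans (Pmono _ _) (PyS (j + l)%N)))).
    by rewrite (leq_trans mk)// leq_add2l (leq_trans (leq_addr l j)).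
  rewrite -mulrDr ler_wpM2l ?(ltW nu)// addnS wS.
  by move: (w j) (w (j + l)%N) => a b; lra.
have wsmall (d : R) : 0 < d -> exists N, forall j, (N <= j)%N -> w j < d.
  move=> d0; exists (Num.truncn d^-1) => j Nj.
  have : (j.+1%:R : R) <= 2 ^+ j.+1.
    by rewrite -natrX ler_nat ltnW// ltn_expl.
  have dj : d^-1 < j.+1%:R by apply: (lt_le_trans (truncnS_gt _)); rewrite ler_nat ltnS.
  rewrite /w exprVn => h; rewrite invf_plt ?posrE ?exprn_gt0//.
  exact: lt_le_trans dj h.
have [|z hz] := frechet_complete fV (u := s).
  move=> m d d0; have dd : 0 < d / (8 * `|u|) by rewrite divr_gt0// mulr_gt0.
  have [N hN] := wsmall _ dd; pose M := maxn N m.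
  have close i : (M.+1 <= i)%N -> P m (s i - s M.+1) <= d / 4.
    move=> Mi; rewrite -(subnKC Mi).
    have mkM : (m <= k + M)%N by rewrite (leq_trans (leq_maxr N m)) ?leq_addl.
    apply: (le_trans (diff _ _ _ mkM)).
    have := hN M (leq_maxl _ _); rewrite ltr_pdivlMr ?mulr_gt0//.
    have := mulr_gt0 nu (w0 (M + (i - M.+1))%N).
    move: (w _) (w _) (`|u|) => a b c; lra.
  exists M.+1 => i j Mi Mj.
  apply: (le_lt_trans (seminorm_trans _ (s M.+1) _ _)).
  rewrite [X in _ + X]seminormC; have := close i Mi; have := close j Mj.
  lra.
have Tz : T z = u.
  apply/eqP; rewrite -subr_eq0 -normr_le0; apply/ler_addgt0Pr => d d0; rewrite add0r.
  have dd : 0 < d / 2 / (D + 1) by rewrite !divr_gt0// ltr_wpDl.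
  have [N hN] := hz n _ dd; have du : 0 < d / (2 * `|u|) by rewrite divr_gt0// mulr_gt0.
  have [M hM] := wsmall _ du; pose j := maxn N M.
  rewrite -[T z - u](subrKA (T (s j.+1))); apply: (le_trans (ler_normD _ _)).
  have h1 : `|T z - T (s j.+1)| <= d / 2.
    rewrite -linearB; apply: (le_trans (hD _)); rewrite seminormC.
    have := hN j.+1 (leqW (leq_maxl _ _)); rewrite ltr_pdivlMr ?ltr_wpDl//.
    by have := seminorm_ge0 (P n) (s j.+1 - z); nra.
  have h2 : `|T (s j.+1) - u| <= d / 2.
    rewrite Ts addrAC subrr sub0r normrN; apply: (le_trans (ltW (rlt j))).
    have := hM j (leq_maxr _ _); rewrite ltr_pdivlMr ?mulr_gt0// => h.
    apply: (@le_trans _ _ (`|u| * w j)).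
      rewrite /e ler_pdivrMr ?ltr_pwDl// ler_peMr ?lerDl//.
      by rewrite mulr_ge0 ?ltW.
    by move: (w j) (`|u|) h => a b; lra.
  lra.
exists z; split => //.
apply/ler_addgt0Pr => d d0; have [N hN] := hz k _ d0.
have bound : P k (s N.+1) <= (C k + 1) * `|u|.
  have h0 : P k (s 1%N) <= C k * `|u|.
    by rewrite /s big_ord1; have := Py 0%N; rewrite addn0.
  have := diff k 0%N N; rewrite addn0 => /(_ (leqnn _)).
  have := seminormD (P k) (s (1 + N)%N - s 1%N) (s 1%N); rewrite subrK add1n.
  have := w0 (0 + N)%N; have -> : w 0%N = 2^-1 by rewrite /w expr1.
  move: (w _) => a a0 h1 h2.
  have := mulr_gt0 nu a0; lra.
have := hN N.+1 (leqnSn _); have := seminormD (P k) (z - s N.+1) (s N.+1).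
rewrite subrK seminormC; lra.
Qed.

End HilbertQuotients.

(** * Seminorms that generate the topology *)

Section FrechetHilbertP.
Context (R : realType) (V : preTopologicalLmodType R) (P : nat -> seminorm V).
Hypothesis fV : frechet P.

Let Pmono := frechet_mono fV.

(** The lower bound sums the squares of several [p i]: the sequence [p] is not
    assumed increasing, and no single [p i] needs to dominate [P m]. *)
Lemma generate_of_bounds (p : nat -> seminorm V) :
  (forall i, exists n (C : R), 0 <= C /\ forall x, p i x <= C * P n x) ->
  (forall m, exists n (C : R), 0 <= C /\
    forall x, P m x ^+ 2 <= C * \sum_(i < n) p i x ^+ 2) ->
  seminorms_generate p.
Proof.
move=> up low x A; split.
- move=> /(frechet_nbhs fV)[m [e [e0 hA]]]; have [n [C [C0 hC]]] := low m.
  have w0 : 0 < C * n%:R + 1 by rewrite ltr_wpDl// mulr_ge0.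
  pose d := Num.min 1 (e ^+ 2 / (C * n%:R + 1)).
  have d0 : 0 < d by rewrite lt_min ltr01 divr_gt0// exprn_gt0.
  exists n, d; split => // y hy; apply: hA.
  have : P m (y - x) ^+ 2 < e ^+ 2.
    apply: (le_lt_trans (hC _)).
    have : \sum_(i < n) p i (y - x) ^+ 2 <= n%:R * d.
      have -> : n%:R * d = \sum_(i < n) d by exact: natr_mul_sum.
      apply: ler_sum => i _; have := hy i (ltnW (ltn_ord i)).
      have := seminorm_ge0 (p i) (y - x); have : d <= 1 by rewrite ge_min lexx.
      by move: (p i _) => t; rewrite expr2; nra.
    move=> /(ler_wpM2l C0)/le_lt_trans; apply.
    have : d * (C * n%:R + 1) <= e ^+ 2 by rewrite -ler_pdivlMr// ge_min lexx orbT.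
    lra.
  by rewrite ltr_pXn2r// ?nnegrE ?seminorm_ge0// ltW.
- move=> [n [e [e0 hA]]].
  have [m [C [C0 hC]]] := @common_bound _ _ p P n Pmono (fun m => seminorm_ge0 (P m))
    (fun i _ => up i).
  have w0 : 0 < C + 1 by rewrite ltr_wpDl.
  apply/(frechet_nbhs fV); exists m, (e / (C + 1)); split; first by rewrite divr_gt0.
  move=> y; rewrite ltr_pdivlMr// => yx; apply: hA => i ilt.
  apply: (le_lt_trans (hC i _ ilt)); have := seminorm_ge0 (P m) (y - x); nra.
Qed.

(** * From Hilbertian quotients to quadratic forms *)

(** The form is the square of the norm of the Hilbert space, pulled back to [V].
    Vectors lift with control of every [P k] because the inverse of the given
    homeomorphism is continuous and the quotient map is open. *)
Lemma quotient_form (p : seminorm V) :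
  (exists n (C : R), 0 <= C /\ forall x, p x <= C * P n x) ->
  hilbertian (tvs_quot (seminorm_ker p)) ->
  exists t : qform V, [/\ qcont P t,
    exists C : R, 0 <= C /\ forall x, p x ^+ 2 <= C * t x &
    forall k, exists C : R, 0 <= C /\ forall x, exists y,
      t (x - y) = 0 /\ P k y ^+ 2 <= C * t x].
Proof.
move=> [n0 [C0 [C00 pC]]] [H /hilbert_spaceP[q qE] [f [g [cf cg fK gK]]]].
pose T x : H := f (quot_pi (seminorm_ker p) x).
have Tlin : linear T by move=> a x y; rewrite /T !linearP.
pose L : {linear V -> H} := bundle_linear Tlin.
have LT x : L x = T x by [].
have g0 : g 0 = 0 by rewrite -(linear0 f) fK.
have pi0 : quot_pi (seminorm_ker p) 0 = 0 by exact: linear0.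
have piZ a z : quot_pi (seminorm_ker p) (a *: z) = a *: quot_pi (seminorm_ker p) z.
  exact: linearZ_LR.
have Tc : exists n (C : R), 0 <= C /\ forall x, qnorm (qcomp L q) x <= C * P n x.
  apply: (frechet_bound fV (q := qf_seminorm (qcomp L q))).
  have f1 : nbhs (f 0) [set h : H | `|h| < 1].
    by apply/normed_normP; exists 1 => // h; rewrite linear0 subr0.
  have := cf _ _ f1; rewrite nbhsE => -[B [/quot_openP oB B0] BA].
  have [k [e [e0 he]]] : exists k (e : R), 0 < e /\
      forall y, P k (y - 0) < e -> (quot_pi (seminorm_ker p) @^-1` B) y.
    by apply: (frechet_openP fV oB); rewrite /= pi0.
  apply/(frechet_nbhs fV); exists k, e; split => // y /he/BA /= h.
  by rewrite /qnorm /= -qE sqrtr_sqr normr_id.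
have opn (s : seminorm V) : (exists n (C : R), 0 <= C /\ forall x, s x <= C * P n x) ->
    exists C : R, 0 <= C /\ forall x, exists y,
      quot_pi (seminorm_ker p) y = quot_pi (seminorm_ker p) x /\ s y <= C * `|T x|.
  move=> [n [C [CC sC]]].
  pose B := [set w | exists x, quot_pi (seminorm_ker p) x = w /\ s x < 1].
  have oB : open B.
    apply/quot_openP/(frechet_open fV) => x [x' [xx' sx']].
    have w0 : 0 < C + 1 by rewrite ltr_wpDl.
    exists n, ((1 - s x') / (C + 1)); split; first by rewrite divr_gt0// subr_gt0.
    move=> y; rewrite ltr_pdivlMr// => yx; exists (x' + (y - x)); split.
      apply/quot_pi_eq; rewrite [y - x]addrC addrA addrK.
      exact/quot_pi_eq.
    apply: (le_lt_trans (seminormD _ _ _)); have := sC (y - x).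
    have := seminorm_ge0 (P n) (y - x); nra.
  have B0 : B (g 0) by exists 0; rewrite g0 pi0 seminorm0.
  have := cg 0 B (open_nbhs_nbhs (conj oB B0)).
  move=> /normed_normP[d d0 hd]; exists (2 / d); split; first by rewrite divr_ge0// ltW.
  move=> x; have [Tx0|Tx0] := eqVneq (T x) 0.
    exists 0; rewrite Tx0 normr0 mulr0 seminorm0; split => //.
    by apply: (can_inj fK); rewrite -[RHS]/(T x) Tx0 pi0 linear0.
  have nT : 0 < `|T x| by rewrite normr_gt0.
  pose c := d / (2 * `|T x|); have c0 : 0 < c by rewrite divr_gt0// mulr_gt0.
  have [|y [yx sy]] := hd (c *: T x).
    rewrite subr0 normrZ gtr0_norm// /c invfM mulrA mulfVK ?gt_eqF//; lra.
  exists (c^-1 *: y); split.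
    rewrite piZ yx; have -> : c *: T x = T (c *: x) by rewrite -[RHS]LT linearZ_LR.
    by rewrite /T fK piZ scalerA mulVf ?scale1r// gt_eqF.
  rewrite seminormZ gtr0_norm ?invr_gt0//.
  have -> : 2 / d * `|T x| = c^-1 by rewrite /c; field; rewrite !gt_eqF.
  by rewrite ler_piMr ?invr_ge0 ?ltW.
exists (qcomp L q); split.
- have [n [C [CC hC]]] := Tc; exists n, (C ^+ 2); split; first exact: sqr_ge0.
  move=> x; rewrite -qnorm_sqr -exprMn lerXn2r ?nnegrE ?qnorm_ge0//.
  by rewrite mulr_ge0 ?seminorm_ge0.
- have [C [CC hC]] := opn p (ex_intro _ n0 (ex_intro _ C0 (conj C00 pC))).
  exists (C ^+ 2); split; first exact: sqr_ge0.
  move=> x; have [y [/quot_pi_eq/eqP yx py]] := hC x.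
  rewrite /= -qE -exprMn lerXn2r ?nnegrE ?seminorm_ge0 ?mulr_ge0//.
  apply: le_trans py; have := seminorm_trans p y x 0; rewrite !subr0.
  by rewrite (seminormC p x y) yx add0r.
- move=> k; have [|C [CC hC]] := opn (P k).
    by exists k, 1; split => // x; rewrite mul1r.
  exists (C ^+ 2); split; first exact: sqr_ge0.
  move=> x; have [y [yx Py]] := hC x; exists y; split.
    by rewrite -[LHS]/(q (L (x - y))) linearB !LT /T yx subrr qf0.
  by rewrite /= -qE -exprMn lerXn2r ?nnegrE ?seminorm_ge0 ?mulr_ge0.
Qed.

(** Let [t i] be the form of the quotient by the kernel of [p i]. If one of them
    has infinite rank, its bounded liftings yield an independent complement in
    every larger form, which excludes the Schwartz property. If all of them have
    finite rank, the local Hilbert spaces are finite-dimensional, their dense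
    images stabilize at once, and projections onto them provide the bounded
    approximations. *)
Lemma frechet_hilbert_conditions : frechet_hilbert V ->
  hilbertizable P /\ (quojective P \/ non_schwartz P).
Proof.
case=> p gp hp.
have pc i : exists n (C : R), 0 <= C /\ forall x, p i x <= C * P n x.
  apply: (frechet_bound fV); apply/gp; exists i, 1; split => // y /(_ i (leqnn i)).
  by rewrite subr0.
have [t ht] := choice (fun i => quotient_form (pc i) (hp i)).
have tc i : qcont P (t i) by case: (ht i).
have tsum m : exists n (C : R), 0 <= C /\ forall x, P m x ^+ 2 <= C * qsum t n x.
  have [n [e [e0 hn]]] := (gp 0 _).1 (frechet_ball fV 0 m ltr01).
  have [|_ [C [C0 hC]]] := @common_bound _ _ (fun i x => p i x ^+ 2)
      (fun _ => qsum t n.+1) n (fun _ _ _ _ => lexx _) (fun _ => qf_ge0 _).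
    move=> i ilt; have [_ [C [C0 hC]] _] := ht i; exists 0%N, C; split => // x.
    by apply: (le_trans (hC x)); rewrite ler_wpM2l//; exact: ler_qsum.
  (* Rescaling turns the inclusion of balls [hn] into a bound. *)
  pose K := Num.sqrt C + 1; have K0 : 0 < K by rewrite ltr_wpDl ?sqrtr_ge0.
  exists n.+1, ((2 / (e / K)) ^+ 2); split; first exact: sqr_ge0.
  move=> x; rewrite -[qsum t _ x]qnorm_sqr -exprMn.
  have eK : 0 < e / K by rewrite divr_gt0.
  rewrite lerXn2r ?nnegrE ?seminorm_ge0 ?mulr_ge0 ?qnorm_ge0 ?invr_ge0 ?(ltW eK)//.
  apply: (@seminorm_bound _ _ (qf_seminorm (qsum t n.+1)) (P m) _ eK) => y /=.
  rewrite ltr_pdivlMr// => hy; have := hn y; rewrite /= subr0; apply => i ilt.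
  apply: le_lt_trans hy.
  have := sqrt_bound C0 (seminorm_ge0 (p i) y) (qnorm_ge0 (qsum t n.+1) y).
  rewrite qnorm_sqr => /(_ (hC i y ilt)) h; apply: (le_trans h).
  by rewrite mulrC ler_wpM2l ?qnorm_ge0// /K lerDl.
have hP : hilbertizable P.
  apply: hilbertizable_of_forms => m; have [n [C [C0 hC]]] := tsum m.
  by exists (qsum t n); split; [exact: qcont_qsum|exists C].
split => //; have [[i ii]|fin] := pselect (exists i, infinite_rank (t i)); [right|left].
- apply: (non_schwartz_of_indep (tc i) ii) => k.
  have [n [C [C0 hC]]] := tsum k; have [m [D [D0 hD]]] := qcont_qsum Pmono n tc.
  have [_ _ /(_ m)[E [E0 hE]]] := ht i.
  exists (qsub (relax_le (t i) (qsum t n))), (C * (D * E + 1)); split.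
  + exact: relax_split.
  + by rewrite mulr_ge0// addr_ge0// mulr_ge0.
  + move=> x; apply: (le_trans (hC x)); rewrite -mulrA ler_wpM2l//=.
    have : relax (t i) (qsum t n) x <= D * E * t i x.
      apply: relax_le_of => e e0; have [y [xy Py]] := hE x; exists y.
      rewrite xy; split => //; apply: ltr_pwDr => //.
      by apply: (le_trans (hD y)); rewrite -mulrA ler_wpM2l.
    have := qf_ge0 (qsub (relax_le (t i) (qsum t n))) x => /= g0 s0.
    have := mulr_ge0 (mulr_ge0 D0 E0) g0; have := qf_ge0 (t i) x; lra.
- have ft i : finite_rank (t i).
    by apply: finite_rankP => ii; apply: fin; exists i.
  move=> m; have [n [C [C0 hC]]] := tsum m.
  have [l [D [D0 hD]]] := qcont_qsum Pmono n tc; exists l => k.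
  have [ir|[N [b [ob qE]]]] := rank_dichotomy (qsum t n).
    by case: (infinite_not_finite ir); exact: finite_rank_qsum.
  pose S := \sum_(j < N) P k (b j).
  have S0 : 0 <= S by apply: sumr_ge0 => j _; exact: seminorm_ge0.
  have [K hK] := le_natr_bound (Num.sqrt D * S).
  exists K.+1 => x e e0 Px; exists (qproj (qsum t n) N b x); split.
    apply: (@le_lt_trans _ _ (qnorm (qsum t n) x * S)).
      apply: (le_trans (seminorm_sum _ _ _ _)); rewrite mulr_sumr.
      apply: ler_sum => j _; rewrite seminormZ ler_wpM2r ?seminorm_ge0//.
      apply: (le_trans (polar_le _ _ _)).
      by rewrite /qnorm -[qsum t n (b j)]polarxx ob// eqxx sqrtr1 mulr1.
    apply: (@le_lt_trans _ _ K%:R); last by rewrite ltr_nat.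
    apply: le_trans hK; rewrite ler_wpM2r//.
    rewrite ler_wsqrtr//; apply: (le_trans (hD x)).
    by rewrite ler_piMr// expr_le1 ?seminorm_ge0// ltW.
  have q0 : qsum t n (x - qproj (qsum t n) N b x) = 0.
    by rewrite qf_sub_proj// -qE subrr.
  have := hC (x - qproj (qsum t n) N b x); rewrite q0 mulr0.
  move=> h; rewrite -(@ltr_pXn2r _ 2) ?nnegrE ?seminorm_ge0 ?(ltW e0)//.
  by apply: (le_lt_trans h); rewrite exprn_gt0.
Qed.

(** * Frechet-Hilbert structures on products of lines *)

Definition norm_seminorm (H : normedModType R) (T : {linear V -> H}) : seminorm V.
Proof.
exists (fun x => `|T x|) => [x y|a x]; first by rewrite linearD ler_normD.
by rewrite linearZ_LR normrZ.
Defined.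

Lemma hilbertian_functional (f : V -> R) : functional f ->
  (exists n (C : R), 0 <= C /\ forall x, `|f x| <= C * P n x) ->
  exists p : seminorm V, (forall x, p x = `|f x|) /\
    hilbertian (tvs_quot (seminorm_ker p)).
Proof.
move=> ff fc; have [[x0 fx0]|nf] := pselect (exists x, f x != 0).
  have flin : linear (f : V -> line_space R) by move=> a x y; exact: ff.
  exists (norm_seminorm (bundle_linear flin)); split => //.
  apply: (hilbertian_of_onto fV (T := bundle_linear flin) (hilbert_line R)) => //.
  move=> k; exists (P k ((f x0)^-1 *: x0)); split; first exact: seminorm_ge0.
  have fZ a x : f (a *: x) = a * f x.
    by have := ff a x 0; rewrite addr0 (functional0 ff) addr0.
  move=> u; exists ((u : R) *: ((f x0)^-1 *: x0)); split.
    by rewrite -[LHS]/(f _) !fZ mulVf// mulr1.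
  by rewrite seminormZ mulrC.
have f0 x : f x = 0 by apply/eqP; apply: contrapT => /negP h; apply: nf; exists x.
have zlin : linear (fun _ : V => 0 : zero_space R).
  by move=> a x y; rewrite scaler0 addr0.
exists (norm_seminorm (bundle_linear zlin)); split.
  by move=> x; rewrite -[LHS]/(`|0 : zero_space R|) f0 !normr0.
apply: (hilbertian_of_onto fV (T := bundle_linear zlin) (hilbert_zero R)) => //.
  exists 0%N, 0; split => // x; rewrite mul0r.
  by rewrite -[X in X <= _]/(`|0 : zero_space R|) normr0.
move=> k; exists 0; split => // u; exists 0; split.
  by apply/rowP => -[].
by rewrite seminorm0 mul0r.
Qed.

(** The moduli of the coordinates of all factors generate the topology, and the
    quotient by the kernel of a functional is a line or zero. *)
Lemma frechet_hilbert_of_finite g : product_like P g ->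
  (forall i, finite_rank (g i)) -> frechet_hilbert V.
Proof.
move=> [gc gg gi] fg.
have [Nb hNb] := choice (fun i => finite_rank_basis (fg i)).
pose f k x : R := if unpickle k is Some ij then
  (if (ij.2 < (Nb ij.1).1)%N then polar (g ij.1) x ((Nb ij.1).2 ij.2) else 0) else 0.
have ff k : functional (f k).
  move=> c u v; rewrite /f; case: unpickle => [[i j]|]; last by rewrite mulr0 addr0.
  by case: ifP => _; [exact: functional_polar|rewrite mulr0 addr0].
have fc k : exists n (C : R), 0 <= C /\ forall x, `|f k x| <= C * P n x.
  rewrite /f; case: (unpickle k : option (nat * nat)) => [[i j]/=|]; last first.
    by exists 0%N, 0; split => // x; rewrite normr0 mul0r.
  case: (ltnP j (Nb i).1) => jN; last by exists 0%N, 0; split => // x; rewrite normr0 mul0r.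
  have [n [C [C0 hC]]] := gc i; exists n, (Num.sqrt C); split; first exact: sqrtr_ge0.
  move=> x; apply: sqrt_bound; rewrite ?normr_ge0 ?seminorm_ge0//.
  rewrite real_normK ?num_real//; apply: le_trans (hC x).
  apply: (le_trans (polar_CS _ _ _)); have [ob _] := hNb i.
  by rewrite -[X in _ * X]polarxx ob// eqxx mulr1.
have [p hp] := choice (fun k => hilbertian_functional (ff k) (fc k)).
exists p; last by move=> k; case: (hp k).
have pE k x : p k x = `|f k x| by case: (hp k).
apply: generate_of_bounds.
  by move=> i; have [n [C [C0 hC]]] := fc i; exists n, C; split => // x; rewrite pE.
move=> m; have [L [C [C0 hC]]] := gg m.
have [n [D [D0 hD]]] : exists n (D : R), 0 <= D /\
    forall x, qsum g L x <= D * \sum_(i < n) p i x ^+ 2.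
  elim: L {hC} => [|L [n [D [D0 IH]]]].
    by exists 0%N, 0; split => // x; rewrite mul0r.
  pose n' := (\max_(j < (Nb L).1) pickle (L, val j)).+1.
  exists (maxn n n'), (D + (Nb L).1%:R); split; first by rewrite addr_ge0.
  move=> x.
  rewrite [qsum _ _]/= mulrDl; apply: lerD.
    by apply: (le_trans (IH x)); rewrite ler_wpM2l// (sum_sqr_mono (fun k => p k x))// leq_maxl.
  have [_ ->] := hNb L; rewrite mulr_natl -[X in _ *+ X]card_ord -sumr_const.
  apply: ler_sum => j _; apply: le_trans (sum_sqr_mono (fun k => p k x) (leq_maxr n n')).
  have kn : (pickle (L, val j) < n')%N.
    by rewrite ltnS (leq_bigmax j).
  rewrite (bigD1 (Ordinal kn))//= pE /f pickleK/= ltn_ord real_normK ?num_real//.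
  by rewrite lerDl; apply: sumr_ge0 => *; exact: sqr_ge0.
exists n, (C * D); split; first exact: mulr_ge0.
by move=> x; apply: (le_trans (hC x)); rewrite -mulrA ler_wpM2l.
Qed.

End FrechetHilbertP.

(** * Frechet-Hilbert structures on spaces that are not Schwartz *)

Section Orthogonal.
Context (R : realType) (V : lmodType R).
Implicit Types (q : qform V).

Lemma qf_comb_orthogonal q N (a : nat -> R) (w : nat -> V) :
  (forall i j, i != j -> polar q (w i) (w j) = 0) ->
  q (comb N a w) = \sum_(i < N) a i ^+ 2 * q (w i).
Proof.
move=> ow; rewrite -polarxx polar_comb; apply: eq_bigr => i _.
rewrite polarC polar_comb (bigD1 i)//= polarxx big1 ?addr0 ?mulrA//.
by move=> j ji; rewrite ow ?mulr0.
Qed.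

(** Cauchy-Schwarz for [x] and the combination [y] of the [v i] with the
    coefficients to be estimated. *)
Lemma bessel_orthogonal q (v : nat -> V) (C : R) :
  (forall i j, i != j -> polar q (v i) (v j) = 0) -> (forall i, q (v i) <= C) ->
  forall x n, \sum_(i < n) polar q x (v i) ^+ 2 <= C * q x.
Proof.
move=> ov vC x n; set S := \sum_(i < n) _.
pose y := comb n (fun i => polar q x (v i)) v.
have yS : polar q x y = S.
  by rewrite polarC polar_comb; apply: eq_bigr => i _; rewrite polarC expr2.
have qy : q y <= C * S.
  rewrite qf_comb_orthogonal// mulr_sumr; apply: ler_sum => i _.
  by rewrite mulrC ler_wpM2r ?sqr_ge0.
have S0 : 0 <= S by apply: sumr_ge0 => i _; exact: sqr_ge0.
have C0 : 0 <= C by apply: le_trans (vC 0%N); exact: qf_ge0.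
have [S00|Sn0] := eqVneq S 0; first by rewrite S00 mulr_ge0 ?qf_ge0.
have Sp : 0 < S by rewrite lt_def Sn0.
have := polar_CS q x y; rewrite yS => h.
have := le_trans h (ler_wpM2l (qf_ge0 q x) qy).
rewrite expr2 mulrA ler_pM2r// => h'; by rewrite mulrC.
Qed.

(** Orthogonality to [s] for both forms is a condition of corank at most twice the
    size of [s], which a subspace of larger dimension allows for. *)
Lemma bounded_orthogonal q (B : qform V) (K : R) :
  (forall N, exists x, forall a, 0 < l1 N a ->
    0 < q (comb N a x) /\ B (comb N a x) <= K * q (comb N a x)) ->
  forall s : seq V, exists z, [/\ q z = 1, forall u, u \in s -> polar q z u = 0 &
    B z <= K /\ forall u, u \in s -> polar B z u = 0].
Proof.
move=> H s; pose n := size s; have [x hx] := H (n + n).+1.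
pose f i v := if (i < n)%N then polar q v (nth 0 s i) else polar B v (nth 0 s (i - n)).
have ff i : functional (f i).
  by rewrite /f => c u v; case: ifP => _; exact: functional_polar.
have [a [a0 ha]] := kill_functionals (n + n) x ff.
have [y0 By] := hx a a0; set y := comb _ a x in ha y0 By.
have n0 : 0 < qnorm q y by rewrite sqrtr_gt0.
have qn : (qnorm q y)^-1 ^+ 2 * q y = 1.
  by rewrite -[X in _ * X]qnorm_sqr -exprMn mulVf ?expr1n// gt_eqF.
exists ((qnorm q y)^-1 *: y); split.
- by rewrite qfZ.
- move=> u us; rewrite polarZl; have ui : (index u s < n)%N by rewrite index_mem.
  by have := ha _ (ltn_addr n ui); rewrite /f ui nth_index// => ->; rewrite mulr0.
- split.
    rewrite qfZ; apply: (le_trans (ler_wpM2l (sqr_ge0 _) By)).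
    by rewrite mulrCA qn mulr1.
  move=> u us; rewrite polarZl; have ui : (index u s < n)%N by rewrite index_mem.
  have : (n + index u s < n + n)%N by rewrite ltn_add2l.
  move=> /ha; rewrite /f ltnNge leq_addr/= addKn nth_index// => ->.
  by rewrite mulr0.
Qed.

Lemma sum_quarter n : \sum_(m < n) (2^-1 ^+ m) ^+ 2 <= 2 :> R.
Proof.
have w0 m : 0 <= (2^-1 ^+ m) ^+ 2 :> R by exact: sqr_ge0.
suff : \sum_(m < n) (2^-1 ^+ m) ^+ 2 <= 2 - 2 * (2^-1 ^+ n) ^+ 2 :> R.
  by have := w0 n; lra.
elim: n => [|n IH]; first by rewrite big_ord0 expr0 expr1n mulr1 subrr.
rewrite big_ord_recr/= [2^-1 ^+ n.+1]exprS exprMn; have := w0 n; move: IH.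
have -> : (2^-1 : R) ^+ 2 = 4^-1 by rewrite exprVn -natrX.
move: (\sum_(_ < _) _) (_ ^+ 2) => S t; lra.
Qed.

End Orthogonal.

(** The Hilbert space of a form [q] is covered by quotients of [V] isomorphic to
    l2, although [V] itself need not map onto it. Bounded orthonormal vectors
    [z t i m], one for each level [m] of boundedness, are reserved in a basis. The
    vectors [f t i] are sums over [m] of the [z t i m] with weights [2 ^ - m], so
    that the coordinates with respect to [f t i] can be prescribed with vectors
    that are bounded for [P k]: the coordinates [i >= k] are produced by [z t i k]
    alone, the finitely many others in any way. Adding basis vectors [c t i]
    orthogonal to all the [z t j m] does not disturb this, and the differences
    between the maps with and without them recover all basis coordinates that are
    not reserved for [t]. Two disjoint reservations recover all of them. *)
Section Quotients.
Context (R : realType) (V : preTopologicalLmodType R) (P : nat -> seminorm V).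
Hypothesis fV : frechet P.
Variables (q : qform V) (b : nat -> V) (B : nat -> qform V) (K : nat -> R).
Hypotheses (ob : orthonormal_seq q b) (pb : parseval q b).
Hypothesis PB : forall m x, P m x ^+ 2 <= B m x.

Let idx (t : bool) (i m : nat) : nat := (pickle ((t, i), m)).*2.+1.
Let z t i m := b (idx t i m).

Hypothesis K0 : forall m, 0 <= K m.
Hypothesis zK : forall t i m, B m (z t i m) <= K m.
Hypothesis zorth : forall t m i j, i != j -> polar (B m) (z t i m) (z t j m) = 0.

Let own n : option bool :=
  if odd n then omap (fun k : bool * nat * nat => k.1.1) (unpickle n./2) else None.

Let own_idx t i m : own (idx t i m) = Some t.
Proof. by rewrite /own /idx /= odd_double/= uphalf_double pickleK. Qed.

Let idx_inj t i m t' i' m' :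
  (idx t i m == idx t' i' m') = [&& t == t', i == i' & m == m'].
Proof.
apply/eqP/and3P => [[/double_inj/(pcan_inj pickleK)[-> -> ->]]|[/eqP-> /eqP-> /eqP->]//].
by rewrite !eqxx.
Qed.

Let c t n := if own n == Some t then 0 else b n.
Let f t i := comb i.+1 (fun m => 2^-1 ^+ m) (z t i).
Let v t (theta : bool) i := f t i + (if theta then c t i else 0).

Let qzz t i m j m' : polar q (z t i m) (z t j m') = ((i == j) && (m == m'))%:R.
Proof. by rewrite ob idx_inj eqxx. Qed.

Let qzf t i m j : polar q (z t i m) (f t j) = ((i == j) && (m <= j)%N)%:R * 2^-1 ^+ m.
Proof.
rewrite polarC polar_comb; have [<-|ij] := eqVneq i j; last first.
  by rewrite big1 ?mul0r// => k _; rewrite qzz eq_sym (negPf ij) mulr0.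
have [mj|jm] := leqP m i.
  rewrite (bigD1 (Ordinal (mj : (m < i.+1)%N)))//= qzz !eqxx mulr1 mul1r.
  rewrite big1 ?addr0// => k; rewrite -val_eqE/= => km.
  by rewrite qzz eqxx (negPf km) mulr0.
rewrite mul0r big1// => k _; rewrite qzz eqxx/=.
by rewrite ltn_eqF ?mulr0// (leq_trans (ltn_ord k)).
Qed.

Let qzc t i m n : polar q (z t i m) (c t n) = 0.
Proof.
rewrite /c; case: ifP => [_|h]; first exact: polar0r.
rewrite ob; case: eqP => // e; by rewrite -e own_idx eqxx in h.
Qed.

Let qzv t th i m j :
  polar q (z t i m) (v t th j) = ((i == j) && (m <= j)%N)%:R * 2^-1 ^+ m.
Proof.
by rewrite polarDr qzf; case: th; rewrite ?qzc ?polar0r addr0.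
Qed.

Let qff t i j : i != j -> polar q (f t i) (f t j) = 0.
Proof.
move=> ij; rewrite polar_comb big1// => m _.
by rewrite qzf (negPf ij) mul0r mulr0.
Qed.

Let qfc t i n : polar q (f t i) (c t n) = 0.
Proof. by rewrite polar_comb big1// => m _; rewrite qzc mulr0. Qed.

Let qcc t i j : i != j -> polar q (c t i) (c t j) = 0.
Proof.
move=> ij; rewrite /c; case: ifP => _; first exact: polar0l.
by case: ifP => _; rewrite ?polar0r// ob (negPf ij).
Qed.

Let qvv t th i j : i != j -> polar q (v t th i) (v t th j) = 0.
Proof.
move=> ij; rewrite polarDl !polarDr qff// add0r; case: th.
  by rewrite qfc polarC qfc qcc// !addr0.
by rewrite !polar0l polar0r !addr0.
Qed.

Let qv t th i : q (v t th i) <= 3.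
Proof.
have qf2 : q (f t i) <= 2.
  rewrite qf_comb_orthogonal; last by move=> m m' mm; rewrite qzz (negPf mm) andbF.
  apply: le_trans (sum_quarter R i.+1); apply: ler_sum => m _.
  by rewrite -[q _]polarxx qzz !eqxx mulr1.
rewrite qfD; have := qf2; case: th; last by rewrite qf0 polar0r; lra.
rewrite qfc; have : q (c t i) <= 1.
  by rewrite /c; case: ifP => _; rewrite ?qf0// -polarxx ob eqxx.
lra.
Qed.

(** The map for [t] and [th] takes the coordinates with respect to the orthogonal
    vectors [v t th i]. *)
Lemma covering_quotients : qcont P q -> exists T : bool -> bool -> {linear V -> ell2 R},
  [/\ forall t th, exists n (C : R), 0 <= C /\ forall x, `|T t th x| <= C * P n x,
      forall t th k, exists C : R, 0 <= C /\
        forall u, exists y, T t th y = u /\ P k y <= C * `|u| &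
      forall x, q x <= \sum_t \sum_th 2 * `|T t th x| ^+ 2].
Proof.
move=> [n0 [D [D0 hD]]].
have ex tt : exists T : {linear V -> ell2 R},
    (forall x i, val (T x) i = polar q x (v tt.1 tt.2 i)) /\
    forall x, `|T x| ^+ 2 <= 3 * q x.
  apply: coordinate_map; apply: bessel_orthogonal => *; [exact: qvv|exact: qv].
have [T' hT] := choice ex; pose T t th := T' (t, th).
have Tv t th x i : val (T t th x) i = polar q x (v t th i) by have [-> _] := hT (t, th).
have Tq t th x : `|T t th x| ^+ 2 <= 3 * q x by have [_ ->] := hT (t, th).
have Tc t th : exists n (C : R), 0 <= C /\ forall x, `|T t th x| <= C * P n x.
  exists n0, (Num.sqrt (3 * D)); split; first exact: sqrtr_ge0.
  move=> x; apply: sqrt_bound; rewrite ?mulr_ge0 ?seminorm_ge0//.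
  by apply: (le_trans (Tq t th x)); rewrite -mulrA ler_wpM2l.
exists T; split => //.
- move=> t th; apply: (onto_of_almost_open fV) => // k.
  pose S := \sum_(i < k) P k (z t i 0%N).
  have S0 : 0 <= S by apply: sumr_ge0 => i _; exact: seminorm_ge0.
  exists (S + 2 ^+ k * Num.sqrt (K k)); split.
    by rewrite addr_ge0// mulr_ge0 ?sqrtr_ge0// exprn_ge0.
  move=> u e e0; have [r hr] := ell2_trunc u e0.
  (* The weight [2 ^ - k] of [z t i k] in [f t i] is compensated. *)
  pose y1 := comb k (val u) (fun i => z t i 0).
  pose y2 := comb r (fun i => val u (k + i)%N) (fun i => z t (k + i)%N k).
  have Ty : forall j, val (T t th (y1 + 2 ^+ k *: y2)) j =
      if (j < k + r)%N then val u j else 0.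
    move=> j; rewrite Tv polarDl polarZl !polar_comb.
    have [jk|kj] := ltnP j k.
      rewrite (ltn_addr _ jk) (bigD1 (Ordinal jk))//= qzv eqxx leq0n mul1r expr0 mulr1.
      rewrite big1; last first.
        by move=> i; rewrite -val_eqE/= => /negPf ij; rewrite qzv ij mul0r mulr0.
      rewrite big1 ?mulr0 ?addr0// => i _.
      by rewrite qzv gtn_eqF ?(leq_trans jk (leq_addr _ _))// mul0r mulr0.
    rewrite big1 ?add0r; last first.
      by move=> i _; rewrite qzv ltn_eqF ?(leq_trans (ltn_ord i))// mul0r mulr0.
    rewrite -(subnKC kj) ltn_add2l; move: (j - k)%N => l; case: ltnP => lr.
      rewrite (bigD1 (Ordinal lr))//= qzv eqxx leq_addr mul1r big1.
        by rewrite addr0 mulrCA exprVn mulfV ?mulr1// expf_neq0.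
      move=> i; rewrite -val_eqE/= => /negPf il.
      by rewrite qzv eqn_add2l il mul0r mulr0.
    rewrite big1 ?mulr0// => i _; rewrite qzv eqn_add2l ltn_eqF ?mul0r ?mulr0//.
    exact: leq_trans (ltn_ord i) lr.
  exists (y1 + 2 ^+ k *: y2); split.
    rewrite -normrN opprB; apply: (hr (k + r)%N) => [|i ik|i ik].
    - exact: leq_addl.
    - by rewrite -[val _ i]/(val u i - val (T t th _) i) Ty ik subrr.
    - by rewrite -[val _ i]/(val u i - val (T t th _) i) Ty ltnNge ik subr0.
  apply: (le_trans (seminormD _ _ _)); rewrite mulrDl; apply: lerD.
    apply: (le_trans (seminorm_sum _ _ _ _)); rewrite mulr_suml.
    apply: ler_sum => i _; rewrite seminormZ mulrC ler_wpM2l ?seminorm_ge0//.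
    exact: ell2_coord_le.
  rewrite seminormZ ger0_norm ?exprn_ge0// -mulrA ler_wpM2l ?exprn_ge0//.
  apply: sqrt_bound; rewrite ?K0 ?seminorm_ge0//; apply: (le_trans (PB _ _)).
  rewrite qf_comb_orthogonal; last by move=> i j ij; rewrite zorth// eqn_add2l.
  apply: (@le_trans _ _ (K k * \sum_(i < r) val u (k + i)%N ^+ 2)).
    rewrite mulr_sumr; apply: ler_sum => i _; rewrite mulrC.
    by rewrite ler_wpM2r ?sqr_ge0.
  rewrite ler_wpM2l//; apply: le_trans (ell2_sum_le u (k + r)%N).
  by rewrite big_split_ord/= lerDr; apply: sumr_ge0 => i _; exact: sqr_ge0.
- move=> x; apply/ler_addgt0Pr => e e0; have [N /(_ _ (leqnn N))] := pb x e0.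
  rewrite qf_sub_proj; last exact: orthonormal_seqW.
  suff : \sum_(i < N) polar q x (b i) ^+ 2 <= \sum_t \sum_th 2 * `|T t th x| ^+ 2 by lra.
  have bc i : polar q x (b i) ^+ 2 <= \sum_t polar q x (c t i) ^+ 2.
    rewrite big_bool /c/=; case: (own i) => [[]|]/=.
    + by rewrite lerDr sqr_ge0.
    + by rewrite lerDl sqr_ge0.
    + by rewrite lerDl sqr_ge0.
  apply: (@le_trans _ _ (\sum_t \sum_(i < N) polar q x (c t i) ^+ 2)).
    by rewrite exchange_big; apply: ler_sum => i _; exact: bc.
  apply: ler_sum => t _; rewrite big_bool/= -mulrDr.
  apply: le_trans (qfB_le (qell2 R) (T t true x) (T t false x)).
  apply: le_trans (ell2_sum_le (T t true x - T t false x) N); apply: ler_sum => i _.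
  rewrite -[val (T t true x - _) i]/(val (T t true x) i - val (T t false x) i) !Tv /v addr0.
  by rewrite polarDr addrC addKr.
Qed.

End Quotients.

(** * The characterization of Frechet-Hilbert spaces *)

Section FrechetHilbertNS.
Context (R : realType) (V : preTopologicalLmodType R) (P : nat -> seminorm V).
Hypothesis fV : frechet P.

Let Pmono := frechet_mono fV.

(** Being non-Schwartz provides, for each [m], vectors of unit length for [q] that
    are bounded for the form of level [m], inside any subspace of finite
    codimension; a basis can be built around them. *)
Lemma non_schwartz_quotients : hilbertizable P -> non_schwartz P -> forall l,
  exists T : bool -> bool -> {linear V -> ell2 R},
  [/\ forall t th, exists n (C : R), 0 <= C /\ forall x, `|T t th x| <= C * P n x,
      forall t th k, exists C : R, 0 <= C /\
        forall u, exists y, T t th y = u /\ P k y <= C * `|u| &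
      exists C : R, 0 <= C /\
        forall x, P l x ^+ 2 <= C * \sum_t \sum_th `|T t th x| ^+ 2].
Proof.
move=> hP [n0 ns] l.
have [q [n1 [C1 [C10 hq]]]] := hilbertizableP hP (maxn l n0).
have qc : qcont P q by exists n1, C1; split => // x; case/andP: (hq x).
have qP m x : (m <= maxn l n0)%N -> P m x ^+ 2 <= q x.
  move=> h; apply: le_trans (Pmono2 Pmono x h) _; by case/andP: (hq x).
have exB m : exists BK : qform V * R, [/\ 0 <= BK.2,
    forall x, P m x ^+ 2 <= BK.1 x &
    forall N, exists x, forall a, 0 < l1 N a ->
      0 < q (comb N a x) /\ BK.1 (comb N a x) <= BK.2 * q (comb N a x)].
  have [B [k [C [C0 hB]]]] := hilbertizableP hP m; have [j hj] := ns k.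
  exists (B, C * j.+1%:R ^+ 2); split => [|x|N] /=.
  - by rewrite mulr_ge0// sqr_ge0.
  - by case/andP: (hB x).
  - have [x [e [e0 hx]]] := hj N; exists x => a a0; move: (comb N a x) (hx a) => y hy.
    have Py : 0 < P n0 y.
      apply: lt_le_trans hy; rewrite ltr_wpDl ?mulr_gt0//.
      by rewrite mulr_ge0 ?seminorm_ge0// invr_ge0.
    have qy := qP n0 y (leq_maxr _ _).
    split; first by apply: lt_le_trans qy; rewrite exprn_gt0.
    have /andP[_ By] := hB y; apply: (le_trans By); rewrite -mulrA ler_wpM2l//.
    apply: le_trans (ler_wpM2l (sqr_ge0 _) qy); rewrite -exprMn.
    rewrite lerXn2r ?nnegrE ?mulr_ge0 ?seminorm_ge0// -ler_pdivrMl//.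
    by apply: le_trans hy; rewrite lerDl mulr_ge0 ?l1_ge0 ?(ltW e0).
have [BK hBK] := choice exB.
pose lev k : nat := if (unpickle k : option (bool * nat * nat)) is Some ((_, _), m) then m else 0%N.
have [d hd] := qcont_dense fV qc.
have [|b [ob pb hb]] := basis_with_requests (q := q) (d := d) (Z := fun k s z =>
    (BK (lev k)).1 z <= (BK (lev k)).2 /\
    forall u, u \in s -> polar (BK (lev k)).1 z u = 0) hd.
  by move=> k; apply: bounded_orthogonal; case: (hBK (lev k)).
have levE (t : bool) (i m : nat) : lev (pickle ((t, i), m)) = m by rewrite /lev pickleK.
have orth m t i j (x := fun i => b (pickle ((t : bool, i : nat), m : nat)).*2.+1) :
    (pickle ((t : bool, i : nat), m : nat) < pickle ((t, j : nat), m))%N ->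
    polar (BK m).1 (x j) (x i) = 0.
  move=> ij; have [_] := hb (pickle ((t, j), m)); rewrite levE; apply.
  by apply/mapP; exists (pickle ((t, i), m)).*2.+1 => //; rewrite mem_iota add0n ltnS ltn_double.
have [||||T [Tc To Tq]] := @covering_quotients _ V P fV q b (fun m => (BK m).1)
    (fun m => (BK m).2) ob pb _ _ _ _ qc.
- by move=> m; case: (hBK m).
- by move=> m; case: (hBK m).
- by move=> t i m; have [] := hb (pickle ((t, i), m)); rewrite levE.
- move=> t m i j ij; have := orth m t i j; have := orth m t j i; rewrite /= => h1 h2.
  case: (ltngtP (pickle ((t, i), m)) (pickle ((t, j), m))) => [/h2|/h1//|].
    by rewrite polarC.
  by move=> /(pcan_inj pickleK)[e]; rewrite e eqxx in ij.
exists T; split => //; exists 2; split => // x; apply: (le_trans (qP l x (leq_maxl _ _))).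
apply: (le_trans (Tq x)); rewrite mulr_sumr; apply: ler_sum => t _.
by rewrite mulr_sumr.
Qed.

(** All the covering quotients of all levels, in one sequence. *)
Lemma frechet_hilbert_of_non_schwartz : hilbertizable P -> non_schwartz P ->
  frechet_hilbert V.
Proof.
move=> hP ns; have [T hT] := choice (non_schwartz_quotients hP ns).
pose S k : {linear V -> ell2 R} :=
  if (unpickle k : option (nat * bool * bool)) is Some ((l, t), th) then T l t th else T 0%N true true.
have Sc k : exists n (C : R), 0 <= C /\ forall x, `|S k x| <= C * P n x.
  rewrite /S; case: (unpickle k : option (nat * bool * bool)) => [[[l t] th]|].
    by have [+ _ _] := hT l; exact.
  by have [+ _ _] := hT 0%N; exact.
have So k : forall m, exists C : R, 0 <= C /\
    forall u, exists y, S k y = u /\ P m y <= C * `|u|.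
  rewrite /S; case: (unpickle k : option (nat * bool * bool)) => [[[l t] th]|].
    by have [_ + _] := hT l; exact.
  by have [_ + _] := hT 0%N; exact.
exists (fun k => norm_seminorm (S k)).
  apply: (generate_of_bounds fV) => // m; have [_ _ [C [C0 hC]]] := hT m.
  pose n := (\max_(tt : bool * bool) pickle ((m, tt.1), tt.2)).+1.
  exists n, (C * 4); split; first exact: mulr_ge0.
  move=> x; apply: (le_trans (hC x)); rewrite -mulrA ler_wpM2l//.
  have le1 t th : `|T m t th x| ^+ 2 <= \sum_(i < n) norm_seminorm (S i) x ^+ 2.
    have kn : (pickle ((m, t), th) < n)%N.
      by rewrite ltnS (leq_bigmax (F := fun tt : bool * bool => pickle ((m, tt.1), tt.2)) (t, th)).
    rewrite (bigD1 (Ordinal kn))//= /S pickleK lerDl.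
    by apply: sumr_ge0 => *; exact: sqr_ge0.
  rewrite !big_bool/=; have := le1 true true; have := le1 true false.
  have := le1 false true; have := le1 false false; move: (\sum_(_ < n) _) => s.
  lra.
by move=> k; apply: (hilbertian_of_onto fV (T := S k) (hilbert_ell2 R)).
Qed.

(** A space that is not Schwartz is covered by quotients isomorphic to l2. A
    quojection that is Schwartz is a product of finite-dimensional spaces, whose
    coordinates generate the topology. *)
Theorem frechet_hilbertP :
  frechet_hilbert V <-> hilbertizable P /\ (quojective P \/ non_schwartz P).
Proof.
split; first exact: frechet_hilbert_conditions.
move=> [hP H]; have [ns|ns] := pselect (non_schwartz P).
  exact: frechet_hilbert_of_non_schwartz.
case: H => // cQ; have [g pg] := product_like_exists Pmono hP cQ.
apply: (frechet_hilbert_of_finite fV pg) => i; apply: finite_rankP => ii.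
exact/ns/(infinite_non_schwartz pg ii).
Qed.

End FrechetHilbertNS.

(** * The space of continuous functions *)

Section ContinuousFunctions.
Context (R : realType).
Implicit Types (f g : CR R) (m : nat).

Definition cfun f : R -> R := val f.

Lemma cfun_continuous f : continuous (cfun f).
Proof. by apply/asboolP; exact: (valP f). Qed.

Definition mk_cfun (h : R -> R) (hc : continuous h) : CR R.
Proof. by apply: (Sub (h : compact_convergence R)); apply/asboolP. Defined.

Lemma cfunB f g t : cfun (f - g) t = cfun f t - cfun g t.
Proof. by []. Qed.

Let I m : set R := [set t | `|t| <= m%:R].

Let compactI m : compact (I m).
Proof.
suff -> : I m = `[- m%:R, m%:R]%classic by exact: segment_compact.
by apply/seteqP; split => t; rewrite /I/= in_itv/= ler_norml.
Qed.

Let bounded f m : exists M : R, forall t, `|t| <= m%:R -> `|cfun f t| <= M.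
Proof.
have : compact (cfun f @` I m).
  by apply: continuous_compact => //; apply: continuous_subspaceT; exact: cfun_continuous.
move=> /(@compact_bounded R R^o)[M [Mr hM]]; exists (M + 1) => t tm.
by apply: hM; [rewrite ltrDl|exists t].
Qed.

Let has_sup_abs f m : has_sup [set `|cfun f t| | t in I m].
Proof.
split; first by exists `|cfun f 0|, 0; rewrite // /I/= normr0.
by have [M hM] := bounded f m; exists M => _ [t tm <-]; exact: hM.
Qed.

Definition abs_sup m f : R := sup [set `|cfun f t| | t in I m].

Lemma le_abs_sup m f t : `|t| <= m%:R -> `|cfun f t| <= abs_sup m f.
Proof. by move=> tm; apply: (sup_upper_bound (has_sup_abs f m)); exists t. Qed.

Lemma abs_sup_le m f (M : R) : (forall t, `|t| <= m%:R -> `|cfun f t| <= M) ->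
  abs_sup m f <= M.
Proof.
move=> h; apply: sup_le_ub; first by case: (has_sup_abs f m).
by move=> _ [t tm <-]; exact: h.
Qed.

Lemma abs_supD m f g : abs_sup m (f + g) <= abs_sup m f + abs_sup m g.
Proof.
apply: abs_sup_le => t tm; rewrite -[cfun _ t]/(cfun f t + cfun g t).
by apply: (le_trans (ler_normD _ _)); rewrite lerD// le_abs_sup.
Qed.

Lemma abs_supZ m (a : R) f : abs_sup m (a *: f) = `|a| * abs_sup m f.
Proof.
have cZ t : cfun (a *: f) t = a * cfun f t by [].
apply/le_anti/andP; split.
  apply: abs_sup_le => t tm; rewrite cZ normrM ler_wpM2l//; exact: le_abs_sup.
have [->|a0] := eqVneq a 0.
  rewrite normr0 mul0r; apply: le_trans (@le_abs_sup m _ 0 _) => //.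
  by rewrite normr0.
rewrite -ler_pdivlMl ?normr_gt0//; apply: abs_sup_le => t tm.
by rewrite ler_pdivlMl ?normr_gt0// -normrM -cZ; exact: le_abs_sup.
Qed.

Definition sup_norm m : seminorm (CR R) := Seminorm (abs_supD m) (abs_supZ m).

Lemma sup_norm_mono m n f : (m <= n)%N -> sup_norm m f <= sup_norm n f.
Proof.
move=> mn; apply: abs_sup_le => t tm; apply: le_abs_sup.
by apply: (le_trans tm); rewrite ler_nat.
Qed.

Lemma sup_norm_lt m f g (e : R) : sup_norm m (f - g) < e ->
  forall t, `|t| <= m%:R -> `|cfun f t - cfun g t| < e.
Proof. by move=> h t tm; apply: le_lt_trans h; rewrite -cfunB; exact: le_abs_sup. Qed.

(** Every compact set lies in a symmetric interval, and these intervals are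
    compact. *)
Lemma nbhs_sup_norm f (A : set (CR R)) : nbhs f A <->
  exists m (e : R), 0 < e /\ forall g, sup_norm m (g - f) < e -> A g.
Proof.
pose W (me : nat * R) : set (compact_convergence R) :=
  [set h | forall t, `|t| <= me.1%:R -> `|h t - cfun f t| < me.2].
pose D := [set me : nat * R | 0 < me.2].
have FW : Filter (filter_from D W).
  apply: filter_from_filter; first by exists (0%N, 1); rewrite /D/=.
  move=> [m e] [n d]; rewrite /D/= => e0 d0.
  exists (maxn m n, Num.min e d); first by rewrite /= lt_min e0.
  have H h t : W (maxn m n, Num.min e d) h -> `|t| <= (maxn m n)%:R ->
      `|h t - cfun f t| < e /\ `|h t - cfun f t| < d.
    by move=> hh /hh; rewrite /= lt_min => /andP.
  move=> h hh; split=> t /= tm; have [] := H h t hh => //; apply: (le_trans tm);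
    by rewrite ler_nat ?leq_maxl ?leq_maxr.
have conv : {family compact, filter_from D W --> (val f : R -> R)}.
  apply/fam_cvgP => K /(@compact_bounded R R^o)[M [Mr hM]] B /uniform_nbhs[E [entE EB]].
  have := entE; rewrite -entourage_ballE => -[e e0 hE].
  have [m hm] := le_natr_bound (M + 1).
  exists (m, e) => // h hh; apply: EB => t Kt; apply: hE.
  rewrite /= -ball_normE /= distrC; apply: hh => /=; apply: le_trans hm.
  by apply: (hM (M + 1)) => //; rewrite ltrDl.
split.
- move=> /nbhs_initialP[B Bf BA]; have [[m e] e0 WB] := conv _ Bf.
  exists m, e; split => // g gf; apply: BA; apply: WB => t tm.
  exact: sup_norm_lt gf _ tm.
- move=> [m [e [e0 hA]]]; apply/nbhs_initialP.
  have e2 : 0 < e / 2 by rewrite divr_gt0.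
  have := @fam_nbhs R R compact (I m) [set xy | ball xy.1 (e / 2) xy.2] (val f).
  move=> /(_ (entourage_ball _ (PosNum e2)) (@compactI m)) nb.
  exists [set h | forall t, I m t -> ball (cfun f t) (e / 2) (h t)] => // g hg.
  apply: hA; apply: (@le_lt_trans _ _ (e / 2)); last lra.
  apply: abs_sup_le => t tm; have := hg t tm.
  by rewrite /= -ball_normE /= distrC => /ltW.
Qed.

Lemma sup_norm_complete (u : nat -> CR R) :
  (forall m (e : R), 0 < e -> exists N, forall i j, (N <= i)%N -> (N <= j)%N ->
    sup_norm m (u i - u j) < e) ->
  exists x, forall m (e : R), 0 < e -> exists N, forall i, (N <= i)%N ->
    sup_norm m (u i - x) < e.
Proof.
move=> cu; have [M hM] := choice (fun t : R => le_natr_bound `|t|).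
have ch t : cvgn (fun i => cfun (u i) t : R).
  apply: cauchy_cvg; apply/cauchyP => e e0; have [N hN] := cu (M t) e e0.
  exists (cfun (u N) t); exists N => // n /= Nn; rewrite -ball_normE /=.
  by apply: sup_norm_lt (hN _ _ (leqnn N) Nn) _ _.
pose h t := limn (fun i => cfun (u i) t : R).
have uh m (e : R) : 0 < e -> exists N, forall i t, (N <= i)%N -> `|t| <= m%:R ->
    `|cfun (u i) t - h t| <= e.
  move=> e0; have [N hN] := cu m e e0; exists N => i t Ni tm.
  apply/ler_addgt0Pr => d d0; have /cvgrPdist_lt/(_ _ d0)[K _ hK] := ch t.
  have := hK (maxn K N) (leq_maxl _ _); rewrite /= -/(h t) => h1.
  have h2 := sup_norm_lt (hN _ _ Ni (leq_maxr K N)) tm.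
  rewrite -(subrKA (cfun (u (maxn K N)) t)); apply: (le_trans (ler_normD _ _)).
  by apply: lerD; apply: ltW => //; rewrite distrC.
have hc : continuous h.
  move=> t; apply/cvgrPdist_lt => e e0; have e3 : 0 < e / 4 by rewrite divr_gt0.
  have [m tm] := le_natr_bound (`|t| + 1); have [N hN] := uh m _ e3.
  have /cvgrPdist_lt/(_ _ e3) := @cfun_continuous (u N) t.
  have near1 : \forall s \near t, `|t - s| < 1.
    by have := @nbhsx_ballx _ R^o t 1 ltr01; rewrite -ball_normE.
  apply: filterS2 near1 => s ts h1.
  have sm : `|s| <= m%:R.
    apply: le_trans tm; rewrite -[s](subKr t); apply: (le_trans (ler_normB _ _)).
    by rewrite lerD2l ltW.
  have h2 := hN N t (leqnn N) (le_trans _ tm); have h3 := hN N s (leqnn N) sm.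
  move: h2; rewrite lerDl ler01 distrC => /(_ isT) h2.
  rewrite -(subrKA (cfun (u N) t)); apply: (le_lt_trans (ler_normD _ _)).
  rewrite -[_ - h s](subrKA (cfun (u N) s)).
  have := ler_normD (cfun (u N) t - cfun (u N) s) (cfun (u N) s - h s); lra.
exists (mk_cfun hc) => m e e0; have e2 : 0 < e / 2 by rewrite divr_gt0.
have [N hN] := uh m _ e2; exists N => i Ni.
apply: (@le_lt_trans _ _ (e / 2)); last lra.
by apply: abs_sup_le => t tm; rewrite cfunB; exact: hN.
Qed.

Lemma uniform_continuity f m (e : R) : 0 < e -> exists N : nat,
  forall s t, `|s| <= m%:R -> `|t - s| < N.+1%:R^-1 -> `|cfun f t - cfun f s| < e.
Proof.
move=> e0; have := (compact_near_coveringP _).1 (@compactI m) nat \oo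
  (fun N s => forall t, `|t - s| < N.+1%:R^-1 -> `|cfun f t - cfun f s| < e) _.
case=> [s sm|N _ hN]; last by exists N => s t sm; exact: (hN N (leqnn N)).
have e2 : 0 < e / 2 by rewrite divr_gt0.
have := @cfun_continuous f s _ (nbhsx_ballx (cfun f s) (PosNum e2)%:num e2).
move=> /nbhs_ballP[d /= d0]; rewrite -ball_normE /= => hd.
have d2 : 0 < d / 2 by rewrite divr_gt0.
have [N hN] := small_invS d2.
exists ([set s' | `|s - s'| < d / 2], [set n | (N <= n)%N]).
  split; last by exists N.
  by have := @nbhsx_ballx _ R^o s (d / 2) d2; rewrite -ball_normE.
move=> [s' n] /= [ss' /hN Nn] t ts'.
have h1 : `|cfun f s - cfun f s'| < e / 2.
  by apply: (hd s'); rewrite /=; apply: (lt_trans ss'); lra.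
have h2 : `|cfun f s - cfun f t| < e / 2.
  apply: (hd t) => /=.
  rewrite -(subrKA s'); apply: (le_lt_trans (ler_normD _ _)).
  rewrite (distrC s' t); have := lt_trans ts' Nn; move: ss'; lra.
rewrite -(subrKA (cfun f s)); apply: (le_lt_trans (ler_normD _ _)).
rewrite distrC; lra.
Qed.

(** Countably many sets, each described by finitely many rational numbers, that
    separate the continuous functions as finely as the topology does. *)
Lemma sup_norm_cover : exists B : nat -> set (CR R), forall f m (e : R), 0 < e ->
  exists j, B j f /\ forall g, B j g -> sup_norm m (g - f) < e.
Proof.
pose C (m N r : nat) (s : seq rat) : set (CR R) := [set g | forall t, `|t| <= m%:R ->
  `|cfun g t - ratr (nth 0 s (Num.truncn ((t + m%:R) * N.+1%:R)))| < r.+1%:R^-1].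
exists (fun j => if (unpickle j : option (nat * nat * nat * seq rat)) is
  Some (((m, N), r), s) then C m N r s else set0) => f m e e0.
have e2 : 0 < e / 4 by rewrite divr_gt0.
have [r hr] := small_invS e2; have r2 : 0 < r.+1%:R^-1 / 2 :> R by rewrite divr_gt0// invr_gt0.
have [N hN] := uniform_continuity f m r2.
have [|c hc] := @choice nat rat (fun k c =>
    `|cfun f (k%:R / N.+1%:R - m%:R) - ratr c| < r.+1%:R^-1 / 2).
  move=> k; set a := cfun f _.
  have [|c] := @rat_in_itvoo R (a - r.+1%:R^-1 / 2) (a + r.+1%:R^-1 / 2).
    by move: r2; move: (_ / 2) => z; lra.
  rewrite in_itv/= => /andP[c1 c2]; exists c; rewrite ltr_norml.
  by move: c1 c2; move: (_ / 2) (ratr c) => z y; move=> *; apply/andP; split; lra.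
pose L := ((m + m) * N.+1).+1.
have inC : C m N r (mkseq c L) f.
  move=> t tm; set k := Num.truncn _.
  have := tm; rewrite ler_norml => /andP[t1 t2].
  have tk0 : 0 <= (t + m%:R) * N.+1%:R by rewrite mulr_ge0//; move: t1; lra.
  have kL : (k < L)%N.
    rewrite ltnS -(ler_nat R); apply: (@le_trans _ _ ((t + m%:R) * N.+1%:R)).
      by rewrite truncn_le.
    by rewrite natrM ler_wpM2r// natrD; move: t2; lra.
  rewrite nth_mkseq//; pose p : R := k%:R / N.+1%:R - m%:R.
  have N0 : 0 < N.+1%:R :> R by [].
  have pt : p <= t by rewrite /p lerBlDr ler_pdivrMr// truncn_le.
  have tp : t - p < N.+1%:R^-1.
    rewrite /p; have := truncnS_gt ((t + m%:R) * N.+1%:R); rewrite -/k -[k.+1%:R]natr1.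
    rewrite -ltr_pdivlMr// mulrDl mul1r; move: (k%:R / _) => x; move: (N.+1%:R^-1) => y; lra.
  have pm : `|p| <= m%:R.
    rewrite ler_norml (le_trans pt t2) andbT /p lerBrDr addNr.
    by rewrite divr_ge0.
  rewrite -(subrKA (cfun f p)); apply: (le_lt_trans (ler_normD _ _)).
  have := hN p t pm; rewrite ger0_norm ?subr_ge0// => /(_ tp).
  have := hc k; rewrite -/p; move: (`|_ - ratr _|) (`|_ - cfun f p|) (r.+1%:R^-1) => x y w; lra.
exists (pickle (((m, N), r), mkseq c L)); rewrite pickleK; split => // g gC.
apply: (@le_lt_trans _ _ (e / 2)); last lra.
apply: abs_sup_le => t tm; rewrite cfunB; have := gC t tm; have := inC t tm.
move: (ratr _) => y h1 h2; rewrite -(subrKA y); apply: (le_trans (ler_normD _ _)).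
rewrite (distrC y); have := hr r (leqnn r); move: h1 h2.
move: (`|_ - y|) (`|_ - y|) (r.+1%:R^-1) => x1 x2 w; lra.
Qed.

(** Choosing a point in each set of the countable family that meets the image of
    [v] shows that images are separable, subspaces in particular. *)
Lemma sup_norm_dense (T : Type) (v : T -> CR R) : inhabited T ->
  exists d : nat -> T, forall t m (e : R), 0 < e -> exists k, sup_norm m (v t - v (d k)) < e.
Proof.
move=> [t0]; have [B hB] := sup_norm_cover.
have ex j : exists d, (exists t, B j (v t)) -> B j (v d).
  by have [[t ht]|n] := pselect (exists t, B j (v t)); [exists t|exists t0].
have [d hd] := choice ex; exists d => t m e e0.
have [j [jt hj]] := hB (v t) m e e0; exists j; rewrite seminormC.
by apply: hj; apply: hd; exists t.
Qed.

(** * Closed subspaces *)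

Definition sub_norm (X : SF R) m : seminorm (SF_tvs X).
Proof.
apply: (@Seminorm R (SF_tvs X) (fun x : SF_tvs X => sup_norm m (val x))) => [x y|a x].
  by rewrite raddfD; exact: seminormD.
by rewrite linearZ_LR; exact: seminormZ.
Defined.

Lemma sub_normE X m (x : SF_tvs X) : sub_norm X m x = sup_norm m (val x).
Proof. by []. Qed.

Lemma sub_normB X m (x y : SF_tvs X) :
  sub_norm X m (x - y) = sup_norm m (val x - val y).
Proof. by rewrite sub_normE raddfB. Qed.

Lemma SF_frechet (X : SF R) : frechet (@sub_norm X).
Proof.
split.
- by move=> m n x mn; rewrite !sub_normE; exact: sup_norm_mono.
- move=> x A; split.
  + move=> /nbhs_initialP[B /nbhs_sup_norm[m [e [e0 hB]]] BA].
    exists m, e; split; first exact: e0.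
    by move=> y; rewrite sub_normB => xy; apply: BA; exact: (hB _ xy).
  + move=> [m [e [e0 hA]]]; apply/nbhs_initialP.
    exists [set g | sup_norm m (g - val x) < e].
      by apply/nbhs_sup_norm; exists m, e; split; [exact: e0|move=> g].
    by move=> y; have := hA y; rewrite sub_normB => h hy; exact: (h hy).
- move=> u cu; have [|x hx] := sup_norm_complete (u := fun i => val (u i)).
    move=> m e /(cu m)[N hN]; exists N => i j Ni Nj; rewrite -sub_normB.
    exact: hN.
  have Xx : x \in SF_mem X.
    rewrite /in_mem/= /SF_mem; apply/mem_set/(@SF_closed R X).
    move=> B /nbhs_sup_norm[m [e [e0 hB]]]; have [N hN] := hx m e e0.
    exists (val (u N)); split; last exact: hB (hN N (leqnn N)).
    exact/set_mem/(valP (u N)).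
  exists (Sub x Xx) => m e e0; have [N hN] := hx m e e0; exists N => i Ni.
  by rewrite sub_normB SubK; exact: hN.
- move=> x hx; apply/val_inj/val_inj/funext => t.
  have [m tm] := le_natr_bound `|t|; apply/eqP; rewrite -normr_le0 -[leRHS](hx m).
  exact: le_abs_sup.
- have [d hd] := @sup_norm_dense (SF_tvs X) val (inhabits 0).
  exists d => x m e /(hd x m)[k hk]; exists k.
  by rewrite sub_normB; exact: hk.
Qed.

End ContinuousFunctions.

Arguments sup_norm {R} m.

(** * Borel conditions *)

Section Borel.
Context (R : realType).
Implicit Types (Q : SF R -> Prop) (X : SF R).

Definition borel Q := effros_borel [set X | Q X].

Lemma borel_ext Q Q' : (forall X, Q X <-> Q' X) -> borel Q -> borel Q'.
Proof. by move=> QQ; rewrite /borel (_ : [set X | Q X] = [set X | Q' X])//; apply/eq_set => X; exact/propext. Qed.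

Lemma borel_not Q : borel Q -> borel (fun X => ~ Q X).
Proof.
by move=> /sigma_algebraCD; apply: borel_ext => X; split=> [[]|].
Qed.

Lemma borel_cst (p : Prop) : borel (fun _ => p).
Proof.
have b0 : borel (fun _ => False) by exact: sigma_algebra0.
have [hp|np] := pselect p; last by apply: borel_ext b0 => X; split.
by apply: borel_ext (borel_not b0) => X; split=> // _ [].
Qed.

Lemma borel_ex (T : countType) (Q : T -> SF R -> Prop) :
  (forall i, borel (Q i)) -> borel (fun X => exists i, Q i X).
Proof.
move=> bQ; have b0 := borel_cst False.
pose F n := [set X | if unpickle n is Some i then Q i X else False].
have : effros_borel (\bigcup_n F n).
  by apply: sigma_algebra_bigcup => n; rewrite /F; case: unpickle.
congr effros_borel; apply/seteqP; split=> [X [n _]|X [i Qi]].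
  by rewrite /F/=; case: unpickle => // i Qi; exists i.
by exists (pickle i) => //; rewrite /F/= pickleK.
Qed.

Lemma borel_all (T : countType) (Q : T -> SF R -> Prop) :
  (forall i, borel (Q i)) -> borel (fun X => forall i, Q i X).
Proof.
move=> bQ; have := borel_not (borel_ex (fun i => borel_not (bQ i))).
apply: borel_ext => X; split=> [h i|h [i]]; last exact.
by apply: contrapT => n; apply: h; exists i.
Qed.

Lemma borel_or Q Q' : borel Q -> borel Q' -> borel (fun X => Q X \/ Q' X).
Proof.
move=> b b'; have := @borel_ex bool (fun t => if t then Q else Q') (fun t => _).
move=> /(_ ltac:(by case)); apply: borel_ext => X; split=> [[[]]|[]].
- by left.
- by right.
- by exists true.
- by exists false.
Qed.

Lemma borel_and Q Q' : borel Q -> borel Q' -> borel (fun X => Q X /\ Q' X).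
Proof.
move=> b b'; have := borel_not (borel_or (borel_not b) (borel_not b')).
apply: borel_ext => X; split=> [/not_orP[/contrapT ? /contrapT ?]//|[q q'] []//].
Qed.

Lemma borel_imply Q Q' : borel Q -> borel Q' -> borel (fun X => Q X -> Q' X).
Proof.
move=> b b'; have := borel_or (borel_not b) b'; apply: borel_ext => X.
split=> [[//|//]|h]; by have [/h|] := pselect (Q X); [right|left].
Qed.

(** * Open conditions on finitely many vectors *)

Definition open_in N (W : (nat -> CR R) -> Prop) := forall x, W x ->
  exists (m : nat) (e : R), 0 < e /\
    forall y : nat -> CR R, (forall i, (i < N)%N -> sup_norm m (y i - x i) < e) -> W y.

Lemma sup_ball_open m c (e : R) : open [set g : CR R | sup_norm m (g - c) < e].
Proof.
rewrite openE => g /= ge; apply/nbhs_sup_norm.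
exists m, (e - sup_norm m (g - c)); split; first by rewrite subr_gt0.
move=> h hg; apply: (@le_lt_trans _ _ _ _ _ (seminorm_trans (sup_norm m) g h c)).
by rewrite -ltrBrDr.
Qed.

(** The condition holds on a countable union of products of balls, and whether
    [X] meets all factors of such a product is a Borel question. *)
Lemma borel_open N W : open_in N W ->
  borel (fun X => exists x : nat -> SF_tvs X, W (fun i => val (x i))).
Proof.
move=> oW; have [d hd] := @sup_norm_dense R _ idfun (inhabits 0).
pose U (k : nat * nat * nat) : set (CR R) :=
  [set g | sup_norm k.1.2 (g - d k.1.1) < k.2.+1%:R^-1].
pose ok s := forall y, (forall i, (i < N)%N -> U (nth (0, 0, 0)%N s i) (y i)) -> W y.
have bU k : borel (fun X => (X `&` U k !=set0)%classic).
  by apply: sub_sigma_algebra; exists (U k) => //; exact: sup_ball_open.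
have : borel (fun X => exists s : seq (nat * nat * nat), ok s /\
    forall i : 'I_N, (X `&` U (nth (0, 0, 0)%N s i) !=set0)%classic).
  apply: borel_ex => s; apply: borel_and; first exact: borel_cst.
  by apply: borel_all => i; exact: bU.
apply: borel_ext => X; split=> [[s [oks meet]]|[x Wx]].
- have [x hx] := choice meet.
  have Xx i : x i \in SF_mem X by have [/mem_set] := hx i.
  exists (fun i => if insub i is Some j then Sub (x j) (Xx j) else 0).
  by apply: oks => i iN; rewrite insubT /=; have [] := hx (Ordinal iN).
- have [m [e [e0 hW]]] := oW _ Wx; have e2 : 0 < e / 2 by rewrite divr_gt0.
  have [r hr] := small_invS e2.
  have [k hk] := choice (fun i => hd (val (x i)) m r.+1%:R^-1 ltac:(by rewrite invr_gt0)).
  exists (mkseq (fun i => (k i, m, r)) N); split.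
    move=> y hy; apply: hW => i iN; have := hy i iN; rewrite nth_mkseq// => h3.
    have {}h3 : sup_norm m (y i - d (k i)) < r.+1%:R^-1 := h3.
    have h2 : sup_norm m (d (k i) - val (x i)) < r.+1%:R^-1.
      by rewrite seminormC; exact: hk.
    apply: le_lt_trans (seminorm_trans (sup_norm m) (d (k i)) (y i) (val (x i))) _.
    by rewrite [e]splitr ltrD// (lt_trans _ (hr r (leqnn r))).
  move=> i; exists (val (x i)); split; first exact/set_mem/(valP (x i)).
  by rewrite nth_mkseq//; exact: hk.
Qed.

Lemma borel_open1 (W : CR R -> Prop) :
  (forall x, W x -> exists (m : nat) (e : R), 0 < e /\ forall y, sup_norm m (y - x) < e -> W y) ->
  borel (fun X => exists x : SF_tvs X, W (val x)).
Proof.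
move=> oW; have : borel (fun X => exists x : nat -> SF_tvs X, W (val (x 0%N))).
  apply: (@borel_open 1 (fun x => W (x 0%N))) => x /oW[m [e [e0 h]]].
  by exists m, e; split => // y hy; apply: h; exact: hy.
by apply: borel_ext => X; split=> [[x Wx]|[x Wx]]; [exists (x 0%N)|exists (fun=> x)].
Qed.

(** * Conditions on the seminorms *)

Lemma sup_norm_comb N (x y : nat -> CR R) m (d : R) a :
  (forall i, (i < N)%N -> sup_norm m (y i - x i) < d) ->
  `|sup_norm m (comb N a y) - sup_norm m (comb N a x)| <= d * l1 N a.
Proof.
move=> h; have : sup_norm m (comb N a y - comb N a x) <= d * l1 N a.
  rewrite -combB; apply: seminorm_lin => i iN; exact/ltW/h.
have := seminorm_trans (sup_norm m) (comb N a x) (comb N a y) 0.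
have := seminorm_trans (sup_norm m) (comb N a y) (comb N a x) 0.
rewrite !subr0 (seminormC _ (comb N a x)) ler_norml => h1 h2 h3.
by apply/andP; split; lra.
Qed.

Lemma val_comb X N a (x : nat -> SF_tvs X) :
  val (comb N a x) = comb N a (fun i => val (x i)).
Proof. by rewrite /comb raddf_sum. Qed.

(** The margin in [dominates] absorbs a small change of the vectors. *)
Lemma borel_dominates n k (c : R) N : 0 <= c ->
  borel (fun X => dominates (@sub_norm R X) n k c N).
Proof.
move=> c0; pose W (x : nat -> CR R) := exists e : R, 0 < e /\ forall a,
  c * sup_norm k (comb N a x) + e * l1 N a <= sup_norm n (comb N a x).
have : borel (fun X => exists x : nat -> SF_tvs X, W (fun i => val (x i))).
  apply: (@borel_open N) => x [e [e0 hx]].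
  have c1 : 0 < c + 1 by rewrite ltr_wpDl.
  have [d [d0 de]] : exists d : R, 0 < d /\ d * (c + 1) = e / 2.
    exists (e / 2 / (c + 1)); split; first by rewrite !divr_gt0.
    by rewrite divfK// gt_eqF.
  exists (maxn n k), d; split => // y hy; exists (e / 2); split; first by rewrite divr_gt0.
  move=> a; have close m : (m <= maxn n k)%N ->
      `|sup_norm m (comb N a y) - sup_norm m (comb N a x)| <= d * l1 N a.
    by move=> mle; apply: sup_norm_comb => i iN; exact: le_lt_trans (sup_norm_mono _ mle) (hy i iN).
  have := close n (leq_maxl _ _); have := close k (leq_maxr _ _).
  rewrite !ler_norml => /andP[_ h1] /andP[h2 _]; have := hx a.
  have := l1_ge0 N a; move: h1 h2.
  move: (sup_norm k _) (sup_norm k _) (sup_norm n _) (sup_norm n _) (l1 N a) => k1 k2 n1 n2 l.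
  move=> h1 h2 l0 h3.
  have := ler_wpM2l c0 h1; have : d * (c + 1) * l = e / 2 * l by rewrite de.
  nra.
by apply: borel_ext => X; split=> -[x [e [e0 hx]]]; exists x, e; split => // a;
  have := hx a; rewrite -?val_comb.
Qed.

Lemma borel_non_schwartz : borel (fun X => non_schwartz (@sub_norm R X)).
Proof.
apply: borel_ex => n; apply: borel_all => k; apply: borel_ex => j.
by apply: borel_all => N; apply: borel_dominates; rewrite invr_ge0.
Qed.

Lemma borel_infinite_steps : borel (fun X => infinite_steps (@sub_norm R X)).
Proof.
apply: borel_all => m; apply: borel_ex => n; apply: borel_all => j.
by apply: borel_all => N; exact: borel_dominates.
Qed.

Lemma borel_normable : borel (fun X => normable (@sub_norm R X)).
Proof.
apply: borel_ex => m; apply: borel_all => n; apply: borel_ex => C.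
apply: (borel_ext _ (borel_not
    (@borel_open1 (fun x => C%:R * sup_norm m x < sup_norm n x) _))) => [X|x hx].
  split=> [h x|h [x]]; last by rewrite ltNge; move/negP; apply; exact: h.
  by rewrite leNgt; apply/negP => hx; apply: h; exists x.
pose g := sup_norm n x - C%:R * sup_norm m x.
have g0 : 0 < g by rewrite subr_gt0.
have c1 : 0 < C%:R + 1 :> R by rewrite ltr_wpDl.
exists (maxn m n), (g / (C%:R + 1)); split; first by rewrite divr_gt0.
move=> y; rewrite ltr_pdivlMr// => yx.
have hm := le_trans (seminormD (sup_norm m) (y - x) x)
  (lerD (sup_norm_mono _ (leq_maxl m n)) (lexx _)).
have hn := le_trans (seminormD (sup_norm n) (x - y) y)
  (lerD (sup_norm_mono _ (leq_maxr m n)) (lexx _)).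
rewrite subrK in hm; rewrite subrK (seminormC _ x y) in hn.
have C0 : 0 <= C%:R :> R by [].
have := ler_wpM2l C0 hm; move: yx hn; rewrite /g.
move: (sup_norm (maxn m n) _) => t; rewrite !mulrDr mulr1; lra.
Qed.

(** The approximating form may be kept when the vectors move a little, so that the
    nonexistence of one is an open condition. *)
Lemma borel_hilb_between m n (C : R) : 0 <= C ->
  borel (fun X => hilb_between (@sub_norm R X) m n C).
Proof.
move=> C0; pose form (x : nat -> CR R) N (e : R) (q : nat -> nat -> R) := forall a,
  sup_norm m (comb N a x) ^+ 2 <= bilin N q a a + e * l1 N a ^+ 2 /\
  bilin N q a a <= C * sup_norm n (comb N a x) ^+ 2 + e * l1 N a ^+ 2.
pose W N x := exists e : R, 0 < e /\ ~ exists q, form x N e q.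
have : borel (fun X => forall N, ~ exists x : nat -> SF_tvs X, W N (fun i => val (x i))).
  apply: borel_all => N; apply: borel_not; apply: (@borel_open N) => x [e [e0 nq]].
  pose M := \sum_(i < N) sup_norm (maxn m n) (x i).
  have M0 : 0 <= M by apply: sumr_ge0 => i _; exact: (seminorm_ge0 (sup_norm _)).
  have bx k a : (k <= maxn m n)%N -> sup_norm k (comb N a x) <= M * l1 N a.
    move=> kmn; apply: seminorm_lin => i iN; apply: (le_trans (sup_norm_mono _ kmn)).
    rewrite /M (bigD1 (Ordinal iN))//= lerDl.
    by apply: sumr_ge0 => j _; exact: (seminorm_ge0 (sup_norm _)).
  have [d [d0 d1 de]] : exists d : R, [/\ 0 < d, d <= 1 & (C + 1) * (d * (2 * M + 1)) <= e / 2].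
    have k0 : 0 < (C + 1) * (2 * M + 1) by rewrite mulr_gt0// ltr_wpDl// mulr_ge0.
    exists (Num.min 1 (e / 2 / ((C + 1) * (2 * M + 1)))).
    rewrite lt_min ltr01 !divr_gt0//= ge_min lexx; split => //.
    by rewrite mulrCA -ler_pdivlMr// ge_min lexx orbT.
  exists (maxn m n), d; split => // y hy; exists (e / 2); split; first by rewrite divr_gt0.
  move=> [q hq]; apply: nq; exists q => a; have [h1 h2] := hq a.
  have sq k : (k <= maxn m n)%N -> `|sup_norm k (comb N a y) ^+ 2 - sup_norm k (comb N a x) ^+ 2|
      <= d * (2 * M + 1) * l1 N a ^+ 2.
    move=> kmn; have kb := bx k a kmn.
    have : `|sup_norm k (comb N a y) - sup_norm k (comb N a x)| <= d * l1 N a.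
      by apply: sup_norm_comb => i iN; exact: le_lt_trans (sup_norm_mono _ kmn) (hy i iN).
    have := seminorm_ge0 (sup_norm k) (comb N a x); have := seminorm_ge0 (sup_norm k) (comb N a y).
    move: kb; rewrite subr_sqr normrM.
    move: (sup_norm k (comb N a x)) (sup_norm k (comb N a y)) => u v uM v0 u0 uv.
    have l0 := l1_ge0 N a.
    rewrite (ger0_norm (addr_ge0 v0 u0)).
    have -> : d * (2 * M + 1) * l1 N a ^+ 2 = d * l1 N a * ((2 * M + 1) * l1 N a).
      by rewrite expr2; ring.
    apply: ler_pM => //; first exact: addr_ge0.
    move: uv; rewrite ler_norml => /andP[_ uv]; have := ler_wpM2r l0 d1; lra.
  have := sq m (leq_maxl _ _); have := sq n (leq_maxr _ _).
  rewrite !ler_norml => /andP[_ n1] /andP[m1 _].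
  have l0 := sqr_ge0 (l1 N a); have K0 : 0 <= d * (2 * M + 1) by rewrite mulr_ge0 ?ltW// ltr_wpDl// mulr_ge0.
  have de' := ler_wpM2r l0 de; have CK := mulr_ge0 C0 (mulr_ge0 K0 l0).
  have Cn := ler_wpM2l C0 n1; have Kl := mulr_ge0 K0 l0.
  move: h1 h2 n1 m1 l0 de' CK Cn Kl; rewrite !mulrDl !mul1r -!mulrA.
  move: (sup_norm m _ ^+ 2) (sup_norm m _ ^+ 2) (sup_norm n _ ^+ 2) (sup_norm n _ ^+ 2).
  move: (l1 N a ^+ 2) (bilin _ _ _ _) => l b m1 m2 n1 n2; rewrite mulrBr.
  by move=> *; split; lra.
apply: borel_ext => X; split=> [h N x e e0|h N [x [e [e0]]]].
  apply: contrapT => nq; apply: (h N); exists x, e; split => // -[q hq]; apply: nq.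
  by exists q => a; have := hq a; rewrite -!val_comb -!sub_normE.
apply; have [q hq] := h N x e e0.
by exists q => a; have := hq a; rewrite !sub_normE !val_comb.
Qed.

Lemma borel_hilbertizable : borel (fun X => hilbertizable (@sub_norm R X)).
Proof.
apply: borel_all => m; apply: borel_ex => n; apply: borel_ex => C.
exact: borel_hilb_between.
Qed.

Lemma open_ball k (c : CR R) (r : R) x : sup_norm k (x - c) < r ->
  exists e : R, 0 < e /\ forall y, sup_norm k (y - x) < e -> sup_norm k (y - c) < r.
Proof.
move=> xc; exists (r - sup_norm k (x - c)); split; first by rewrite subr_gt0.
move=> y yx; apply: (@le_lt_trans _ _ _ _ _ (seminorm_trans (sup_norm k) x y c)).
by rewrite -ltrBrDr.
Qed.

Lemma open_ball2 k l (c d : CR R) (r s : R) x :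
  sup_norm k (x - c) < r -> sup_norm l (x - d) < s ->
  exists (m : nat) (e : R), 0 < e /\ forall y, sup_norm m (y - x) < e ->
    sup_norm k (y - c) < r /\ sup_norm l (y - d) < s.
Proof.
move=> /open_ball[e1 [e10 h1]] /open_ball[e2 [e20 h2]].
exists (maxn k l), (Num.min e1 e2); rewrite lt_min e10; split => // y.
rewrite lt_min => /andP[y1 y2]; split.
  by apply: h1; apply: le_lt_trans y1; exact: sup_norm_mono (leq_maxl _ _).
by apply: h2; apply: le_lt_trans y2; exact: sup_norm_mono (leq_maxr _ _).
Qed.

(** It is enough to test the condition on the traces on [X] of the balls of a
    countable base, which is a question about these balls only. *)
Lemma borel_quojective : borel (fun X => quojective (@sub_norm R X)).
Proof.
apply: borel_all => m; apply: borel_ex => n; apply: borel_all => k; apply: borel_ex => C.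
have [d hd] := @sup_norm_dense R _ idfun (inhabits 0).
pose U i j (g : CR R) := sup_norm m (g - d i) < j.+1%:R^-1.
have : borel (fun X => forall ij : nat * nat,
    (exists x : SF_tvs X, U ij.1 ij.2 (val x) /\ sup_norm n (val x - 0) < 1) ->
    exists y : SF_tvs X, sup_norm k (val y - 0) < C%:R /\
      exists u, U ij.1 ij.2 u /\ sup_norm m (u - val y) < ij.2.+1%:R^-1).
  apply: borel_all => -[i j]; apply: borel_imply.
    apply: (@borel_open1 (fun x => U i j x /\ sup_norm n (x - 0) < 1)) => x [xU x1].
    exact: open_ball2.
  apply: (@borel_open1 (fun y => sup_norm k (y - 0) < C%:R /\
    exists u, U i j u /\ sup_norm m (u - y) < j.+1%:R^-1)) => y [yC [u [uU uy]]].
  rewrite seminormC in uy; have [l [e [e0 he]]] := open_ball2 yC uy.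
  exists l, e; split; first exact: e0.
  move=> z /he[zC zu]; split; first exact: zC.
  by exists u; split; [exact: uU|rewrite seminormC; exact: zu].
apply: borel_ext => X; split=> [h x e e0 Px|h [i j] [x [xU x1]]].
- have e3 : 0 < e / 3 by rewrite divr_gt0.
  have [j hj] := small_invS e3; have := hj j (leqnn j) => {}hj.
  have [|i hi] := hd (val x) m j.+1%:R^-1; first by rewrite invr_gt0.
  have [|y [yC [u [uU uy]]]] := h (i, j).
    by exists x; split; [exact: hi|rewrite subr0].
  exists y; split; first by move: yC; rewrite subr0.
  have t1 := seminorm_trans (sup_norm m) u (val x) (val y).
  have t2 := seminorm_trans (sup_norm m) (d i) (val x) u.
  have hi' : sup_norm m (val x - d i) < j.+1%:R^-1 := hi.
  have uU' : sup_norm m (d i - u) < j.+1%:R^-1 by rewrite seminormC; exact: uU.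
  have uy' : sup_norm m (u - val y) < j.+1%:R^-1 := uy.
  rewrite sub_normB; apply: (le_lt_trans t1).
  have -> : e = e / 3 + e / 3 + e / 3 by field.
  apply: ltrD; last exact: lt_trans uy' hj.
  by apply: (le_lt_trans t2); apply: ltrD; [exact: lt_trans hi' hj|exact: lt_trans uU' hj].
- have j0 : 0 < j.+1%:R^-1 :> R by rewrite invr_gt0.
  have Px : sub_norm X n x < 1 by rewrite sub_normE; rewrite subr0 in x1.
  have [y [yC xy]] := h x _ j0 Px; exists y; split; first by rewrite subr0 -sub_normE.
  by exists (val x); split; [exact: xU|rewrite -sub_normB].
Qed.

End Borel.

Theorem theorem4p6 (R : realType) :
  [/\ effros_borel (FH R),
      effros_borel (iso_class (real_seq R)),
      effros_borel (iso_class (ell2_seq R)) &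
      effros_borel (iso_class (ell2_plus_real_seq R))].
Proof.
have bH := @borel_hilbertizable R; have bQ := @borel_quojective R.
have bS := @borel_non_schwartz R; have bI := @borel_infinite_steps R.
have bN := @borel_normable R; split.
- have := borel_and bH (borel_or bQ bS); apply: borel_ext => X.
  exact: iff_sym (frechet_hilbertP (SF_frechet X)).
- have := borel_and bH (borel_and bQ (borel_and (borel_not bS) (borel_not bN))).
  apply: borel_ext => X; apply: iff_trans (iff_sym (real_seqP (SF_frechet X))).
  by split=> [[? [? []]]|[]].
- have := borel_and bH (borel_and bQ bI).
  apply: borel_ext => X; apply: iff_trans (iff_sym (ell2_seqP (SF_frechet X))).
  by split=> [[? []]|[]].
- have := borel_and bH (borel_and bQ (borel_and bS (borel_and (borel_not bI) (borel_not bN)))).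
  apply: borel_ext => X; apply: iff_trans (iff_sym (ell2_plusP (SF_frechet X))).
  by split=> [[? [? [? []]]]|[]].
Qed.
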